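(* Let $r\ge1$, $s\ge0$, let $a$, $b_1,\dots,b_r$, $c$, $d$, $e_1,\dots,e_r$, $f_1,\dots,f_r$, $z_1,\dots,z_r$, $h_1,\dots,h_s$ be indeterminates, let $N_1,\dots,N_s$ be nonnegative integers, $|N|=\sum_{i=1}^sN_i$, and suppose none of the denominators below vanishes. Set $B=b_1\cdots b_r$, $E=e_1\cdots e_r$, $F=f_1\cdots f_r$. Then, provided $|a^{r+1}q^{1-|N|}/BcdE|<1$, \begin{multline*} {}_{6+2s}\Psi_{6+2s}^{(r)}\bigg[a;b_1,\dots,b_r;c,d;e_1,\dots,e_r;z_1,\dots,z_r;\frac{aq^{1+N_1}}{h_1},\dots,\frac{aq^{1+N_s}}{h_s};h_1,\dots,h_s\bigg|\,q,\frac{a^{r+1}q^{1-|N|}}{BcdE}\bigg]\\ =\prod_{j=1}^s\left[\frac{(Fq/h_j;q)_{N_j}}{(q/h_j;q)_{N_j}}\prod_{i=1}^r\frac{(az_iq/f_ih_j;q)_{N_j}}{(az_iq/h_j;q)_{N_j}}\right] \frac{(Fq/d,aq/cF;q)_{\infty}}{(aq/c,q/d;q)_{\infty}} \prod_{i,j=1}^r\frac{(qz_i/z_j,az_iq/e_jf_iz_j,f_jz_iq/b_iz_j;q)_{\infty}}{(qf_jz_i/f_iz_j,qz_i/b_iz_j,az_iq/e_jz_j;q)_{\infty}}\\ \times\prod_{i=1}^r\frac{(az_iq,q/az_i,Fq/e_iz_i,az_iq/b_iF,az_iq/df_i,f_iq/cz_i;q)_{\infty}}{(Ff_iq/az_i,az_iq/Ff_i,az_iq/b_i,q/e_iz_i,q/cz_i,az_iq/d;q)_{\infty}}\\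 \times{}_{6+2s}\Psi_{6+2s}^{(r)}\bigg[\frac Fa;\frac{e_1f_1}a,\dots,\frac{e_rf_r}a;\frac da,\frac{cF}a;\frac{b_1F}{af_1},\dots,\frac{b_rF}{af_r};\frac{f_1}{z_1},\dots,\frac{f_r}{z_r};\frac{h_1}a,\dots,\frac{h_s}a;\frac{Fq^{1+N_1}}{h_1},\dots,\frac{Fq^{1+N_s}}{h_s}\bigg|\,q,\frac{a^{r+1}q^{1-|N|}}{BcdE}\bigg]. \end{multline*}
   Context: Fix $q\in\mathbb C$ with $0<|q|<1$. Define $(x;q)_\infty=\prod_{j\ge0}(1-xq^j)$ and, for any integer $k$, $(x;q)_k=(x;q)_\infty/(xq^k;q)_\infty$; write $(x_1,\dots,x_m;q)_k=(x_1;q)_k\cdots(x_m;q)_k$ (also for $k=\infty$). For $\mathbf k\in\mathbb Z^r$ let $|\mathbf k|=k_1+\dots+k_r$. For indeterminates $a,b_1,\dots,b_r,c,d,e_1,\dots,e_r,z_1,\dots,z_r,g_1,\dots,g_s,h_1,\dots,h_s,w$ define \begin{multline*} {}_{6+2s}\Psi_{6+2s}^{(r)}\big[a;b_1,\dots,b_r;c,d;e_1,\dots,e_r;z_1,\dots,z_r;g_1,\dots,g_s;h_1,\dots,h_s\big|\,q,w\big]\\ :=\sum_{k_1,\dots,k_r=-\infty}^{\infty}\Bigg(\prod_{1\le i<j\le r}\frac{z_iq^{k_i}-z_jq^{k_j}}{z_i-z_j}\prod_{i=1}^r\frac{1-az_iq^{k_i+|\mathbf k|}}{1-az_i} \prod_{i,j=1}^r\frac{(b_jz_i/z_j;q)_{k_i}}{(az_iq/e_jz_j;q)_{k_i}}\prod_{i=1}^r\frac{(e_iz_i;q)_{|\mathbf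 k|}}{(az_iq/b_i;q)_{|\mathbf k|}}\\ \times\prod_{i=1}^r\frac{(cz_i,g_1z_i,\dots,g_sz_i;q)_{k_i}}{(az_iq/d,az_iq/h_1,\dots,az_iq/h_s;q)_{k_i}}\cdot\frac{(d,h_1,\dots,h_s;q)_{|\mathbf k|}}{(aq/c,aq/g_1,\dots,aq/g_s;q)_{|\mathbf k|}}\,w^{|\mathbf k|}\Bigg). \end{multline*} *)

(* Defs.v *)
From mathcomp Require Import all_boot all_order all_algebra.
From mathcomp Require Import all_classical all_reals all_analysis.
From mathcomp Require Import complex.
Import Order.TTheory GRing.Theory Num.Theory.
Import numFieldNormedType.Exports.

Set Implicit Arguments.
Unset Strict Implicit.
Unset Printing Implicit Defensive.

Local Open Scope ring_scope.
Local Open Scope classical_set_scope.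

(* The complex numbers over a real field R, seen as a numClosedFieldType so that
   the norm topology of mathcomp-analysis applies. *)
Definition Cx (R : realType) : numClosedFieldType := (R[i])%C.

Section QSeries.
Variable R : realType.
Local Notation C := (Cx R).

Definition qpoch_n (q x : C) (n : nat) : C := \prod_(j < n) (1 - x * q ^+ j).

(* (x;q)_k = (x;q)_oo / (x q^k;q)_oo for k : int, written as the usual finite
   products: numerator part and denominator part. *)
Definition qpoch_num (q x : C) (k : int) : C :=
  match k with Posz n => qpoch_n q x n | Negz _ => 1 end.
Definition qpoch_den (q x : C) (k : int) : C :=
  match k with Posz _ => 1 | Negz m => \prod_(j < m.+1) (1 - x * q ^- j.+1) end.
Definition qpoch (q x : C) (k : int) : C := qpoch_num q x k / qpoch_den q x k.

Definition qpinf (q x : C) : C := lim (qpoch_n q x n @[n --> \oo]).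

Definition ksum (r : nat) (k : 'I_r -> int) : int := \sum_(i < r) k i.

Definition psi_term (q : C) (r s : nat) (a : C) (b : 'I_r -> C) (c d : C)
    (e z : 'I_r -> C) (g h : 'I_s -> C) (w : C) (k : 'I_r -> int) : C :=
  let K := ksum k in
  (\prod_(i < r) \prod_(j < r | (i < j)%N)
      ((z i * q ^ (k i) - z j * q ^ (k j)) / (z i - z j)))
  * (\prod_(i < r) ((1 - a * z i * q ^ (k i + K)) / (1 - a * z i)))
  * (\prod_(i < r) \prod_(j < r)
      (qpoch q (b j * z i / z j) (k i) / qpoch q (a * z i * q / (e j * z j)) (k i)))
  * (\prod_(i < r) (qpoch q (e i * z i) K / qpoch q (a * z i * q / b i) K))
  * (\prod_(i < r)
      ((qpoch q (c * z i) (k i) * \prod_(l < s) qpoch q (g l * z i) (k i))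
       / (qpoch q (a * z i * q / d) (k i)
          * \prod_(l < s) qpoch q (a * z i * q / h l) (k i))))
  * ((qpoch q d K * \prod_(l < s) qpoch q (h l) K)
     / (qpoch q (a * q / c) K * \prod_(l < s) qpoch q (a * q / g l) K))
  * w ^ K.

Definition psi_partial (q : C) (r s : nat) (a : C) (b : 'I_r -> C) (c d : C)
    (e z : 'I_r -> C) (g h : 'I_s -> C) (w : C) (n : nat) : C :=
  \sum_(t : {ffun 'I_r -> 'I_(n + n).+1})
     psi_term q a b c d e z g h w (fun i => (t i)%:Z - n%:Z).

(* "none of the denominators of the Psi series vanishes": for a Pochhammer
   symbol in a numerator, its (negative-index) denominator part is nonzero;
   for a Pochhammer symbol in a denominator, its (nonneg-index) product is
   nonzero; and 1 - a z_i, z_i - z_j (i <> j) are nonzero. *)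
Definition num_ok (q x : C) (k : int) : Prop := qpoch_den q x k != 0.
Definition den_ok (q x : C) (k : int) : Prop := qpoch_num q x k != 0.

Definition psi_denoms_ok (q : C) (r s : nat) (a : C) (b : 'I_r -> C) (c d : C)
    (e z : 'I_r -> C) (g h : 'I_s -> C) : Prop :=
  (forall i, 1 - a * z i != 0) /\
  (forall i j : 'I_r, i != j -> z i - z j != 0) /\
  forall k : 'I_r -> int,
    (forall i j, num_ok q (b j * z i / z j) (k i)
                 /\ den_ok q (a * z i * q / (e j * z j)) (k i)) /\
    (forall i, num_ok q (e i * z i) (ksum k) /\ den_ok q (a * z i * q / b i) (ksum k)
               /\ num_ok q (c * z i) (k i) /\ den_ok q (a * z i * q / d) (k i)
               /\ (forall l, num_ok q (g l * z i) (k i)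
                             /\ den_ok q (a * z i * q / h l) (k i))) /\
    num_ok q d (ksum k) /\ den_ok q (a * q / c) (ksum k) /\
    (forall l, num_ok q (h l) (ksum k) /\ den_ok q (a * q / g l) (ksum k)).

End QSeries.

(* Main.v *)
Require Import Defs.
From mathcomp Require Import all_boot all_order all_algebra.
From mathcomp Require Import all_classical all_reals all_analysis.
From mathcomp Require Import perm cyclic separable cyclotomic.
From mathcomp Require Import complex.
From mathcomp Require Import zify ring lra.
Import Order.TTheory GRing.Theory Num.Theory.
Import numFieldNormedType.Exports.
Set Implicit Arguments.
Unset Strict Implicit.
Unset Printing Implicit Defensive.
Local Open Scope ring_scope.
Local Open Scope classical_set_scope.

(** Put x_0 = 1/a, x_i = z_i (1 <= i <= r) and n = r + 1.  The left-hand series becomes a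
    sum over k in Z^n with |k| = 0 of a Vandermonde determinant in x_i q^(k_i) times a product
    of one-variable weights tau_(k_i)(x_i), and reversing k turns the right-hand series into
    the same sum at the point y_0 = F/a, y_i = z_i/f_i, which has the same product of
    coordinates.  For |w| < |v| < 1 the generating function with an extra factor v^|k| is the
    determinant of the bilateral series psi_j(x_i; v).  As functions of x these psi_j lie in
    one n-dimensional space of theta functions f(qx) = const x^(-n) f(x), and so does, in each
    variable, the alternating product
      prod_(i<j) x_j theta(x_i/x_j) * theta(v prod_j A_j prod_i x_i).
    Hence the two are proportional, with a factor independent of x.  Extracting the constant
    term in v, by averaging over roots of unity, shows that the sum over |k| = 0 divided by
    prod_(i<j) x_j theta(x_i/x_j) depends on x only through the product of the x_i. *)

(** * Complex modulus and limits *)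

(** Complex analysis enters only through averages over roots of unity: they are exact on Laurent
    polynomials, and their limits do not depend on the circle, which takes the place of Cauchy's
    theorem. The space of theta functions has dimension at most n because the functional equation
    ties the Laurent coefficient of index m to that of index m + n. Pochhammer quotients have poles
    in x, whereas that argument needs functions holomorphic off 0. Hence the weights tau carry extra
    infinite products that are independent of k and clear the poles. The ratio of these products at
    y and at x, times the ratio of the two theta products, is the prefactor of the theorem. The
    range of v is forced: the terms decay like |v|^k as k tends to plus infinity and like
    (|w|/|v|)^|k| as k tends to minus infinity. Inside this range |v| must also avoid the moduli of
    the zeros of theta(v prod_j A_j prod_i x_i), because this factor, common to x and y, has to be
    cancelled on a whole circle before the constant term is taken. *)

Section Modulus.
Variable R : realType.
Local Notation C := (Cx R).

(** The norm of [Cx R] takes values in [Cx R] itself; its real part puts estimates in the ordered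
    field [R], where [lra] and the real exponential apply. *)
Definition md (x : C) : R := complex.Re (`|x| : R[i]%C).

Lemma normE_md (x : C) : `|x| = (md x)%:C%C.
Proof. by rewrite /md normc_def. Qed.

Lemma md0 : md 0 = 0. Proof. by rewrite /md normr0. Qed.
Lemma md1 : md 1 = 1. Proof. by rewrite /md normr1. Qed.

Lemma mdM x y : md (x * y) = md x * md y.
Proof.
apply: complexI; rewrite rmorphM -!normE_md; exact: normrM.
Qed.

Lemma md_ge0 x : 0 <= md x.
Proof. by rewrite -lecR -normE_md normr_ge0. Qed.

Lemma ler_mdD x y : md (x + y) <= md x + md y.
Proof. by rewrite -lecR rmorphD -!normE_md ler_normD. Qed.

Lemma mdN x : md (- x) = md x.
Proof. by rewrite /md normrN. Qed.

Lemma mdB x y : md (x - y) = md (y - x).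
Proof. by rewrite /md distrC. Qed.

Lemma ler_mdB x y : md (x - y) <= md x + md y.
Proof. by rewrite -(mdN y) ler_mdD. Qed.

Lemma ler_dist_md x y z : md (x - z) <= md (x - y) + md (y - z).
Proof. by rewrite -[x - z](subrKA y) ler_mdD. Qed.

Lemma md_eq0 x : (md x == 0) = (x == 0).
Proof. by rewrite -[RHS]normr_eq0 normE_md -(inj_eq (@complexI R)). Qed.

Lemma md_gt0 x : (0 < md x) = (x != 0).
Proof. by rewrite lt_def md_ge0 andbT md_eq0. Qed.

Lemma md_neq0 x : x != 0 -> md x != 0. Proof. by rewrite md_eq0. Qed.

Lemma mdV x : md x^-1 = (md x)^-1.
Proof.
have [->|x0] := eqVneq x 0; first by rewrite !invr0 md0 invr0.
by apply: (mulIf (md_neq0 x0)); rewrite -mdM !mulVf ?md1 ?md_eq0.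
Qed.

Lemma mdX x n : md (x ^+ n) = md x ^+ n.
Proof. by elim: n => [|n IH]; rewrite ?expr0 ?md1 // !exprS mdM IH. Qed.

Lemma mdXz x (n : int) : md (x ^ n) = md x ^ n.
Proof. by case: n => n; rewrite ?NegzE -?exprnP ?exprnN ?mdV mdX. Qed.

Lemma md_prod I (r : seq I) (P : pred I) (F : I -> C) :
  md (\prod_(i <- r | P i) F i) = \prod_(i <- r | P i) md (F i).
Proof. by elim/big_rec2: _ => [|i y x _ <-]; rewrite ?md1 // mdM. Qed.

Lemma ler_md_sum I (r : seq I) (P : pred I) (F : I -> C) :
  md (\sum_(i <- r | P i) F i) <= \sum_(i <- r | P i) md (F i).
Proof.
elim/big_rec2: _ => [|i y x _ H]; first by rewrite md0.
by apply: le_trans (ler_mdD _ _) _; rewrite lerD2l.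
Qed.

Lemma md_natr n : md n%:R = n%:R.
Proof.
by apply: complexI; rewrite -normE_md normr_nat rmorph_nat.
Qed.

Lemma md_realC (t : R) : md (t%:C%C) = `|t|.
Proof. by rewrite /md normc_def /= expr0n addr0 sqrtr_sqr. Qed.

Lemma md_lt1 (x : C) : (`|x| < 1) = (md x < 1).
Proof. by rewrite normE_md -ltcR. Qed.

Lemma Re_le_md (x : C) : `|complex.Re x| <= md x.
Proof.
rewrite /md normc_def /= -sqrtr_sqr ler_wsqrtr // lerDl sqr_ge0 //.
Qed.

Lemma Im_le_md (x : C) : `|complex.Im x| <= md x.
Proof.
rewrite /md normc_def /= -sqrtr_sqr ler_wsqrtr // lerDr sqr_ge0 //.
Qed.

Lemma md_le_ReIm (x : C) : md x <= `|complex.Re x| + `|complex.Im x|.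
Proof.
rewrite -ler_sqr ?nnegrE ?addr_ge0 ?md_ge0 //.
have -> : md x ^+ 2 = complex.Re x ^+ 2 + complex.Im x ^+ 2.
  by rewrite /md normc_def /= sqr_sqrtr // addr_ge0 ?sqr_ge0.
rewrite sqrrD !real_normK ?num_real //.
have := mulr_ge0 (normr_ge0 (complex.Re x)) (normr_ge0 (complex.Im x)).
by move=> H; rewrite addrAC lerDl mulrn_wge0.
Qed.

(** Real tolerances and explicit ranks allow several limits to be combined with estimates uniform in
    a parameter; [tendsP] returns to the filter form. *)
Definition tends (u : nat -> C) (l : C) :=
  forall e : R, 0 < e -> exists N, forall n, (N <= n)%N -> md (u n - l) <= e.

Lemma tendsP (u : nat -> C) l : tends u l <-> u n @[n --> \oo] --> l.
Proof.
split=> [ul|/cvgrPdist_le ul e e0].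
  apply/cvgrPdist_le => e e0.
  have [k ek] : exists k : R, e = k%:C%C by apply/complex_realP/gtr0_real.
  have k0 : 0 < k by rewrite -ltcR -ek.
  have [N HN] := ul k k0.
  by exists N => //= n Nn; rewrite normE_md ek lecR mdB HN.
have ec : (0 : C) < (e%:C%C : C) by rewrite ltcR.
have [N _ HN] := ul _ ec.
exists N => n Nn; have := HN n Nn; by rewrite /= normE_md mdB => H; rewrite -lecR.
Qed.

Lemma eps_eq0 (x : C) : (forall e : R, 0 < e -> md x <= e) -> x = 0.
Proof.
move=> H; apply/eqP; rewrite -md_eq0; apply/eqP/le_anti; rewrite md_ge0 andbT.
by apply/ler_addgt0Pl => e e0; rewrite addr0 H.
Qed.

Lemma tends_unique u l l' : tends u l -> tends u l' -> l = l'.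
Proof.
move=> ul ul'; apply/eqP; rewrite -subr_eq0; apply/eqP/eps_eq0 => e e0.
have e2 : 0 < e / 2 by rewrite divr_gt0.
have [N HN] := ul _ e2; have [N' HN'] := ul' _ e2.
apply: le_trans (ler_dist_md _ (u (maxn N N')) _) _.
by rewrite [leRHS]splitr lerD // ?[md (l - _)]mdB ?HN ?HN' ?leq_maxl ?leq_maxr.
Qed.

Lemma tends_cst l : tends (fun _ => l) l.
Proof. by move=> e e0; exists 0%N => n _; rewrite subrr md0 ltW. Qed.

Lemma tendsD u v l l' : tends u l -> tends v l' -> tends (fun n => u n + v n) (l + l').
Proof.
move=> ul vl e e0; have e2 : 0 < e / 2 by rewrite divr_gt0.
have [N HN] := ul _ e2; have [N' HN'] := vl _ e2.
exists (maxn N N') => n; rewrite geq_max => /andP[Nn N'n].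
rewrite opprD addrACA; apply: le_trans (ler_mdD _ _) _.
by rewrite [leRHS]splitr lerD ?HN ?HN'.
Qed.

Lemma tendsZ a u l : tends u l -> tends (fun n => a * u n) (a * l).
Proof.
move=> ul e e0; have a1 : 0 < md a + 1 by rewrite ltr_wpDl ?md_ge0.
have [N HN] := ul (e / (md a + 1)) (divr_gt0 e0 a1).
exists N => n Nn; rewrite -mulrBr mdM.
apply: (@le_trans _ _ ((md a + 1) * (e / (md a + 1)))).
  by rewrite ler_pM ?md_ge0 ?HN // lerDl.
by rewrite mulrCA divff ?mulr1 ?gt_eqF.
Qed.

Lemma tends_le u l M : tends u l -> (forall n, md (u n) <= M) -> md l <= M.
Proof.
move=> ul uM; apply/ler_addgt0Pl => e e0; have [N HN] := ul e e0.
rewrite -[l](subrK (u N)); apply: le_trans (ler_mdD _ _) _.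
by rewrite lerD // mdB HN.
Qed.

Lemma eq_tends u v l : (forall n, u n = v n) -> tends u l -> tends v l.
Proof. by move=> uv ul e /ul[N HN]; exists N => n /HN; rewrite uv. Qed.

Lemma tends_shift u l k : tends u l -> tends (fun n => u (n + k)%N) l.
Proof.
by move=> ul e /ul[N HN]; exists N => n Nn; apply: HN; rewrite (leq_trans Nn) ?leq_addr.
Qed.

(** Completeness is inherited from [R]: real and imaginary parts do not increase distances, and
    together they bound the modulus. *)
Lemma cauchy_tends (u : nat -> C) :
  (forall e : R, 0 < e -> exists N, forall m n, (N <= m)%N -> (N <= n)%N -> md (u m - u n) <= e) ->
  exists l, tends u l.
Proof.
move=> cu.
have real_part (f : C -> R) : (forall x y, f (x - y) = f x - f y) ->
    (forall x, `|f x| <= md x) -> exists l : R, f (u n) @[n --> \oo] --> l.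
  move=> fB fle; apply/cvg_ex; apply/cauchy_cvgP/cauchy_ballP => e e0.
  have e2 : 0 < e / 2 by rewrite divr_gt0.
  have [N HN] := cu _ e2.
  have H : \forall m \near \oo & n \near \oo, ball (f (u m)) e (f (u n)).
    exists ([set m | (N <= m)%N], [set m | (N <= m)%N]).
      by split; exists N.
    case=> m n [/= Nm Nn]; rewrite -ball_normE /ball_ /= -fB.
    apply: le_lt_trans (fle _) _; apply: le_lt_trans (HN _ _ Nm Nn) _.
    by rewrite ltr_pdivrMr ?ltr_pMr // ltrDl.
  by near_simpl; exact: H.
have [a /cvgrPdist_le ca] := real_part (fun x => complex.Re x)
  (raddfB (@complex.Re R)) Re_le_md.
have [b /cvgrPdist_le cb] := real_part (fun x => complex.Im x)
  (raddfB (@complex.Im R)) Im_le_md.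
exists (a +i* b)%C => e e0; have e2 : 0 < e / 2 by rewrite divr_gt0.
have [N _ HN] := ca _ e2; have [N' _ HN'] := cb _ e2.
exists (maxn N N') => n; rewrite geq_max => /andP[Nn N'n].
apply: le_trans (md_le_ReIm _) _; rewrite [leRHS]splitr lerD //.
  by rewrite raddfB distrC HN.
by rewrite raddfB distrC HN'.
Qed.

End Modulus.

(** * Infinite q-shifted factorials *)

Section QPochhammer.
Variable R : realType.
Local Notation C := (Cx R).

Lemma geo_small (K t e : R) : 0 <= t -> t < 1 -> 0 < e ->
  exists N, forall n, (N <= n)%N -> K * t ^+ n <= e.
Proof.
move=> t0 t1 e0.
have /cvgrPdist_le H : geometric K t n @[n --> \oo] --> 0.
  by apply: cvg_geometric; rewrite ger0_norm.
have [N _ HN] := H e e0; exists N => n Nn; have := HN n Nn.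
by rewrite /= sub0r normrN => /(le_trans (ler_norm _)).
Qed.

Lemma geo_sum_le (t : R) m : 0 <= t -> t < 1 -> \sum_(i < m) t ^+ i <= (1 - t)^-1.
Proof.
move=> t0 t1; have d0 : 0 < 1 - t by rewrite subr_gt0.
rewrite -[leRHS]mul1r ler_pdivlMr //.
have := subrX1 t m; have := exprn_ge0 m t0; lra.
Qed.

(** Telescoping against a geometric series. The explicit rate matters more than the limit: it
    depends on [K] and [t] alone, so it is uniform in any parameter on which they do not depend. *)
Lemma geo_tends (u : nat -> C) (K t : R) : 0 <= t -> t < 1 ->
  (forall n, md (u n.+1 - u n) <= K * t ^+ n) ->
  exists2 l, tends u l & forall n, md (u n - l) <= K * t ^+ n / (1 - t).
Proof.
move=> t0 t1 Hu; have d0 : 0 < 1 - t by rewrite subr_gt0.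
have K0 : 0 <= K by have := Hu 0%N; rewrite expr0 mulr1; apply: le_trans; exact: md_ge0.
have step n m : md (u (n + m)%N - u n) <= K * t ^+ n / (1 - t).
  have H : md (u (n + m)%N - u n) <= K * t ^+ n * \sum_(i < m) t ^+ i.
    elim: m => [|m IH]; first by rewrite addn0 subrr md0 big_ord0 mulr0.
    apply: le_trans (ler_dist_md _ (u (n + m)%N) _) _.
    rewrite big_ord_recr /= mulrDr addrC lerD // addnS.
    by apply: le_trans (Hu _) _; rewrite exprD mulrA.
  apply: le_trans H _; rewrite ler_wpM2l ?geo_sum_le // mulr_ge0 ?exprn_ge0 //.
have [l ul] : exists l, tends u l.
  apply: cauchy_tends => e e0; have e2 : 0 < e / 2 by rewrite divr_gt0.
  have [N HN] := geo_small (K / (1 - t)) t0 t1 e2; exists N.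
  have bnd m : (N <= m)%N -> md (u m - u N) <= e / 2.
    move=> Nm; rewrite -(subnKC Nm); apply: le_trans (step _ _) _.
    by apply: le_trans (HN N (leqnn _)); rewrite mulrAC.
  move=> m n Nm Nn; apply: le_trans (ler_dist_md _ (u N) _) _.
  by rewrite [leRHS]splitr lerD ?bnd // mdB bnd.
exists l => // n; rewrite mdB.
have H : tends (fun m => u (n + m)%N - u n) (l - u n).
  apply: tendsD (tends_cst _); apply: (@eq_tends _ (fun m => u (m + n)%N)).
    by move=> m; rewrite addnC.
  exact: tends_shift.
by apply: tends_le H _ => m; exact: step.
Qed.

Variable q : C.
Hypothesis q0 : q != 0.
Hypothesis q1 : md q < 1.
Local Notation tq := (md q).

(** From 1 + u <= exp u and the geometric series: a bound for all partial q-products whose argument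
    has modulus at most t. *)
Definition qbnd (t : R) : R := expR (t / (1 - tq)).

Lemma qbnd_gt0 t : 0 < qbnd t. Proof. exact: expR_gt0. Qed.

Lemma prod_1D_le (t : R) n : 0 <= t -> \prod_(j < n) (1 + t * tq ^+ j) <= qbnd t.
Proof.
move=> t0.
have H : \prod_(j < n) (1 + t * tq ^+ j) <= expR (t * \sum_(j < n) tq ^+ j).
  elim: n => [|n IH]; first by rewrite !big_ord0 mulr0 expR0.
  rewrite !big_ord_recr /= [t * (_ + _)]mulrDr expRD ler_pM ?expR_ge1Dx //.
    by apply: prodr_ge0 => i _; rewrite addr_ge0 ?mulr_ge0 ?exprn_ge0 ?md_ge0.
  by rewrite addr_ge0 ?mulr_ge0 ?exprn_ge0 ?md_ge0.
apply: le_trans H _; rewrite ler_expR ler_wpM2l // geo_sum_le ?md_ge0 //.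
Qed.

Lemma qpoch_n_le x n t : md x <= t -> md (qpoch_n q x n) <= qbnd t.
Proof.
move=> xt; have t0 : 0 <= t by apply: le_trans xt; exact: md_ge0.
apply: le_trans (prod_1D_le n t0); rewrite md_prod ler_prod // => i _.
rewrite md_ge0 /=; apply: le_trans (ler_mdB _ _) _.
by rewrite md1 lerD2l mdM mdX ler_wpM2r ?exprn_ge0 ?md_ge0.
Qed.

Lemma qpoch_nS x n : qpoch_n q x n.+1 = qpoch_n q x n * (1 - x * q ^+ n).
Proof. by rewrite /qpoch_n big_ord_recr. Qed.

Lemma qpoch_n0 x : qpoch_n q x 0 = 1. Proof. by rewrite /qpoch_n big_ord0. Qed.

Lemma qpoch_nD x m n : qpoch_n q x (m + n) = qpoch_n q x m * qpoch_n q (x * q ^+ m) n.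
Proof.
elim: n => [|n IH]; first by rewrite addn0 qpoch_n0 mulr1.
by rewrite addnS !qpoch_nS IH mulrA exprD mulrA.
Qed.

Lemma qpoch_step x t n : md x <= t ->
  md (qpoch_n q x n.+1 - qpoch_n q x n) <= qbnd t * t * tq ^+ n.
Proof.
move=> xt.
have -> : qpoch_n q x n.+1 - qpoch_n q x n = - (qpoch_n q x n * x * q ^+ n).
  by rewrite qpoch_nS; ring.
rewrite mdN !mdM mdX ler_wpM2r ?exprn_ge0 ?md_ge0 // ler_pM ?md_ge0 //.
exact: qpoch_n_le.
Qed.

Lemma qpoch_tends x : tends (qpoch_n q x) (qpinf q x).
Proof.
have [l ul _] := geo_tends (md_ge0 q) q1 (fun n => qpoch_step n (lexx (md x))).
have /tendsP/cvg_lim e := ul.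
by rewrite /qpinf e //; exact: norm_hausdorff.
Qed.

Lemma qpinf_approx x t n : md x <= t ->
  md (qpoch_n q x n - qpinf q x) <= qbnd t * t * tq ^+ n / (1 - tq).
Proof.
move=> xt.
have [l ul H] := geo_tends (md_ge0 q) q1 (fun n => qpoch_step n xt).
by rewrite (tends_unique (qpoch_tends x) ul).
Qed.

Lemma qpinf_le x t : md x <= t -> md (qpinf q x) <= qbnd t.
Proof. by move=> xt; apply: tends_le (qpoch_tends x) _ => n; exact: qpoch_n_le. Qed.

Lemma qpinf_split x n : qpinf q x = qpoch_n q x n * qpinf q (x * q ^+ n).
Proof.
apply: tends_unique (tends_shift n (qpoch_tends x)) _.
apply: (@eq_tends _ (fun m => qpoch_n q x n * qpoch_n q (x * q ^+ n) m)).
  by move=> m; rewrite addnC qpoch_nD.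
exact: tendsZ (qpoch_tends _).
Qed.

Lemma qpinf_rec x : qpinf q x = (1 - x) * qpinf q (x * q).
Proof. by rewrite (qpinf_split x 1) /qpoch_n big_ord1 expr0 mulr1 expr1. Qed.

(** Weierstrass' inequality: a product of factors 1 - u_j is at least 1 minus the sum of the u_j.
    The hypothesis keeps every partial sum at most 1, so the induction multiplies nonnegative
    numbers. *)
Lemma md_prod_ge (x : C) n : md x * (1 - tq)^-1 <= 1 ->
  1 - md x * \sum_(j < n) tq ^+ j <= md (qpoch_n q x n).
Proof.
move=> xs; elim: n => [|n IH]; first by rewrite big_ord0 mulr0 subr0 qpoch_n0 md1.
rewrite big_ord_recr /= qpoch_nS mdM.
have h1 : 1 - md x * tq ^+ n <= md (1 - x * q ^+ n).
  rewrite lerBlDr -mdX -mdM.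
  by rewrite -[X in X <= _](md1 R) -[X in md X <= _](subrK (x * q ^+ n)) ler_mdD.
have s1 : md x * \sum_(j < n.+1) tq ^+ j <= 1.
  by apply: le_trans xs; rewrite ler_wpM2l ?md_ge0 // geo_sum_le ?md_ge0.
rewrite big_ord_recr /= in s1.
have a0 := mulr_ge0 (md_ge0 x) (exprn_ge0 n (md_ge0 q)).
have b0 : 0 <= md x * \sum_(j < n) tq ^+ j.
  by rewrite mulr_ge0 ?md_ge0 // sumr_ge0 // => i _; rewrite exprn_ge0 ?md_ge0.
apply: (@le_trans _ _ ((1 - md x * \sum_(j < n) tq ^+ j) * (1 - md x * tq ^+ n))).
  by have := mulr_ge0 a0 b0; rewrite mulrDr; nra.
by apply: ler_pM => //; rewrite mulrDr in s1; lra.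
Qed.

(** After N factors the remaining sum is at most 1/2, so the tail product stays at least 1/2 in
    modulus; a zero must come from one of the first N factors. *)
Lemma qpinf_eq0 x : qpinf q x = 0 -> exists j, x * q ^+ j = 1.
Proof.
move=> x0.
have d0 : 0 < 1 - tq by rewrite subr_gt0.
have h0 : 0 < 2^-1 :> R by rewrite invr_gt0.
have [N HN] := geo_small (md x / (1 - tq)) (md_ge0 q) q1 h0.
have y2 : md (x * q ^+ N) * (1 - tq)^-1 <= 2^-1.
  by rewrite mdM mdX mulrAC; exact: HN.
have yge n : 2^-1 <= md (qpoch_n q (x * q ^+ N) n).
  apply: le_trans (md_prod_ge n _); last by apply: le_trans y2 _; lra.
  have : md (x * q ^+ N) * \sum_(j < n) tq ^+ j <= 2^-1.
    by apply: le_trans y2; rewrite ler_wpM2l ?md_ge0 // geo_sum_le ?md_ge0.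
  by lra.
have yn0 : qpinf q (x * q ^+ N) != 0.
  apply/eqP => y0; have [M HM] := qpoch_tends (x * q ^+ N) (divr_gt0 h0 (ltr0Sn _ 1)).
  by have := HM M (leqnn _); rewrite y0 subr0; have := yge M; lra.
move: x0; rewrite (qpinf_split x N) => /eqP; rewrite mulf_eq0 (negPf yn0) orbF.
move/prodf_eq0 => [j _]; rewrite subr_eq0 => /eqP j1.
by exists (val j).
Qed.

End QPochhammer.

(** * Functions approximable by Laurent polynomials *)

Section Laurent.
Variable R : realType.
Local Notation C := (Cx R).

(** Invariant under inversion, so that one radius controls the behaviour near 0 and near infinity
    together. *)
Definition annulus (rho : R) (x : C) := (rho^-1 <= md x) && (md x <= rho).

Definition lpol (P : {poly C}) (K : nat) (x : C) : C := P.[x] / x ^+ K.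

(* Holomorphy on the punctured plane, encoded as uniform approximability by Laurent
   polynomials on annuli. *)
Definition Lau (f : C -> C) := forall rho e : R, 1 <= rho -> 0 < e ->
  exists P K, forall x, annulus rho x -> md (f x - lpol P K x) <= e.

Lemma ann_neq0 rho x : 1 <= rho -> annulus rho x -> x != 0.
Proof.
move=> r1 /andP[h _]; rewrite -md_gt0; apply: lt_le_trans h.
by rewrite invr_gt0 (lt_le_trans ltr01).
Qed.

Lemma ann_exists x : x != 0 -> exists2 rho, 1 <= rho & annulus rho x.
Proof.
rewrite -md_gt0 => x0; exists (1 + md x + (md x)^-1).
  by rewrite -addrA lerDl addr_ge0 ?invr_ge0 ?md_ge0.
have i0 : 0 < (md x)^-1 by rewrite invr_gt0.
apply/andP; split; last by lra.
rewrite -[leRHS]invrK lef_pV2 ?posrE; lra.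
Qed.

Lemma ann_le rho rho' x : 1 <= rho -> rho <= rho' -> annulus rho x -> annulus rho' x.
Proof.
move=> r1 rr /andP[h1 h2]; apply/andP; split; last exact: le_trans rr.
by apply: le_trans h1; rewrite lef_pV2 // posrE; lra.
Qed.

Lemma annV rho x : 1 <= rho -> annulus rho x -> annulus rho x^-1.
Proof.
move=> r1 /[dup] /(ann_neq0 r1); rewrite -md_gt0 => x0 /andP[h1 h2].
rewrite /annulus mdV; apply/andP; split; first by rewrite lef_pV2 // posrE; lra.
by rewrite -[leRHS]invrK lef_pV2 // posrE invr_gt0; lra.
Qed.

Lemma annX_le rho x k : 1 <= rho -> annulus rho x -> md (x ^+ k) <= rho ^+ k.
Proof. by move=> r1 /andP[_ h]; rewrite mdX lerXn2r // nnegrE ?md_ge0 //; lra. Qed.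

Lemma annXz_le rho x (k : int) : 1 <= rho -> annulus rho x -> md (x ^ k) <= rho ^+ `|k|.
Proof.
move=> r1 xr; case: k => k; first by rewrite -exprnP annX_le.
rewrite NegzE -exprnN -exprVn abszN absz_nat; apply: annX_le => //; exact: annV.
Qed.

Lemma lpol_bnd P K rho : 1 <= rho ->
  exists2 M, 0 <= M & forall x, annulus rho x -> md (lpol P K x) <= M.
Proof.
move=> r1; have r0 : 0 <= rho by lra.
exists ((\sum_(i < size P) md P`_i * rho ^+ i) * rho ^+ K).
  rewrite mulr_ge0 ?exprn_ge0 // sumr_ge0 // => i _.
  by rewrite mulr_ge0 ?exprn_ge0 ?md_ge0.
move=> x xr; rewrite /lpol mdM ler_pM ?md_ge0 //; last first.
  by rewrite -exprVn annX_le // annV.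
rewrite horner_coef; apply: le_trans (ler_md_sum _ _ _) _.
by apply: ler_sum => i _; rewrite mdM ler_wpM2l ?md_ge0 // annX_le.
Qed.

Lemma Lau_bnd f rho : Lau f -> 1 <= rho ->
  exists2 M, 0 <= M & forall x, annulus rho x -> md (f x) <= M.
Proof.
move=> Lf r1; have [P [K H]] := Lf rho 1 r1 ltr01.
have [M M0 HM] := lpol_bnd P K r1; exists (1 + M); first by rewrite addr_ge0.
move=> x xr; rewrite -[f x](subrK (lpol P K x)).
by apply: le_trans (ler_mdD _ _) _; rewrite lerD ?H ?HM.
Qed.

(** The substitute for Weierstrass' theorem on locally uniform limits; it admits infinite products
    and bilateral series. *)
Lemma Lau_lim (f : C -> C) : (forall rho e, 1 <= rho -> 0 < e ->
    exists2 g, Lau g & forall x, annulus rho x -> md (f x - g x) <= e) -> Lau f.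
Proof.
move=> H rho e r1 e0; have e2 : 0 < e / 2 by rewrite divr_gt0.
have [g Lg fg] := H rho _ r1 e2; have [P [K gP]] := Lg rho _ r1 e2.
exists P, K => x xr; apply: le_trans (ler_dist_md _ (g x) _) _.
by rewrite [leRHS]splitr lerD ?fg ?gP.
Qed.

Lemma eq_Lau f g : (forall x, x != 0 -> f x = g x) -> Lau f -> Lau g.
Proof.
move=> fg Lf rho e r1 e0; have [P [K H]] := Lf rho e r1 e0.
by exists P, K => x xr; rewrite -fg ?H // (ann_neq0 r1 xr).
Qed.

Lemma Lau_lpol P K : Lau (lpol P K).
Proof. by move=> rho e r1 e0; exists P, K => x _; rewrite subrr md0 ltW. Qed.

Lemma Lau_cst c : Lau (fun _ => c).
Proof.
by apply: eq_Lau (Lau_lpol c%:P 0) => x _; rewrite /lpol hornerC expr0 divr1.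
Qed.

Lemma Lau_id : Lau (fun x => x).
Proof.
by apply: eq_Lau (Lau_lpol 'X 0) => x _; rewrite /lpol hornerX expr0 divr1.
Qed.

Lemma Lau_inv : Lau (fun x => x^-1).
Proof.
by apply: eq_Lau (Lau_lpol 1 1) => x _; rewrite /lpol hornerC expr1 div1r.
Qed.

Lemma LauD f g : Lau f -> Lau g -> Lau (fun x => f x + g x).
Proof.
move=> Lf Lg rho e r1 e0; have e2 : 0 < e / 2 by rewrite divr_gt0.
have [P [K fP]] := Lf rho _ r1 e2; have [P' [K' gP]] := Lg rho _ r1 e2.
exists (P * 'X^K' + P' * 'X^K), (K + K')%N => x xr.
have x0 := ann_neq0 r1 xr.
have -> : lpol (P * 'X^K' + P' * 'X^K) (K + K') x = lpol P K x + lpol P' K' x.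
  rewrite /lpol !hornerE exprD; field.
  by rewrite !expf_neq0.
rewrite opprD addrACA; apply: le_trans (ler_mdD _ _) _.
by rewrite [leRHS]splitr lerD ?fP ?gP.
Qed.

Lemma LauM f g : Lau f -> Lau g -> Lau (fun x => f x * g x).
Proof.
move=> Lf Lg rho e r1 e0.
have [M M0 HM] := Lau_bnd Lf r1.
have e2 : 0 < e / 2 by rewrite divr_gt0.
have M1 : 0 < M + 1 by rewrite ltr_wpDl.
(* The approximant of [g] is fixed first: its bound [M'] on the annulus sets the precision required
   of the approximant of [f]. *)
have [P' [K' gP]] := Lg rho _ r1 (divr_gt0 e2 M1).
have [M' M'0 HM'] := lpol_bnd P' K' r1.
have M'1 : 0 < M' + 1 by rewrite ltr_wpDl.
have [P [K fP]] := Lf rho _ r1 (divr_gt0 e2 M'1).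
exists (P * P'), (K + K')%N => x xr; have x0 := ann_neq0 r1 xr.
have -> : lpol (P * P') (K + K') x = lpol P K x * lpol P' K' x.
  rewrite /lpol hornerM exprD; field.
  by rewrite !expf_neq0.
have -> : f x * g x - lpol P K x * lpol P' K' x =
  f x * (g x - lpol P' K' x) + (f x - lpol P K x) * lpol P' K' x by ring.
apply: le_trans (ler_mdD _ _) _.
rewrite (mdM (f x)) (mdM (f x - _)) [leRHS]splitr lerD //.
  apply: (@le_trans _ _ ((M + 1) * (e / 2 / (M + 1)))).
    by rewrite ler_pM ?md_ge0 ?gP //; have := HM x xr; lra.
  by rewrite mulrCA divff ?mulr1 ?gt_eqF.
apply: (@le_trans _ _ ((e / 2 / (M' + 1)) * (M' + 1))).
  by rewrite ler_pM ?md_ge0 ?fP //; have := HM' x xr; lra.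
by rewrite divfK ?gt_eqF.
Qed.

Lemma LauN f : Lau f -> Lau (fun x => - f x).
Proof.
by move=> Lf; apply: eq_Lau (LauM (Lau_cst (-1)) Lf) => x _; rewrite mulN1r.
Qed.

Lemma Lau_sum I (r : seq I) (F : I -> C -> C) :
  (forall i, Lau (F i)) -> Lau (fun x => \sum_(i <- r) F i x).
Proof.
move=> LF; elim: r => [|i r IH].
  by apply: eq_Lau (Lau_cst 0) => x _; rewrite big_nil.
by apply: eq_Lau (LauD (LF i) IH) => x _; rewrite big_cons.
Qed.

Lemma Lau_prod I (r : seq I) (P : pred I) (F : I -> C -> C) :
  (forall i, P i -> Lau (F i)) -> Lau (fun x => \prod_(i <- r | P i) F i x).
Proof.
move=> LF; elim: r => [|i r IH].
  by apply: eq_Lau (Lau_cst 1) => x _; rewrite big_nil.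
have [Pi|/negPf Pi] := boolP (P i).
  by apply: eq_Lau (LauM (LF i Pi) IH) => x _; rewrite big_cons Pi.
by apply: eq_Lau IH => x _; rewrite big_cons Pi.
Qed.

Lemma LauX f n : Lau f -> Lau (fun x => f x ^+ n).
Proof.
move=> Lf; elim: n => [|n IH].
  by apply: eq_Lau (Lau_cst 1) => x _; rewrite expr0.
by apply: eq_Lau (LauM Lf IH) => x _; rewrite exprS.
Qed.

Lemma Lau_exprz (k : int) : Lau (fun x => x ^ k).
Proof.
case: k => k; first by apply: eq_Lau (LauX k Lau_id) => x _.
by apply: eq_Lau (LauX k.+1 Lau_inv) => x _; rewrite NegzE -exprnN exprVn.
Qed.

Lemma Lau_qpoch_n q f n : Lau f -> Lau (fun x => qpoch_n q (f x) n).
Proof.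
move=> Lf; apply: Lau_prod => i _.
by apply: LauD (Lau_cst 1) _; apply: LauN; apply: LauM Lf (Lau_cst _).
Qed.

Lemma Lau_qpinf q f : md q < 1 -> Lau f -> Lau (fun x => qpinf q (f x)).
Proof.
move=> q1 Lf; apply: Lau_lim => rho e r1 e0; have [M M0 HM] := Lau_bnd Lf r1.
have [N HN] := geo_small (qbnd q M * M / (1 - md q)) (md_ge0 q) q1 e0.
exists (fun x => qpoch_n q (f x) N); first exact: Lau_qpoch_n.
move=> x xr; rewrite mdB; apply: le_trans (qpinf_approx q1 N (HM x xr)) _.
by apply: le_trans (HN N (leqnn N)); rewrite mulrAC.
Qed.

End Laurent.

(** * Laurent coefficients as limits of averages over roots of unity *)

Section CircleAverage.
Variable R : realType.
Local Notation C := (Cx R).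

Lemma prim_root_exists M : (0 < M)%N -> exists z : C, M.-primitive_root z.
Proof.
move=> M0; have [r Dr] := closed_field_poly_normal ('X^M - 1 : {poly C}).
rewrite (monicP _) ?monicXnsubC // scale1r in Dr.
have /hasP[z _ zP] : has M.-primitive_root r; last by exists z.
apply: has_prim_root => //.
- by apply/allP => z; rewrite -root_prod_XsubC -Dr.
- by rewrite -separable_prod_XsubC -Dr separable_Xn_sub_1 // pnatr_eq0 -lt0n.
- by have := size_prod_XsubC r id; rewrite -Dr size_XnsubC // => -[->].
Qed.

Definition zeta (M : nat) : C := xget 1 [set z | M.-primitive_root z].

Lemma zeta_prim M : (0 < M)%N -> M.-primitive_root (zeta M).
Proof. by move=> /prim_root_exists[z zP]; rewrite /zeta; case: xgetP => [y _ //|/(_ z)]. Qed.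

Lemma md_zeta M : (0 < M)%N -> md (zeta M) = 1.
Proof.
move=> M0; apply/eqP; rewrite -(@pexpr_eq1 _ _ M) ?md_ge0 //.
by rewrite -mdX prim_expr_order ?md1 // zeta_prim.
Qed.

Lemma zeta_neq0 M : (0 < M)%N -> zeta M != 0.
Proof. by move=> M0; rewrite -md_gt0 md_zeta. Qed.

Lemma zeta_expz_eq1 M (d : int) : (0 < M)%N -> (`|d| < M)%N -> zeta M ^ d = 1 -> d = 0.
Proof.
move=> M0 dM; have key k : (k < M)%N -> zeta M ^+ k = 1 -> k = 0%N.
  move=> kM /eqP; rewrite -(prim_order_dvd (zeta_prim M0)) => /dvdn_leq.
  by case: k kM => // k kM /(_ isT); rewrite leqNgt kM.
case: d dM => k dM; first by rewrite -exprnP => /key ->.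
rewrite NegzE -exprnN => /(congr1 (fun x => x^-1)); rewrite invrK invr1.
by move/key => ->.
Qed.

Lemma sum_zeta M (d : int) : (0 < M)%N -> (`|d| < M)%N ->
  \sum_(j < M) (zeta M ^ d) ^+ j = (M * (d == 0))%:R.
Proof.
move=> M0 dM; have [->|d0] := eqVneq d 0.
  rewrite expr0z muln1; under eq_bigr do rewrite expr1n.
  by rewrite sumr_const card_ord.
have z1 : zeta M ^ d - 1 != 0.
  by apply: contra_neq d0 => /eqP; rewrite subr_eq0 => /eqP /(zeta_expz_eq1 M0 dM).
rewrite muln0; apply: (mulfI z1); rewrite -subrX1 mulr0 [_ ^+ M]exprnP exprzAC.
by rewrite -exprnP prim_expr_order ?zeta_prim // exp1rz subrr.
Qed.

(** The M-point Riemann sum of Cauchy's integral for the coefficient of z^m, on the circle through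
    [z0]. It is exact on a Laurent polynomial once M is large compared with its exponents
    ([avg_lpol]). *)
Definition avg (z0 : C) (M : nat) (f : C -> C) (m : int) : C :=
  M%:R^-1 * \sum_(j < M) f (z0 * zeta M ^+ j) * (z0 * zeta M ^+ j) ^ (- m).

Lemma eq_avg z0 M f g m : z0 != 0 -> (0 < M)%N ->
  (forall z, md z = md z0 -> f z = g z) -> avg z0 M f m = avg z0 M g m.
Proof.
move=> z0n M0 fg; congr (_ * _); apply: eq_bigr => j _.
by rewrite fg // mdM mdX md_zeta // expr1n mulr1.
Qed.

Lemma avgD z0 M f g m : avg z0 M (fun z => f z + g z) m = avg z0 M f m + avg z0 M g m.
Proof.
by rewrite /avg -mulrDr -big_split; congr (_ * _); apply: eq_bigr => j _; rewrite mulrDl.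
Qed.

Lemma avgZ z0 M a f m : avg z0 M (fun z => a * f z) m = a * avg z0 M f m.
Proof.
rewrite /avg mulrCA; congr (_ * _); rewrite mulr_sumr.
by apply: eq_bigr => j _; rewrite mulrA.
Qed.

Lemma avg_sum z0 M (I : Type) (r : seq I) (F : I -> C -> C) m :
  avg z0 M (fun z => \sum_(i <- r) F i z) m = \sum_(i <- r) avg z0 M (F i) m.
Proof.
rewrite /avg -mulr_sumr exchange_big /=; congr (_ * _).
by apply: eq_bigr => j _; rewrite mulr_suml.
Qed.

Lemma avg_le z0 M f m e : (0 < M)%N -> (forall z, md z = md z0 -> md (f z) <= e) ->
  md (avg z0 M f m) <= e * md z0 ^ (- m).
Proof.
move=> M0 fe; have M0' : 0 < M%:R :> R by rewrite ltr0n.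
rewrite /avg mdM mdV md_natr ler_pdivrMl //.
apply: le_trans (ler_md_sum _ _ _) _.
have H (j : 'I_M) : md (f (z0 * zeta M ^+ j) * (z0 * zeta M ^+ j) ^ (- m))
    <= e * md z0 ^ (- m).
  have mz : md (z0 * zeta M ^+ j) = md z0 by rewrite mdM mdX md_zeta // expr1n mulr1.
  by rewrite mdM mdXz mz ler_wpM2r ?fe // exprz_ge0 ?md_ge0.
apply: le_trans (ler_sum _ (fun j _ => H j)) _.
by rewrite sumr_const card_ord mulr_natl lexx.
Qed.

Lemma avg_monomial z0 M (e m : int) : z0 != 0 -> (`|e - m| < M)%N ->
  avg z0 M (fun z => z ^ e) m = (e == m)%:R.
Proof.
move=> z0n eM; have M0 : (0 < M)%N by apply: leq_ltn_trans eM.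
have MC : M%:R != 0 :> C by rewrite pnatr_eq0 -lt0n.
rewrite /avg (eq_bigr (fun j : 'I_M => z0 ^ (e - m) * (zeta M ^ (e - m)) ^+ j)); last first.
  move=> j _; rewrite -expfzDr ?mulf_neq0 ?expf_neq0 ?zeta_neq0 // expfzMl.
  by congr (_ * _); rewrite !exprnP exprzAC.
rewrite -mulr_sumr sum_zeta // subr_eq0; have [->|_] := eqVneq e m.
  by rewrite subrr expr0z mul1r muln1 mulVf.
by rewrite muln0 !mulr0.
Qed.

Definition lcoef (P : {poly C}) (K : nat) (m : int) : C :=
  \sum_(i < size P) P`_i * ((i%:Z - K%:Z == m)%:R).

Lemma avg_lpol z0 M (P : {poly C}) K m : z0 != 0 -> (size P + K + `|m| < M)%N ->
  avg z0 M (lpol P K) m = lcoef P K m.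
Proof.
move=> z0n HM; have M0 : (0 < M)%N by apply: leq_ltn_trans HM.
transitivity (avg z0 M (fun z => \sum_(i < size P) P`_i * z ^ (i%:Z - K%:Z)) m).
  apply: eq_avg => // z zz0; have z1 : z != 0 by rewrite -md_gt0 zz0 md_gt0.
  rewrite /lpol horner_coef mulr_suml; apply: eq_bigr => i _.
  by rewrite -mulrA expfzDr // exprnN.
rewrite avg_sum; apply: eq_bigr => i _; rewrite avgZ avg_monomial //.
have := ltn_ord i; lia.
Qed.

(** Uniformity in the base point [z0] is built in: one constant [c] serves all circles, so averages
    on different circles may be compared. *)
Definition Lcoef (f : C -> C) (m : int) (c : C) := forall rho e : R, 1 <= rho -> 0 < e ->
  exists M0, forall z0 M, annulus rho z0 -> (M0 <= M)%N -> md (avg z0 M f m - c) <= e.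

Lemma avg_approx f (P : {poly C}) K rho e z0 M m : 1 <= rho -> 0 <= e -> annulus rho z0 ->
  (size P + K + `|m| < M)%N -> (forall x, annulus rho x -> md (f x - lpol P K x) <= e) ->
  md (avg z0 M f m - lcoef P K m) <= e * md z0 ^ (- m).
Proof.
move=> r1 e0 zr HM H; have z0n := ann_neq0 r1 zr.
have M0 : (0 < M)%N by apply: leq_ltn_trans HM.
rewrite -(avg_lpol z0n HM) -mulN1r -avgZ -avgD; apply: avg_le => // z mz.
by rewrite mulN1r H // /annulus mz.
Qed.

Lemma ann_expz_le rho (z : C) (m : int) : 1 <= rho -> annulus rho z -> md z ^ m <= rho ^+ `|m|.
Proof. by move=> r1 zr; rewrite -mdXz annXz_le. Qed.

Lemma Lcoef_ex f m : Lau f -> exists c, Lcoef f m c.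
Proof.
move=> Lf.
have approx rho e : 1 <= rho -> 0 < e -> exists c M0, forall z0 M, annulus rho z0 ->
    (M0 <= M)%N -> md (avg z0 M f m - c) <= e.
  move=> r1 e0; have rm : 0 < rho ^+ `|m| by rewrite exprn_gt0 //; lra.
  have [P [K H]] := Lf rho _ r1 (divr_gt0 e0 rm).
  exists (lcoef P K m), (size P + K + `|m|).+1 => z0 M zr HM.
  apply: le_trans (avg_approx r1 (ltW (divr_gt0 e0 rm)) zr HM H) _.
  rewrite -[leRHS](divfK (lt0r_neq0 rm)); apply: ler_wpM2l; first by rewrite ltW ?divr_gt0.
  by have := ann_expz_le (- m) r1 zr; rewrite abszN.
(* The point 1 lies in every annulus. The averages based there define [c], and the constant [d]
   found for any other annulus is compared with [c] through them. *)
have a1 : annulus 1 (1 : C) by rewrite /annulus md1 invr1 lexx.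
have [c Hc] : exists c, tends (fun M => avg 1 M f m) c.
  apply: cauchy_tends => e e0; have e2 : 0 < e / 2 by rewrite divr_gt0.
  have [c [M0 H]] := approx 1 _ (lexx 1) e2.
  exists M0 => a b Ha Hb; apply: le_trans (ler_dist_md _ c _) _.
  by rewrite [leRHS]splitr lerD ?H // mdB H.
exists c => rho e r1 e0; have e3 : 0 < e / 3 by rewrite divr_gt0.
have [d [M0 H]] := approx rho _ r1 e3; have [M1 H1] := Hc _ e3.
exists M0 => z0 M zr HM; set N := maxn M0 M1.
have a1' : annulus rho (1 : C) by apply: ann_le a1.
have h1 := H z0 M zr HM; have h2 := H 1 N a1' (leq_maxl _ _).
have h3 := H1 N (leq_maxr _ _).
apply: le_trans (ler_dist_md _ d _) _.
have := ler_dist_md d (avg 1 N f m) c; rewrite mdB in h2; lra.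
Qed.

Lemma Lcoef_lin (I : Type) (r : seq I) (F : I -> C -> C) (a c : I -> C) m :
  (forall i, Lcoef (F i) m (c i)) ->
  Lcoef (fun x => \sum_(i <- r) a i * F i x) m (\sum_(i <- r) a i * c i).
Proof.
move=> HF rho e r1; elim: r e => [|i r IH] e e0.
  exists 0%N => z0 M _ _; rewrite avg_sum !big_nil subrr md0 ltW //.
have e2 : 0 < e / 2 by rewrite divr_gt0.
have a1 : 0 < md (a i) + 1 by rewrite ltr_wpDl ?md_ge0.
have [M0 H0] := IH _ e2; have [M1 H1] := HF i _ _ r1 (divr_gt0 e2 a1).
exists (maxn M0 M1) => z0 M zr; rewrite geq_max => /andP[h0 h1].
have := H0 z0 M zr h0; rewrite !avg_sum !big_cons opprD addrACA => h.
apply: le_trans (ler_mdD _ _) _; rewrite [leRHS]splitr lerD //.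
rewrite avgZ -mulrBr mdM.
apply: (@le_trans _ _ ((md (a i) + 1) * (e / 2 / (md (a i) + 1)))).
  by rewrite ler_pM ?md_ge0 ?H1 // lerDl.
by rewrite mulrCA divff ?mulr1 ?gt_eqF.
Qed.

Lemma sum_half_le (n K : nat) : \sum_(i < n) 2^-1 ^+ `|i%:Z - K%:Z| <= 4 :> R.
Proof.
apply: (@le_trans _ _ (\sum_(i < K + n) 2^-1 ^+ `|i%:Z - K%:Z|)).
  by rewrite addnC big_split_ord /= lerDl sumr_ge0 //.
have h01 : 0 <= 2^-1 :> R by rewrite invr_ge0.
have h11 : 2^-1 < 1 :> R by lra.
have two : (1 - 2^-1)^-1 = 2 :> R by rewrite -[1 - _](_ : 2^-1 = _) ?invrK //; lra.
have -> : 4 = (1 - 2^-1)^-1 + (1 - 2^-1)^-1 :> R by rewrite two; lra.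
rewrite big_split_ord /= lerD //; last first.
  apply: le_trans (geo_sum_le (n) h01 h11).
  by apply: ler_sum => i _; rewrite PoszD addrC addKr absz_nat.
apply: le_trans (geo_sum_le K h01 h11).
rewrite [leRHS](reindex_inj rev_ord_inj) /=; apply: ler_sum => i _.
rewrite ler_wiXn2l ?(ltW h11) //; have := ltn_ord i; clear; lia.
Qed.

(** Cauchy estimates. Let a Laurent polynomial be within e/5 of [f] on an annulus twice as wide as
    one containing x. If all coefficients of [f] vanish, the estimates at 2x and at x/2 bound its
    term of exponent m at x by (e/5) 2^(-|m|). These bounds sum to at most 4e/5, and the
    approximation error is the last e/5. *)
Lemma Lcoef_inj f : Lau f -> (forall m, Lcoef f m 0) -> forall x, x != 0 -> f x = 0.
Proof.
move=> Lf Hf x x0; apply: eps_eq0 => e e0.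
have [rho0 r01 xr0] := ann_exists x0; set rho := 2 * rho0.
have r1 : 1 <= rho by rewrite /rho; lra.
have e5 : 0 < e / 5 by rewrite divr_gt0.
have [P [K H]] := Lf rho _ r1 e5.
(* The same average is within any [e'] of 0, the coefficient of [f], and within the stated bound of
   the coefficient of [P]. *)
have Pc (i : 'I_(size P)) z : annulus rho z -> md P`_i <= e / 5 * md z ^ (- (i%:Z - K%:Z)).
  move=> zr; have z0 := ann_neq0 r1 zr.
  apply/ler_addgt0Pl => e' e'0; have [M0 HM0] := Hf (i%:Z - K%:Z) _ _ r1 e'0.
  set m := i%:Z - K%:Z; set M := (maxn M0 (size P + K + `|m|).+1).
  have h1 := HM0 z M zr (leq_maxl _ _).
  have h2 := @avg_approx f P K rho _ z M m r1 (ltW e5) zr (leq_maxr M0 _) H.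
  have e1 : lcoef P K m = P`_i.
    rewrite /lcoef (bigD1 i) //= eqxx mulr1 big1 ?addr0 // => j ji.
    rewrite (_ : (_ == _) = false) ?mulr0 //; apply/negbTE; apply: contra ji.
    by rewrite /m => /eqP h; apply/eqP/val_inj; move: h; clear; rewrite /=; lia.
  rewrite subr0 in h1; rewrite e1 mdB in h2.
  by apply: le_trans (lerD h1 h2); rewrite -[X in md X](subrK (avg z M f m)) addrC ler_mdD.
have md2 : md (2 : C) = 2 by exact: md_natr.
move: xr0 => /andP[xr1 xr2]; have mx : 0 < md x by rewrite md_gt0.
have r0i : 0 < rho0^-1 by rewrite invr_gt0; lra.
have rE : rho^-1 = rho0^-1 / 2 by rewrite /rho invfM mulrC.
have a1 : annulus rho (2 * x) by rewrite /annulus mdM md2 rE /rho; apply/andP; split; lra.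
have a2 : annulus rho (x / 2) by rewrite /annulus mdM mdV md2 rE /rho; apply/andP; split; lra.
have a3 : annulus rho x by rewrite /annulus rE /rho; apply/andP; split; lra.
have Pb (i : 'I_(size P)) : md (P`_i * x ^ (i%:Z - K%:Z)) <= e / 5 * 2^-1 ^+ `|i%:Z - K%:Z|.
  rewrite mdM mdXz; set m := i%:Z - K%:Z.
  have key z (t : R) : annulus rho z -> md z = md x * t -> 0 < t ->
      md P`_i * md x ^ m <= e / 5 * t ^ (- m).
    move=> zr zx t0; have h := Pc i z zr; rewrite zx expfzMl -/m mulrA in h.
    rewrite -ler_pdivlMr ?exprz_gt0 //; apply: le_trans h _.
    by rewrite -invr_expz mulrAC.
  have h1 : md P`_i * md x ^ m <= e / 5 * 2 ^ (- m).
    by apply: (key (2 * x)) => //; rewrite mdM md2 mulrC.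
  have h2 : md P`_i * md x ^ m <= e / 5 * 2^-1 ^ (- m).
    by apply: (key (x / 2)) => //; rewrite ?mdM ?mdV ?md2 ?invr_gt0.
  case: m h1 h2 {key} => k h1 h2; first by rewrite exprVn exprnN.
  by move: h2; rewrite NegzE opprK -exprnP abszN.
rewrite -[f x]subr0; apply: le_trans (ler_dist_md _ (lpol P K x) _) _; rewrite subr0.
suff : md (lpol P K x) <= e / 5 * 4 by have := H x a3; lra.
rewrite /lpol horner_coef mulr_suml.
apply: (@le_trans _ _ (\sum_(i < size P) e / 5 * 2^-1 ^+ `|i%:Z - K%:Z|)).
  apply: le_trans (ler_md_sum _ _ _) _; apply: ler_sum => i _; apply: le_trans (Pb i).
  by rewrite -mulrA (expfzDr _ _ x0) -exprnN.
rewrite -mulr_sumr; apply: ler_wpM2l; first exact: ltW.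
exact: sum_half_le.
Qed.

End CircleAverage.

(** * Theta function spaces *)

Section ThetaSpace.
Variable R : realType.
Local Notation C := (Cx R).
Variables (q : C) (n : nat) (c : C).
Hypotheses (q0 : q != 0) (c0 : c != 0) (n0 : (0 < n)%N).

Definition theta_space (f : C -> C) :=
  Lau f /\ forall x, x != 0 -> f (q * x) * x ^+ n = c * f x.

Lemma Lcoef_tends (f : C -> C) m a z0 : z0 != 0 -> Lcoef f m a ->
  tends (fun M => avg z0 M f m) a.
Proof.
move=> /ann_exists[rho r1 zr] H e e0; have [M0 HM] := H _ _ r1 e0.
by exists M0 => M; exact: HM.
Qed.

(** By the functional equation the average of order m based at q equals c q^(-m) times the average
    of order m + n based at 1; both converge to coefficients because these do not depend on the
    circle. *)
Lemma theta_coef_shift f m a b : theta_space f -> Lcoef f m a -> Lcoef f (m + n%:Z) b ->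
  a = c * q ^ (- m) * b.
Proof.
move=> [_ fq] Ha Hb.
apply: (tends_unique (Lcoef_tends q0 Ha)).
apply: eq_tends (tendsZ (c * q ^ (- m)) (Lcoef_tends (oner_neq0 C) Hb)) => M.
rewrite /avg mulrCA; congr (_ * _); rewrite mulr_sumr; apply: eq_bigr => j _.
have M0 : (0 < M)%N by case: M j => [[]|].
rewrite mul1r; set z := zeta R M ^+ j; have z0 : z != 0 by rewrite expf_neq0 ?zeta_neq0.
have -> : f (q * z) = c * f z * z ^ (- n%:Z).
  by rewrite -fq // -exprnN mulfK // expf_neq0.
rewrite expfzMl opprD expfzDr //; ring.
Qed.

(** The recurrence propagates zeros in steps of n both ways, so the n coefficients of index 0, ...,
    n - 1 determine the function. This is the dimension bound. *)
Lemma theta_space_zero f : theta_space f -> (forall s, (s < n)%N -> Lcoef f s%:Z 0) ->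
  forall x, x != 0 -> f x = 0.
Proof.
move=> Tf Hs; apply: Lcoef_inj; first by case: Tf.
have up m : Lcoef f m 0 -> Lcoef f (m + n%:Z) 0.
  move=> H; have [b Hb] := Lcoef_ex (m + n%:Z) Tf.1.
  have /esym/eqP := theta_coef_shift Tf H Hb.
  by rewrite !mulf_eq0 (negPf c0) (negPf (expfz_neq0 _ q0)) /= => /eqP b0; rewrite b0 in Hb.
have down m : Lcoef f (m + n%:Z) 0 -> Lcoef f m 0.
  move=> H; have [b Hb] := Lcoef_ex m Tf.1.
  by have b0 := theta_coef_shift Tf Hb H; rewrite mulr0 in b0; rewrite b0 in Hb.
have n0' : n%:Z != 0 by rewrite eqz_nat -lt0n.
move=> m; rewrite (divz_eq m n%:Z); set d := (m %/ n)%Z.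
have [s -> sn] : exists2 s : nat, (m %% n)%Z = s%:Z & (s < n)%N.
  have := modz_ge0 m n0'; have := ltz_pmod m (_ : 0 < n%:Z).
  by case: (m %% n)%Z => // s h _; exists s => //; apply: h.
case: d => k.
  elim: k => [|k IH]; first by rewrite mul0r add0r; exact: Hs.
  by rewrite intS mulrDl mul1r -addrA addrC; exact: up.
have {}IH : forall k : nat, Lcoef f (- k%:Z * n%:Z + s%:Z) 0; last by rewrite NegzE; exact: IH.
elim=> [|j IH]; first by rewrite oppr0 mul0r add0r; exact: Hs.
apply: down; have -> // : - j.+1%:Z * n%:Z + s%:Z + n%:Z = - j%:Z * n%:Z + s%:Z.
by rewrite intS; ring.
Qed.

Lemma theta_space_sum (I : Type) (r : seq I) (a : I -> C) (F : I -> C -> C) :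
  (forall i, theta_space (F i)) -> theta_space (fun x => \sum_(i <- r) a i * F i x).
Proof.
move=> TF; split; first by apply: Lau_sum => i; apply: LauM (Lau_cst _) (TF i).1.
move=> x x0; rewrite mulr_suml mulr_sumr; apply: eq_bigr => i _.
by rewrite -mulrA (TF i).2 // mulrCA.
Qed.

(** The Lagrange conditions make the [l j] independent, so the square matrix of their first n
    coefficients is invertible. Some combination then shares these coefficients with [f] and equals
    it by [theta_space_zero]; evaluation at the nodes identifies the weights. *)
Lemma theta_space_interp (l : 'I_n -> C -> C) (p : 'I_n -> C) :
  (forall j, theta_space (l j)) -> (forall k, p k != 0) ->
  (forall j k, l j (p k) = (j == k)%:R) ->
  forall f, theta_space f -> forall x, x != 0 -> f x = \sum_j f (p j) * l j x.
Proof.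
move=> Tl p0 lp f Tf.
have [a Ha] : exists a : 'I_n -> 'I_n -> C, forall j (s : 'I_n), Lcoef (l j) s%:Z (a j s).
  have H j : exists b : 'I_n -> C, forall s : 'I_n, Lcoef (l j) s%:Z (b s).
    have [b Hb] := choice (fun s : 'I_n => Lcoef_ex s%:Z (Tl j).1); by exists b.
  by have [a Ha] := choice H; exists a.
have [b Hb] : exists b : 'I_n -> C, forall s : 'I_n, Lcoef f s%:Z (b s).
  have [b Hb] := choice (fun s : 'I_n => Lcoef_ex s%:Z Tf.1); by exists b.
have lv (v : 'I_n -> C) k : \sum_j v j * l j (p k) = v k.
  rewrite (bigD1 k) //= lp eqxx mulr1 big1 ?addr0 // => j jk.
  by rewrite lp (negPf jk) mulr0.
pose A : 'M[C]_n := \matrix_(j, s) a j s.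
have Au : A \in unitmx.
  rewrite -row_free_unit; apply: inj_row_free => v vA.
  have Tg := theta_space_sum (index_enum _) (v 0) Tl.
  have g0 := theta_space_zero Tg.
  apply/rowP => k; rewrite mxE -(lv (v 0) k); apply: g0 => // s sn.
  have := Lcoef_lin (index_enum _) (v 0) (fun j => Ha j (Ordinal sn)).
  congr (Lcoef _ _ _); have /rowP /(_ (Ordinal sn)) := vA; rewrite !mxE => e.
  by rewrite -[RHS]e; apply: eq_bigr => j _; rewrite mxE.
pose v := (\row_s b s) *m invmx A.
(* [None] stands for [f] and [Some j] for [l j], so that the difference of [f] and the combination
   is a single linear combination. *)
pose F (o : option 'I_n) := if o is Some j then l j else f.
pose w (o : option 'I_n) := if o is Some j then - v 0 j else 1.
pose d (s : 'I_n) (o : option 'I_n) := if o is Some j then a j s else b s.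
have TF o : theta_space (F o) by case: o.
have h0 x : x != 0 -> \sum_(o <- None :: map Some (index_enum 'I_n)) w o * F o x = 0.
  apply: (theta_space_zero (theta_space_sum _ w TF)) => s sn.
  have Hd o : Lcoef (F o) s%:Z (d (Ordinal sn) o) by case: o => [j|]; [exact: (Ha j (Ordinal sn))|exact: (Hb (Ordinal sn))].
  have := Lcoef_lin (None :: map Some (index_enum 'I_n)) w Hd; congr (Lcoef _ _ _).
  have : v *m A = \row_s b s by rewrite mulmxKV.
  move=> /rowP /(_ (Ordinal sn)); rewrite !mxE => e.
  rewrite big_cons big_map /= -e mul1r -big_split /= big1 // => j _.
  by rewrite !mxE mulNr subrr.
have fv x : x != 0 -> f x = \sum_j v 0 j * l j x.
  move=> /h0; rewrite big_cons big_map /= mul1r => /eqP; rewrite addr_eq0 => /eqP ->.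
  by rewrite -sumrN; apply: eq_bigr => j _; rewrite mulNr opprK.
move=> x x0; rewrite fv //; apply: eq_bigr => j _; congr (_ * _).
by rewrite fv // lv.
Qed.

Definition upd (x : 'I_n -> C) (i : 'I_n) (t : C) : 'I_n -> C :=
  fun j => if j == i then t else x j.

Lemma updE x i : upd x i (x i) = x.
Proof. by apply: funext => j; rewrite /upd; case: eqP => // ->. Qed.

(** Interpolating one variable after another reduces G to its values at tuples of nodes. A repeated
    node gives 0 by alternation; the other tuples are permutations of the nodes. *)
Lemma alternating_zero (G : ('I_n -> C) -> C) (p : 'I_n -> C) (l : 'I_n -> C -> C) :
  (forall k, p k != 0) ->
  (forall x i t, (forall k, x k != 0) -> t != 0 ->
     G (upd x i t) = \sum_j G (upd x i (p j)) * l j t) ->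
  (forall x i j, i != j -> x i = x j -> G x = 0) ->
  (forall s : {perm 'I_n}, G (fun i => p (s i)) = 0) ->
  forall x, (forall k, x k != 0) -> G x = 0.
Proof.
move=> p0 Gl Galt Gp.
(* Only the coordinates of index below m are still free; the others are nodes. *)
suff H m : forall x, (forall k, x k != 0) ->
    (forall i : 'I_n, (m <= i)%N -> exists j, x i = p j) -> G x = 0.
  by move=> x x0; apply: (H n) => // i; rewrite leqNgt ltn_ord.
elim: m => [|m IH] x x0 xp.
  have [s xs] := choice (fun i => xp i (leq0n i)).
  have -> : x = (fun i => p (s i)) by apply: funext.
  have [/injectiveP sI|] := boolP (injectiveb s).
    by rewrite -(Gp (perm sI)); congr G; apply: funext => i; rewrite permE.
  move=> /injectivePn[i [j ij sij]]; by apply: (Galt _ i j) => //=; rewrite sij.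
have [mn|nm] := ltnP m n; last first.
  by apply: IH => // i /(leq_trans nm); rewrite leqNgt ltn_ord.
set i := Ordinal mn; rewrite -(updE x i) Gl // big1 // => j _.
have -> : G (upd x i (p j)) = 0; last by rewrite mul0r.
apply: IH => k; rewrite /upd; first by case: ifP.
case: (k =P i) => [_ _|/eqP ki mk]; first by exists j.
by apply: xp; rewrite ltn_neqAle mk andbT eq_sym.
Qed.

Definition section_mx (psi : 'I_n -> C -> C) (x : 'I_n -> C) : 'M[C]_n :=
  \matrix_(i, j) psi j (x i).

(* Both sides are alternating and lie in the n-dimensional theta space in each
   variable, and the sections of [F] at [y] form a Lagrange basis of that space. *)
Lemma theta_det_proportional (psi : 'I_n -> C -> C) (F : ('I_n -> C) -> C) (y : 'I_n -> C) :
  (forall j, theta_space (psi j)) ->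
  (forall x i, (forall k, x k != 0) -> theta_space (fun t => F (upd x i t))) ->
  (forall x i j, (forall k, x k != 0) -> i != j -> x i = x j -> F x = 0) ->
  (forall x (s : {perm 'I_n}), (forall k, x k != 0) ->
     F (fun i => x (s i)) = (-1) ^+ s * F x) ->
  (forall k, y k != 0) -> F y != 0 ->
  forall x, (forall k, x k != 0) ->
  \det (section_mx psi x) * F y = \det (section_mx psi y) * F x.
Proof.
move=> Tpsi TF Falt Fperm y0 Fy x x0.
pose l (j : 'I_n) (t : C) := (F y)^-1 * F (upd y j t).
have Tl j : theta_space (l j).
  have := theta_space_sum [:: tt] (fun _ => (F y)^-1) (fun _ => TF y j y0).
  by congr theta_space; apply: funext => t; rewrite big_seq1.
have ly j k : l j (y k) = (j == k)%:R.
  rewrite /l; have [->|jk] := eqVneq j k; first by rewrite updE mulVf ?Fy.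
  rewrite (Falt (upd y j (y k)) j k) ?mulr0 //; first by move=> i; rewrite /upd; case: ifP.
  by rewrite /upd eqxx eq_sym (negPf jk).
pose G x := \det (section_mx psi x) * F y - \det (section_mx psi y) * F x.
have detalt (z : 'I_n -> C) i j : i != j -> z i = z j -> \det (section_mx psi z) = 0.
  by move=> ij zij; apply: (determinant_alternate ij) => k; rewrite !mxE zij.
(* [alternating_zero] asks for alternation at all points, while [F] is controlled only where no
   coordinate is 0; the function is therefore set to 0 elsewhere. *)
suff : forall x, (forall k, x k != 0) -> (if [forall k, x k != 0] then G x else 0) = 0.
  move=> /(_ x x0); case: ifP => [_ /eqP|/forallP//]; rewrite subr_eq0 => /eqP //.
apply: (alternating_zero y0 (l := l)) => [z i t z0 t0|z i j ij zij|s].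
- have TG : theta_space (fun t => G (upd z i t)).
    (* Expansion along row i: the cofactors do not involve the i-th variable, so they may be
       computed with the value 1 there and serve as constant weights. *)
    pose w (o : option 'I_n) := if o is Some j then F y * cofactor (section_mx psi (upd z i 1)) i j
      else - \det (section_mx psi y).
    pose H (o : option 'I_n) := if o is Some j then psi j else fun t => F (upd z i t).
    have TH o : theta_space (H o) by case: o => [j|]; [exact: Tpsi | exact: TF].
    have := theta_space_sum (None :: map Some (index_enum 'I_n)) w TH; congr theta_space; apply: funext => u.
    rewrite big_cons big_map /= /G addrC mulNr; congr (_ - _).
    rewrite (expand_det_row _ i) mulr_suml; apply: eq_bigr => j _.
    have -> : cofactor (section_mx psi (upd z i u)) i j =
              cofactor (section_mx psi (upd z i 1)) i j.
      rewrite /cofactor; congr (_ * \det _); apply/matrixP => a b; rewrite !mxE.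
      by rewrite /upd eq_sym (negPf (neq_lift i a)).
    by rewrite mxE /upd eqxx; ring.
  have nz u : u != 0 -> [forall k, upd z i u k != 0].
    by move=> u0; apply/forallP => k; rewrite /upd; case: ifP.
  rewrite nz // (theta_space_interp Tl y0 ly TG t0); apply: eq_bigr => j _.
  by rewrite nz.
- case: ifP => // /forallP z0; rewrite /G (detalt _ i j ij) // (Falt _ i j z0 ij zij).
  by rewrite mul0r mulr0 subrr.
- case: ifP => // _; rewrite /G Fperm //.
  have -> : section_mx psi (fun i => y (s i)) = row_perm s (section_mx psi y).
    by apply/matrixP => i j; rewrite !mxE.
  by rewrite row_permE det_mulmx det_perm -mulrA [X in _ - X]mulrCA subrr.
Qed.

End ThetaSpace.

(** * Products over pairs of indices *)

Section PairProducts.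
Variable K : fieldType.

Lemma prod_pairs_recl r (s : 'I_r.+1 -> 'I_r.+1 -> K) :
  \prod_(i < r.+1) \prod_(j < r.+1 | (i < j)%N) s i j =
  (\prod_(j < r) s ord0 (lift ord0 j)) *
  \prod_(i < r) \prod_(j < r | (i < j)%N) s (lift ord0 i) (lift ord0 j).
Proof.
rewrite big_ord_recl; congr (_ * _).
  by rewrite big_mkcond big_ord_recl /= mul1r.
apply: eq_bigr => i _; rewrite big_mkcond big_ord_recl /= mul1r.
by rewrite [RHS]big_mkcond.
Qed.

(** A permutation acts on unordered pairs. [h g] sends an increasing pair to its image put back in
    increasing order, and the same construction for the inverse of g undoes it. *)
Lemma prod_pairs_sym n (s : 'I_n -> 'I_n -> K) (g : {perm 'I_n}) :
  (forall i j, s i j = s j i) ->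
  \prod_(i < n) \prod_(j < n | (i < j)%N) s (g i) (g j) =
  \prod_(i < n) \prod_(j < n | (i < j)%N) s i j.
Proof.
move=> sC; rewrite !pair_big_dep /=.
pose h (g : {perm 'I_n}) (p : 'I_n * 'I_n) :=
  if (g p.1 < g p.2)%N then (g p.1, g p.2) else (g p.2, g p.1).
have hK (g' g'' : {perm 'I_n}) : cancel g' g'' ->
    forall p : 'I_n * 'I_n, (p.1 < p.2)%N -> h g'' (h g' p) = p.
  move=> gK [i j] /= ij; rewrite /h /=; case: (g' i < g' j)%N; rewrite /= !gK ?ij //.
  by rewrite ltnNge ltnW.
have hlt (g' : {perm 'I_n}) (p : 'I_n * 'I_n) : p.1 != p.2 -> ((h g' p).1 < (h g' p).2)%N.
  move=> pp; rewrite /h; case: ifP => //= /negbT; rewrite -leqNgt leq_eqVlt => /orP[|//].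
  by rewrite (inj_eq val_inj) (inj_eq perm_inj) eq_sym (negPf pp).
rewrite [RHS](reindex_onto (h g) (h g^-1%g)) /=; last by move=> p; apply: hK; exact: permKV.
apply: eq_big => [[i j]|[i j] _]; last by rewrite /h; case: ifP.
apply/idP/andP => [/= ij|[hij /eqP e]].
  split; last by rewrite (hK _ _ (permK g)).
  by apply: hlt => /=; rewrite -(inj_eq val_inj) neq_ltn ij.
suff : ((h (g^-1)%g (h g (i, j))).1 < (h (g^-1)%g (h g (i, j))).2)%N by rewrite e.
by apply: hlt; rewrite -(inj_eq val_inj) neq_ltn hij.
Qed.

End PairProducts.

(** * Theta functions and their alternating product *)

Section ThetaKernel.
Variable R : realType.
Local Notation C := (Cx R).

(** Dividing by the antisymmetric differences of the numbers 0, ..., n - 1 leaves a symmetric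
    kernel, whose product is invariant. The sign is thus that of an ordinary Vandermonde determinant
    under a permutation of its columns. *)
Lemma prod_pairs_sign n (g : C -> C -> C) (x : 'I_n -> C) (s : {perm 'I_n}) :
  (forall i j, g (x i) (x j) = - g (x j) (x i)) ->
  \prod_(i < n) \prod_(j < n | (i < j)%N) g (x (s i)) (x (s j)) =
  (-1) ^+ s * \prod_(i < n) \prod_(j < n | (i < j)%N) g (x i) (x j).
Proof.
move=> gN.
pose a : 'rV[C]_n := \row_j (val j)%:R.
have aN (i j : 'I_n) : (i < j)%N -> a 0 j - a 0 i != 0.
  by move=> ij; rewrite !mxE subr_eq0 eqr_nat gtn_eqF.
pose k i j := g (x i) (x j) / (a 0 j - a 0 i).
have kC i j : k i j = k j i by rewrite /k gN -[a 0 j - _]opprB invrN mulrNN.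
have dV (u : 'I_n -> 'I_n) : (forall i j : 'I_n, (i < j)%N -> a 0 (u j) - a 0 (u i) != 0) ->
    \prod_(i < n) \prod_(j < n | (i < j)%N) g (x (u i)) (x (u j)) =
    (\prod_(i < n) \prod_(j < n | (i < j)%N) k (u i) (u j)) *
    \prod_(i < n) \prod_(j < n | (i < j)%N) (a 0 (u j) - a 0 (u i)).
  move=> un; rewrite -big_split; apply: eq_bigr => i _; rewrite -big_split.
  by apply: eq_bigr => j ij; rewrite /= /k divfK ?un.
rewrite (dV s) ?(dV id) //; last first.
  move=> i j ij; have sij : s i != s j by rewrite (inj_eq perm_inj) -(inj_eq val_inj) neq_ltn ij.
  have [lt|lt|/val_inj e] := ltngtP (s i) (s j); first exact: aN.
    by rewrite -opprB oppr_eq0 aN.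
  by rewrite e eqxx in sij.
rewrite (prod_pairs_sym s kC) mulrCA; congr (_ * _).
have := det_Vandermonde (\row_j a 0 (s j)).
under eq_bigr do under eq_bigr do rewrite !mxE.
move=> e; under eq_bigr do under eq_bigr do rewrite !mxE; rewrite -e.
have -> : Vandermonde n (\row_j a 0 (s j)) = col_perm s (Vandermonde n a).
  by apply/matrixP => i j; rewrite !mxE.
by rewrite col_permE det_mulmx det_perm det_Vandermonde odd_permV mulrC.
Qed.

Variable q : C.
Hypotheses (q0 : q != 0) (q1 : md q < 1).

Definition theta (u : C) : C := qpinf q u * qpinf q (q / u).

Lemma theta_qshift u : u != 0 -> theta (q * u) = - theta u / u.
Proof.
move=> u0; rewrite /theta [qpinf q u](qpinf_rec q1) invfM mulrA divff // mul1r.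
rewrite [qpinf q u^-1](qpinf_rec q1) [u * q]mulrC [u^-1 * q]mulrC; by field.
Qed.

Lemma theta_inv u : u != 0 -> theta u^-1 = - theta u / u.
Proof.
by move=> u0; rewrite -theta_qshift // /theta invfM invrK mulrC mulrA divff // mul1r.
Qed.

Lemma theta1 : theta 1 = 0.
Proof. by rewrite /theta (qpinf_rec q1) subrr !mul0r. Qed.

Lemma theta_neq0 u : u != 0 -> (forall k : int, u != q ^ k) -> theta u != 0.
Proof.
move=> u0 uk; rewrite mulf_neq0 //; apply/eqP => /(qpinf_eq0 q1)[j e].
  by have /negP := uk (- j%:Z); apply; rewrite -exprnN -[_^-1]mul1r -e mulfK ?expf_neq0.
have /negP := uk j.+1%:Z; apply; rewrite -exprnP exprS; apply/eqP.
by rewrite -[LHS]mulr1 -e mulrA; field.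
Qed.

(** The factor v makes theta(u/v) antisymmetric ([theta2N]); this is the theta analogue of v - u,
    which it contains as a factor ([theta2E]). *)
Definition theta2 (u v : C) : C := v * theta (u / v).

Lemma theta2N u v : u != 0 -> v != 0 -> theta2 u v = - theta2 v u.
Proof.
move=> u0 v0; rewrite /theta2 -(invf_div v u) theta_inv ?mulf_neq0 ?invr_eq0 //.
by rewrite invf_div; field; rewrite ?u0 ?v0.
Qed.

Lemma theta2_qshift u v : u != 0 -> v != 0 -> theta2 (q * u) v = - (v / u) * theta2 u v.
Proof.
move=> u0 v0; rewrite /theta2 -mulrA theta_qshift ?mulf_neq0 ?invr_eq0 //.
by field; rewrite ?u0 ?v0.
Qed.

Lemma theta2E u v : u != 0 -> v != 0 ->
  theta2 u v = (v - u) * (qpinf q (q * u / v) * qpinf q (q * v / u)).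
Proof.
move=> u0 v0; rewrite /theta2 /theta (qpinf_rec q1) invf_div !mulrA.
congr (_ * qpinf q _ * _); last by rewrite mulrC mulrA.
by rewrite mulrBr mulr1 mulrCA divff ?mulr1.
Qed.

Definition Theta n (x : 'I_n -> C) : C :=
  \prod_(i < n) \prod_(j < n | (i < j)%N) theta2 (x i) (x j).

Definition thetaF n (v : C) (x : 'I_n -> C) : C := Theta x * theta (v * \prod_(i < n) x i).

Lemma Theta_neq0 n (x : 'I_n -> C) : (forall i, x i != 0) ->
  (forall i j, i != j -> x i != x j /\ qpinf q (q * x i / x j) != 0) -> Theta x != 0.
Proof.
move=> x0 H; apply/prodf_neq0 => i _; apply/prodf_neq0 => j ij.
have nij : i != j by rewrite -(inj_eq val_inj) neq_ltn ij.
have [h1 h2] := H i j nij; rewrite eq_sym in nij; have [h3 h4] := H j i nij.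
by rewrite theta2E // !mulf_neq0 // subr_eq0.
Qed.

Lemma Theta_perm n (x : 'I_n -> C) (s : {perm 'I_n}) : (forall i, x i != 0) ->
  Theta (fun i => x (s i)) = (-1) ^+ s * Theta x.
Proof. by move=> x0; apply: prod_pairs_sign => i j; exact: theta2N. Qed.

Lemma thetaF_perm n v (x : 'I_n -> C) (s : {perm 'I_n}) : (forall i, x i != 0) ->
  thetaF v (fun i => x (s i)) = (-1) ^+ s * thetaF v x.
Proof.
move=> x0; rewrite /thetaF Theta_perm // -mulrA; congr (_ * (_ * theta (_ * _))).
by rewrite [RHS](reindex_inj (@perm_inj _ s)).
Qed.

Lemma thetaF_alt n v (x : 'I_n -> C) i j : (forall k, x k != 0) -> i != j -> x i = x j ->
  thetaF v x = 0.
Proof.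
move=> x0 ij xij; rewrite /thetaF /Theta.
wlog lij : i j ij xij / (i < j)%N.
  move=> W; have [l|l|/val_inj e] := ltngtP i j; first exact: (W i j).
    by apply: (W j i) => //; rewrite eq_sym.
  by rewrite e eqxx in ij.
rewrite (bigD1 i) //= (bigD1 j) //= {1}/theta2 xij divff // theta1.
by rewrite mulr0 !mul0r.
Qed.

Lemma Lau_theta f : Lau f -> Lau (fun t => (f t)^-1) -> Lau (fun t => theta (f t)).
Proof.
move=> Lf Lfi; apply: LauM (Lau_qpinf q1 Lf) _; apply: Lau_qpinf => //.
exact: LauM (Lau_cst q) Lfi.
Qed.

(** A transposition moves the variable t to place 0. Replacing t by q t then yields a factor -z_j/t
    from each of the r pairs and -1/(v t prod_j z_j) from the last theta; the z_j cancel, leaving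
    (-1)^(r+1) / (v t^(r+1)). *)
Lemma thetaF_section r v (x : 'I_r.+1 -> C) i : v != 0 -> (forall k, x k != 0) ->
  theta_space q r.+1 ((-1) ^+ r.+1 / v) (fun t => thetaF v (upd x i t)).
Proof.
move=> v0 x0.
suff H0 (y : 'I_r.+1 -> C) : (forall k, y k != 0) ->
    theta_space q r.+1 ((-1) ^+ r.+1 / v) (fun t => thetaF v (upd y ord0 t)).
  pose s := tperm ord0 i.
  have y0 k : x (s k) != 0 by exact: x0.
  have [L0 E0] := H0 (fun k => x (s k)) y0.
  have e t : t != 0 -> (-1) ^+ s * thetaF v (upd (fun k => x (s k)) ord0 t) = thetaF v (upd x i t).
    move=> t0; rewrite -thetaF_perm => [|k]; last by rewrite /upd; case: ifP.
    congr thetaF; apply: funext => k.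
    have sk : (s k == ord0) = (k == i).
      by rewrite -(inj_eq (@perm_inj _ s)) tpermK tpermL.
    by rewrite /upd sk tpermK.
  split; first exact: eq_Lau e (LauM (Lau_cst _) L0).
  by move=> t t0; rewrite -!e ?mulf_neq0 // -mulrA E0 // mulrCA.
move=> y0.
pose z (j : 'I_r) := y (lift ord0 j).
have z0 j : z j != 0 by exact: y0.
have FE t : thetaF v (upd y ord0 t) =
    (\prod_(j < r) theta2 t (z j)) * Theta z * theta (v * (t * \prod_(j < r) z j)).
  by rewrite /thetaF /Theta prod_pairs_recl big_ord_recl.
have P0 : \prod_(j < r) z j != 0 by apply/prodf_neq0 => j _.
split.
  apply: eq_Lau (fun t _ => esym (FE t)) _.
  apply: LauM; first apply: LauM (Lau_cst _).
    apply: Lau_prod => j _; apply: LauM (Lau_cst _) _; apply: Lau_theta.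
      exact: LauM (@Lau_id R) (Lau_cst _).
    apply: eq_Lau (LauM (Lau_cst (z j)) (@Lau_inv R)) => t _; by rewrite invf_div.
  apply: Lau_theta; first by apply: LauM (Lau_cst _) (LauM (@Lau_id R) (Lau_cst _)).
  apply: eq_Lau (LauM (Lau_cst (v * \prod_(j < r) z j)^-1) (@Lau_inv R)) => t _.
  by rewrite !invfM; ring.
move=> t t0; rewrite !FE.
have -> : v * (q * t * \prod_(j < r) z j) = q * (v * (t * \prod_(j < r) z j)) by ring.
rewrite theta_qshift ?mulf_neq0 //.
rewrite (eq_bigr (fun j => - (z j / t) * theta2 t (z j))) => [|j _]; last exact: theta2_qshift.
rewrite big_split /= (eq_bigr (fun j => (- t^-1) * z j)) => [|j _]; last by ring.
rewrite big_split /= prodr_const card_ord [(- t^-1) ^+ r]exprNn exprVn !exprS.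
have tr0 : t ^+ r != 0 by rewrite expf_neq0.
by field; rewrite ?t0 ?v0 ?tr0 ?P0.
Qed.

End ThetaKernel.

(** * Bilateral series *)

Section BilateralSums.
Variable R : realType.
Local Notation C := (Cx R).

Definition bsum (f : int -> C) (L : nat) : C := \sum_(t < (L + L).+1) f (t%:Z - L%:Z).

(** Limit of the symmetric truncations, with value 0 if there is none; being total, it defines [psi]
    for all arguments without a convergence proof. *)
Definition bilim (f : int -> C) : C := xget 0 [set l | tends (bsum f) l].

Lemma bsum0 f : bsum f 0 = f 0.
Proof. by rewrite /bsum big_ord1. Qed.

Lemma bsumS f L : bsum f L.+1 = bsum f L + (f L.+1%:Z + f (- L.+1%:Z)).
Proof.
rewrite /bsum addSn addnS big_ord_recl big_ord_recr /=.
have swap (a b c : C) : a + (b + c) = b + c + a by ring.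
rewrite [LHS]swap [RHS]addrA; congr (_ + f _ + f _); rewrite ?/bump /=; [|lia|lia].
by apply: eq_bigr => i _; congr f; rewrite /bump /=; lia.
Qed.

Variables (f : int -> C) (K t : R).
Hypotheses (t0 : 0 <= t) (t1 : t < 1) (fK : forall k, md (f k) <= K * t ^+ `|k|).

Lemma bsum_step L : md (bsum f L.+1 - bsum f L) <= 2 * K * t * t ^+ L.
Proof.
rewrite bsumS addrAC subrr add0r; apply: le_trans (ler_mdD _ _) _.
have := fK L.+1%:Z; have := fK (- L.+1%:Z); rewrite abszN absz_nat exprS; lra.
Qed.

Lemma bilim_tends : tends (bsum f) (bilim f).
Proof.
have [l ul _] := geo_tends t0 t1 bsum_step.
by rewrite /bilim; case: xgetP => [y _ //|/(_ l)].
Qed.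

Lemma bilim_approx L : md (bsum f L - bilim f) <= 2 * K * t / (1 - t) * t ^+ L.
Proof.
have [l ul H] := geo_tends t0 t1 bsum_step.
by rewrite (tends_unique bilim_tends ul) mulrAC.
Qed.

Lemma tail_tends0 (e : nat -> int) : (forall L, (L <= `|e L|)%N) -> tends (fun L => f (e L)) 0.
Proof.
move=> eL eps e0; have [N HN] := geo_small K t0 t1 e0.
exists N => L NL; rewrite subr0; apply: le_trans (fK _) _; apply: HN.
exact: leq_trans (eL L).
Qed.

(** A symmetric window is not invariant under translation, but the two sums differ only by the
    boundary terms f(L + 1) and f(-L), which tend to 0. *)
Lemma bsum_shift_tends : tends (bsum (fun k => f (k + 1))) (bilim f).
Proof.
have shiftE L : bsum (fun k => f (k + 1)) L = bsum f L + (f (L%:Z + 1) + (-1) * f (- L%:Z)).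
  elim: L => [|L IH]; first by rewrite !bsum0 oppr0 add0r; ring.
  rewrite !bsumS IH; have -> : - L.+1%:Z + 1 = - L%:Z by lia.
  have -> : L%:Z + 1 = L.+1%:Z by lia.
  by ring.
apply: eq_tends (fun L => esym (shiftE L)) _.
rewrite -[bilim f]addr0; apply: tendsD bilim_tends _.
rewrite -[0]addr0 -{2}(mulr0 (-1)); apply: tendsD; last apply: tendsZ.
  by apply: tail_tends0 => L; lia.
by apply: tail_tends0 => L; rewrite abszN.
Qed.

End BilateralSums.

Lemma bilimE (R : realType) (f : int -> Cx R) l : tends (bsum f) l -> bilim f = l.
Proof.
by move=> H; rewrite /bilim; case: xgetP => [y _ /= /tends_unique|/(_ l)//]; apply.
Qed.

(** * Pole-free weights and their recurrences *)

Section Psi.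
Variable R : realType.
Local Notation C := (Cx R).
Variables (q p : C) (r s : nat) (A B : 'I_r.+1 -> C) (Cl : 'I_s -> C) (N : 'I_s -> nat).
Hypotheses (q0 : q != 0) (q1 : md q < 1) (p2 : p ^+ 2 = q).
Hypotheses (A0 : forall i, A i != 0) (B0 : forall i, B i != 0).
Local Notation tq := (md q).

Let p0 : p != 0. Proof. by apply: contra_neq q0 => p00; rewrite -p2 p00 expr0n. Qed.

(** Numerator and denominator parameters that differ by a factor q^N have a Pochhammer ratio
    polynomial in q^k: it is the quotient of the values of this product at x q^k and at x, by
    [qpoch_shift_ratio]. *)
Definition km_poly (X : C) : C := \prod_(l < s) qpoch_n q (Cl l * X) (N l).

(* [p ^ (k * k - k)] is q^(k(k-1)/2), since [p ^+ 2 = q]. *)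
Definition afac (a x : C) (k : int) : C :=
  qpinf q (q ^ (1 - k) / (a * x)) * ((- (a * x)) ^ k * p ^ (k * k - k)).

(** The Pochhammer quotient [lattice_weight] multiplied by a factor independent of k
    ([tau_amplitude]), in a form with no Pochhammer denominator left, hence holomorphic off 0. *)
Definition tau (k : int) (x : C) : C :=
  km_poly (x * q ^ k) * \prod_(i < r.+1) (qpinf q (B i * x * q ^ k) * afac (A i) x k).

(** The power j labels the Vandermonde column, and v records the index k. *)
Definition bilateral_term (v : C) (j : nat) (k : int) (x : C) : C :=
  v ^ k * (x * q ^ k) ^+ j * tau k x.

Lemma gauss_succ (u : C) (k : int) : u != 0 ->
  u ^ (k + 1) * p ^ ((k + 1) * (k + 1) - (k + 1)) = u * q ^ k * (u ^ k * p ^ (k * k - k)).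
Proof.
move=> u0; have -> : (k + 1) * (k + 1) - (k + 1) = (k * k - k) + (k + k) by ring.
rewrite !(expfzDr _ _ u0) (expfzDr (k * k - k)) // (expfzDr k k) // expr1z -p2 expr2 expfzMl.
by move: (p ^ (k * k - k)) (p ^ k) (u ^ k) => x y z; ring.
Qed.

Lemma afac_shift a x k : a != 0 -> x != 0 ->
  afac a (q * x) k = afac a x (k + 1) * (- (a * x))^-1.
Proof.
move=> a0 x0; have ax0 : - (a * x) != 0 by rewrite oppr_eq0 mulf_neq0.
rewrite /afac gauss_succ // -!mulrA; congr (qpinf q _ * _).
  have -> : 1 - k = 1 + - (k + 1) + 1 by ring.
  rewrite (expfzDr (1 + _)) // expr1z; have -> : 1 - (k + 1) = 1 + - (k + 1) by [].
  by field; rewrite a0 q0 x0.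
have -> : - (a * (q * x)) = q * - (a * x) by ring.
by rewrite expfzMl; field; rewrite x0 a0.
Qed.

Lemma afac_rec a x k : a != 0 -> x != 0 ->
  afac a x (k + 1) = afac a x k * (1 - a * x * q ^ k).
Proof.
move=> a0 x0; have ax0 : - (a * x) != 0 by rewrite oppr_eq0 mulf_neq0.
have qk0 : q ^ k != 0 by exact: expfz_neq0.
rewrite /afac gauss_succ //; have -> : 1 - (k + 1) = - k by ring.
rewrite (qpinf_rec q1 (q ^ (- k) / _)).
have -> : q ^ (- k) / (a * x) * q = q ^ (1 - k) / (a * x).
  by rewrite (expfzDr 1) // expr1z; ring.
rewrite -invr_expz; field; by rewrite a0 x0 qk0.
Qed.

Lemma afac0 a x : afac a x 0 = qpinf q (q / (a * x)).
Proof. by rewrite /afac subr0 expr1z !expr0z mulr1 mulr1. Qed.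

Lemma afac_nat a x n : a != 0 -> x != 0 ->
  afac a x n%:Z = qpinf q (q / (a * x)) * qpoch_n q (a * x) n.
Proof.
move=> a0 x0; elim: n => [|n IH]; first by rewrite afac0 qpoch_n0 mulr1.
by rewrite intS addrC afac_rec // IH qpoch_nS mulrA.
Qed.

Lemma afac_negz a x n : a != 0 -> x != 0 ->
  afac a x (- n%:Z) * \prod_(j < n) (1 - a * x * q ^- j.+1) = qpinf q (q / (a * x)).
Proof.
move=> a0 x0; elim: n => [|n IH]; first by rewrite oppr0 big_ord0 mulr1 afac0.
rewrite big_ord_recr /= -{}[RHS]IH mulrCA mulrC; congr (_ * _).
have -> : - n%:Z = - n.+1%:Z + 1 by rewrite intS; ring.
by rewrite afac_rec // exprnN mulrC.
Qed.

Lemma bfac_negz b x n :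
  qpinf q (b * x * q ^ (- n%:Z)) = qpinf q (b * x) * \prod_(j < n) (1 - b * x * q ^- j.+1).
Proof.
elim: n => [|n IH]; first by rewrite oppr0 big_ord0 expr0z !mulr1.
rewrite big_ord_recr /= mulrA -IH (qpinf_rec q1) exprnN mulrC; congr (qpinf q _ * _).
have -> : - n%:Z = - n.+1%:Z + 1 by rewrite intS; ring.
by rewrite expfzDr // expr1z mulrA.
Qed.

(** The product in b grows like an inverse Gaussian in n, and the Gaussian in [afac] decays at the
    same rate. The two cancel, and (b/a)^n remains with factors bounded in n. *)
Lemma bafac_negz a b x n : a != 0 -> b != 0 -> x != 0 ->
  qpinf q (b * x * q ^ (- n%:Z)) * ((- (a * x)) ^ (- n%:Z) * p ^ (- n%:Z * - n%:Z - - n%:Z)) =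
  (b / a) ^+ n * (qpoch_n q (q / (b * x)) n * qpinf q (b * x)).
Proof.
move=> a0 b0 x0; have ax0 : - (a * x) != 0 by rewrite oppr_eq0 mulf_neq0.
elim: n => [|n IH]; first by rewrite oppr0 mulr0 subrr !expr0z qpoch_n0 expr0 !mulr1 !mul1r.
rewrite qpoch_nS exprS.
have e : - n%:Z = - n.+1%:Z + 1 by rewrite intS; ring.
have q' : q ^ (- n.+1%:Z) != 0 by exact: expfz_neq0.
move: IH; rewrite e gauss_succ // expfzDr // expr1z => IH.
rewrite (qpinf_rec q1 (b * x * q ^ (- n.+1%:Z))).
have -> : q / (b * x) * q ^+ n = (b * x * q ^ (- n.+1%:Z))^-1.
  by rewrite -exprnN !invfM invrK exprS; ring.
set Q := q ^ (- n.+1%:Z) in q' IH *.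
set G := _ ^ _ * _ in IH *; rewrite -[b * x * Q * q]mulrA; set X := qpinf q (b * x * (Q * q)) in IH *.
transitivity ((b / a) * (1 - (b * x * Q)^-1) * (X * (- (a * x) * Q * G))).
  by field; rewrite a0 b0 x0 q'.
by rewrite IH; ring.
Qed.

(** Replacing x by q x has the effect of raising k by 1, up to a monomial; the functional equation
    of the bilateral series comes from this. *)
Lemma tau_shift k x : x != 0 ->
  tau k (q * x) = (\prod_(i < r.+1) (- (A i * x))^-1) * tau (k + 1) x.
Proof.
move=> x0; have e : q * x * q ^ k = x * q ^ (k + 1) by rewrite expfzDr // expr1z; ring.
rewrite /tau e mulrCA; congr (_ * _); rewrite -big_split; apply: eq_bigr => i _ /=.
rewrite afac_shift // -[B i * (q * x) * _]mulrA e mulrA [RHS]mulrC -!mulrA; by [].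
Qed.

Lemma sterm_shift v j k x : v != 0 -> x != 0 ->
  bilateral_term v j k (q * x) =
  v^-1 * (\prod_(i < r.+1) (- (A i * x))^-1) * bilateral_term v j (k + 1) x.
Proof.
move=> v0 x0; rewrite /bilateral_term tau_shift // (expfzDr k 1 v0) expr1z.
have -> : q * x * q ^ k = x * q ^ (k + 1) by rewrite expfzDr // expr1z; ring.
by field.
Qed.

Lemma Lau_sterm v j k : Lau (bilateral_term v j k).
Proof.
have Lq c : Lau (fun x : C => c * x * q ^ k).
  by apply: LauM (Lau_cst _); apply: LauM (Lau_cst _) (@Lau_id R).
apply: LauM; first apply: LauM (Lau_cst _) _.
  by apply: LauX; apply: LauM (@Lau_id R) (Lau_cst _).
apply: LauM; apply: Lau_prod => i _.
  apply: Lau_qpoch_n; apply: LauM (Lau_cst _) _; exact: LauM (@Lau_id R) (Lau_cst _).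
apply: LauM; first by apply: Lau_qpinf.
apply: LauM.
  apply: Lau_qpinf => //; apply: LauM (Lau_cst _) _.
  by apply: eq_Lau (LauM (Lau_cst (A i)^-1) (@Lau_inv R)) => x _; rewrite invfM.
apply: LauM (Lau_cst _).
apply: (@eq_Lau _ (fun x => (- A i) ^ k * x ^ k)) => [x _|].
  by rewrite -expfzMl mulNr.
exact: LauM (Lau_cst _) (Lau_exprz _).
Qed.

End Psi.

(** * Geometric bounds for the bilateral terms *)

Section PsiBounds.
Variable R : realType.
Local Notation C := (Cx R).
Variables (q p : C) (r s : nat) (A B : 'I_r.+1 -> C) (Cl : 'I_s -> C) (N : 'I_s -> nat).
Hypotheses (q0 : q != 0) (q1 : md q < 1) (p2 : p ^+ 2 = q).
Hypotheses (A0 : forall i, A i != 0) (B0 : forall i, B i != 0).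
Local Notation tq := (md q).
Local Notation sterm := (bilateral_term q p A B Cl N).

(** D stands for the size of q^k: 1 for k >= 0 and |q|^(-m) for k = -m. The growth is isolated as a
    power of D whose exponent is the degree. *)
Lemma km_poly_le (X : C) (rho D : R) : 1 <= D -> md X <= rho * D ->
  md (km_poly q Cl N X) <=
  (\prod_(l < s) (1 + md (Cl l) * rho) ^+ N l) * D ^+ (\sum_(l < s) N l)%N.
Proof.
move=> D1 XD; have rho0 : 0 <= rho.
  by rewrite -(pmulr_lge0 _ (lt_le_trans ltr01 D1)) (le_trans (md_ge0 X)).
rewrite -prodrXr -big_split md_prod ler_prod //= => l _; rewrite md_ge0 /=.
rewrite -exprMn md_prod -[X in _ ^+ X]card_ord -prodr_const ler_prod // => j _.
rewrite md_ge0 /=; apply: le_trans (ler_mdB _ _) _; rewrite md1 mulrDl mul1r lerD //.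
rewrite !mdM -mulrA -[leRHS]mulrA ler_wpM2l ?md_ge0 //.
rewrite -[leRHS]mulr1 ler_pM ?md_ge0 // mdX exprn_ile1 ?md_ge0 // ltW //.
Qed.

(** Decay rate at minus infinity, before division by |v|: B_i/A_i comes from [bafac_negz], the
    exponent r from the Vandermonde power and the sum of the N_l from [km_poly]. For the data of the
    theorem it equals |w|. *)
Definition conv_ratio : R := md (\prod_(i < r.+1) (B i / A i)) / tq ^+ (r + \sum_(l < s) N l)%N.

Lemma sterm_bounds (rho rv : R) : 1 <= rho -> 0 < rv -> exists2 K, 0 <= K &
  forall v x (j m : nat), md v = rv -> annulus rho x -> (j <= r)%N ->
    md (sterm v j m%:Z x) <= K * rv ^+ m /\
    md (sterm v j (- m%:Z) x) <= K * (conv_ratio / rv) ^+ m.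
Proof.
move=> r1 rv0; have tq0 : 0 < tq by rewrite md_gt0.
have rho0 : 0 < rho by lra.
(* On the annulus [T] dominates A_i x, B_i x, q/(A_i x) and q/(B_i x), the arguments of all the
   q-products below. *)
pose T := rho * \sum_(i < r.+1) (md (A i) + md (B i) + tq / md (A i) + tq / md (B i)).
have TP i : [/\ rho * md (A i) <= T, rho * md (B i) <= T,
    rho * (tq / md (A i)) <= T & rho * (tq / md (B i)) <= T].
  have h1 := md_ge0 (A i); have h2 := md_ge0 (B i).
  have h3 : 0 <= tq / md (A i) by rewrite divr_ge0 ?md_ge0.
  have h4 : 0 <= tq / md (B i) by rewrite divr_ge0 ?md_ge0.
  have h : md (A i) + md (B i) + tq / md (A i) + tq / md (B i) <= T / rho.
    rewrite /T mulrAC divff ?gt_eqF // mul1r (bigD1 i) //= lerDl sumr_ge0 // => k _.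
    by rewrite !addr_ge0 ?divr_ge0 ?md_ge0.
  have key y : y <= T / rho -> rho * y <= T.
    by rewrite ler_pdivlMr // mulrC.
  by split; apply: key; lra.
pose Q := qbnd q T; have Q0 : 0 < Q by exact: qbnd_gt0.
pose KP := \prod_(l < s) (1 + md (Cl l) * rho) ^+ N l.
have KP0 : 0 <= KP.
  by apply: prodr_ge0 => l _; rewrite exprn_ge0 // addr_ge0 // mulr_ge0 ?md_ge0 // ltW.
(* One factor for the Vandermonde power, one for the polynomial, and for each i three q-products, in
   both directions of k. *)
pose K := rho ^+ r * KP * (Q * (Q * Q)) ^+ r.+1.
have Q3 : 0 < Q * (Q * Q) by rewrite !mulr_gt0.
exists K; first by rewrite /K !mulr_ge0 ?exprn_ge0 // ltW.
move=> v x j m vr xr jr; have x0 := ann_neq0 r1 xr.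
have := annV r1 xr; case/andP: (xr) => _ xle /andP[_ xile]; rewrite mdV in xile.
have mq k : md (q ^+ k) <= 1 by rewrite mdX exprn_ile1 ?md_ge0 // ltW.
have bA i : md (A i * x) <= T.
  by case: (TP i) => h _ _ _; apply: le_trans h; rewrite mdM mulrC ler_wpM2r ?md_ge0.
have bB i : md (B i * x) <= T.
  by case: (TP i) => _ h _ _; apply: le_trans h; rewrite mdM mulrC ler_wpM2r ?md_ge0.
have bA' i : md (q / (A i * x)) <= T.
  case: (TP i) => _ _ h _; apply: le_trans h.
  have -> : md (q / (A i * x)) = (md x)^-1 * (tq / md (A i)).
    by rewrite mdM mdV mdM invfM; ring.
  by rewrite ler_wpM2r // mulr_ge0 ?invr_ge0 ?md_ge0.
have bB' i : md (q / (B i * x)) <= T.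
  case: (TP i) => _ _ _ h; apply: le_trans h.
  have -> : md (q / (B i * x)) = (md x)^-1 * (tq / md (B i)).
    by rewrite mdM mdV mdM invfM; ring.
  by rewrite ler_wpM2r // mulr_ge0 ?invr_ge0 ?md_ge0.
have bq y k : md y <= T -> md (y * q ^+ k) <= T.
  by move=> h; apply: le_trans h; rewrite mdM -[leRHS]mulr1 ler_wpM2l ?md_ge0.
have rj : rho ^+ j <= rho ^+ r by rewrite ler_weXn2l.
have prodb (F : 'I_r.+1 -> C) (D : 'I_r.+1 -> R) :
    (forall i, md (F i) <= D i * (Q * (Q * Q))) ->
    md (\prod_i F i) <= (\prod_i D i) * (Q * (Q * Q)) ^+ r.+1.
  move=> FD; rewrite md_prod -[X in _ ^+ X]card_ord -prodr_const -big_split.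
  by apply: ler_prod => i _; rewrite md_ge0 /= FD.
split.
  have kb : md (km_poly q Cl N (x * q ^ m%:Z)) <= KP.
    apply: le_trans (@km_poly_le _ rho 1 (lexx 1) _) _; last by rewrite expr1n mulr1.
    by rewrite -exprnP mdM ler_pM ?md_ge0.
  have pb := prodb (fun i => qpinf q (B i * x * q ^ m%:Z) * afac q p (A i) x m%:Z) (fun _ => 1).
  rewrite big1_eq mul1r in pb.
  have xb : md ((x * q ^ m%:Z) ^+ j) <= rho ^+ r.
    apply: le_trans rj; rewrite mdX; apply: lerXn2r; rewrite ?nnegrE ?md_ge0 ?(ltW rho0) //.
    by rewrite -exprnP mdM -[X in _ <= X]mulr1 ler_pM ?md_ge0.
  rewrite /bilateral_term /tau !mdM [md (v ^ _)]mdXz vr.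
  have -> : K * rv ^+ m = rv ^ m%:Z * rho ^+ r * (KP * (Q * (Q * Q)) ^+ r.+1).
    by rewrite /K -exprnP; ring.
  apply: ler_pM; [by rewrite mulr_ge0 ?md_ge0 // exprz_ge0 // ltW | by rewrite mulr_ge0 ?md_ge0 | |].
    by rewrite ler_wpM2l // exprz_ge0 // ltW.
  apply: ler_pM; rewrite ?md_ge0 //.
  rewrite mul1r in pb; apply: pb => i; rewrite afac_nat // !mdM ler_pM ?mulr_ge0 ?md_ge0 //.
    by apply: qpinf_le => //; apply: bq.
  by rewrite ler_pM ?md_ge0 ?qpinf_le ?qpoch_n_le.
(* The modulus of q^(-m), the only unbounded quantity left for negative indices. *)
pose D : R := (tq ^+ m)^-1.
have D1 : 1 <= D by rewrite /D invf_ge1 ?exprn_gt0 // exprn_ile1 // ltW.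
have D0 : 0 < D by lra.
have qD : md (x * q ^ (- m%:Z)) <= rho * D.
  by rewrite mdM -exprnN mdV mdX ler_wpM2r // ltW.
have kb := km_poly_le D1 qD; rewrite -/KP in kb.
have pb := prodb (fun i => qpinf q (B i * x * q ^ (- m%:Z)) * afac q p (A i) x (- m%:Z))
  (fun i => md ((B i / A i) ^+ m)) _.
have xb : md ((x * q ^ (- m%:Z)) ^+ j) <= rho ^+ r * D ^+ r.
  rewrite mdX; apply: (@le_trans _ _ ((rho * D) ^+ j)).
    by rewrite lerXn2r ?nnegrE ?md_ge0 // mulr_ge0 // ltW.
  rewrite exprMn; apply: ler_pM => //; rewrite ?exprn_ge0 ?(ltW rho0) ?(ltW D0) //.
  exact: ler_weXn2l.
rewrite /bilateral_term /tau !mdM [md (v ^ _)]mdXz vr.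
have -> : K * (conv_ratio / rv) ^+ m = rv ^ (- m%:Z) * (rho ^+ r * D ^+ r) *
   (KP * D ^+ (\sum_(l < s) N l)%N *
    ((\prod_i md ((B i / A i) ^+ m)) * (Q * (Q * Q)) ^+ r.+1)).
  have -> : \prod_i md ((B i / A i) ^+ m) = md (\prod_i (B i / A i)) ^+ m.
    by rewrite md_prod -prodrXl; apply: eq_bigr => i _; rewrite mdX.
  rewrite /K /conv_ratio /D -exprnN !exprMn !exprVn -!exprM [((r + _) * m)%N]mulnC mulnDr exprD.
  by rewrite invfM; ring.
apply: ler_pM; [by rewrite mulr_ge0 ?md_ge0 // exprz_ge0 // ltW | by rewrite mulr_ge0 ?md_ge0 | |].
  by rewrite ler_wpM2l // exprz_ge0 // ltW.
apply: ler_pM; rewrite ?md_ge0 //.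
apply: pb => i.
have -> : qpinf q (B i * x * q ^ (- m%:Z)) * afac q p (A i) x (- m%:Z) =
    (B i / A i) ^+ m * (qpinf q (q / (A i * x) * q ^+ m) *
      (qpoch_n q (q / (B i * x)) m * qpinf q (B i * x))).
  have E := bafac_negz q0 q1 p2 m (A0 i) (B0 i) x0.
  rewrite /afac mulrCA E mulrCA; congr (_ * (qpinf q _ * _)).
  by rewrite opprK expfzDr // expr1z -exprnP mulrAC.
rewrite mdM; apply: ler_wpM2l; first exact: md_ge0.
rewrite mdM; apply: ler_pM; rewrite ?md_ge0 //; first by apply: qpinf_le => //; apply: bq.
by rewrite mdM; apply: ler_pM; rewrite ?md_ge0 ?qpinf_le ?qpoch_n_le.
Qed.

End PsiBounds.

(** * Determinants of bilateral series as theta products *)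

Section PsiDeterminant.
Variable R : realType.
Local Notation C := (Cx R).
Variables (q p : C) (r s : nat) (A B : 'I_r.+1 -> C) (Cl : 'I_s -> C) (N : 'I_s -> nat).
Hypotheses (q0 : q != 0) (q1 : md q < 1) (p2 : p ^+ 2 = q).
Hypotheses (A0 : forall i, A i != 0) (B0 : forall i, B i != 0).
Local Notation tq := (md q).
Local Notation sterm := (bilateral_term q p A B Cl N).
Local Notation W := (conv_ratio q A B N).

Lemma conv_ratio_ge0 : 0 <= W.
Proof. by rewrite divr_ge0 ?exprn_ge0 ?md_ge0. Qed.

(** Both directions share the ratio max(rv, W/rv), which is below 1 because W < rv < 1. The bound
    sees v only through its modulus, so it is uniform on the circle. *)
Lemma sterm_geo (rho rv : R) : 1 <= rho -> W < rv -> rv < 1 ->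
  exists K t, [/\ 0 <= K, 0 <= t, t < 1 & forall v x j k, md v = rv -> annulus rho x ->
    (j <= r)%N -> md (sterm v j k x) <= K * t ^+ `|k|].
Proof.
move=> r1 Wv v1; have rv0 : 0 < rv by apply: le_lt_trans Wv; exact: conv_ratio_ge0.
have [K K0 HK] := sterm_bounds Cl N q0 q1 p2 A0 B0 r1 rv0.
have wv0 : 0 <= W / rv by rewrite divr_ge0 ?conv_ratio_ge0 // ltW.
exists K, (Num.max rv (W / rv)); split => //; first by rewrite le_max ltW.
  by rewrite gt_max v1 ltr_pdivrMr // mul1r.
move=> v x j k vr xr jr.
have [m km] : exists m : nat, k = m%:Z \/ k = - m%:Z.
  by case: k => m; [exists m; left | exists m.+1; right; rewrite NegzE].
have [h1 h2] := HK v x j m vr xr jr.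
have t0 : 0 <= Num.max rv (W / rv) by rewrite le_max ltW.
case: km => ->; rewrite ?abszN absz_nat.
  apply: le_trans h1 _; apply: ler_wpM2l => //; apply: lerXn2r; rewrite ?nnegrE ?(ltW rv0) //.
  by rewrite le_max lexx.
apply: le_trans h2 _; apply: ler_wpM2l => //; apply: lerXn2r; rewrite ?nnegrE //.
by rewrite le_max lexx orbT.
Qed.

Definition psi (v : C) (j : nat) (x : C) : C := bilim (fun k => sterm v j k x).

(** The shift of k absorbs x -> q x. The multiplier is that of [thetaF_section] at v prod_i A_i,
    which explains the argument of the last theta factor. *)
Lemma psi_theta_space v j : W < md v -> md v < 1 -> (j <= r)%N ->
  theta_space q r.+1 ((-1) ^+ r.+1 / (v * \prod_i A i)) (psi v j).
Proof.
move=> Wv v1 jr; have v0 : v != 0.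
  by rewrite -md_gt0; apply: le_lt_trans Wv; exact: conv_ratio_ge0.
split.
  apply: Lau_lim => rho e r1 e0; have [K [t [K0 t0 t1 HK]]] := sterm_geo r1 Wv v1.
  have [L HL] := geo_small (2 * K * t / (1 - t)) t0 t1 e0.
  exists (fun x => bsum (fun k => sterm v j k x) L).
    by apply: Lau_sum => i; exact: Lau_sterm.
  move=> x xr; rewrite mdB; apply: le_trans (HL L (leqnn L)).
  by apply: bilim_approx => // k; exact: HK.
move=> x x0; have [rho r1 xr] := ann_exists x0.
have [K [t [K0 t0 t1 HK]]] := sterm_geo r1 Wv v1.
have Hx k : md (sterm v j k x) <= K * t ^+ `|k| by exact: HK.
pose a := v^-1 * (\prod_(i < r.+1) (- (A i * x))^-1).
have -> : psi v j (q * x) = a * psi v j x.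
  apply: bilimE; apply: eq_tends (tendsZ a (bsum_shift_tends t0 t1 Hx)) => L.
  by rewrite /bsum mulr_sumr; apply: eq_bigr => u _; rewrite sterm_shift.
rewrite mulrAC; congr (_ * _); rewrite /a.
have -> : \prod_(i < r.+1) (- (A i * x))^-1 = \prod_(i < r.+1) ((- x^-1) * (A i)^-1).
  by apply: eq_bigr => i _; rewrite invrN invfM mulNr mulrC.
rewrite big_split /= prodr_const card_ord prodfV invfM [(- x^-1) ^+ _]exprNn exprVn.
have P0 : \prod_i A i != 0 by apply/prodf_neq0.
have X0 : x ^+ r.+1 != 0 by rewrite expf_neq0.
by field; rewrite X0 P0 v0.
Qed.

Lemma psi_det v (x y : 'I_r.+1 -> C) : W < md v -> md v < 1 ->
  (forall i, x i != 0) -> (forall i, y i != 0) -> thetaF q (v * \prod_i A i) y != 0 ->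
  \det (section_mx (fun j => psi v (val j)) x) * thetaF q (v * \prod_i A i) y =
  \det (section_mx (fun j => psi v (val j)) y) * thetaF q (v * \prod_i A i) x.
Proof.
move=> Wv v1 x0 y0 Fy; have v0 : v != 0.
  by rewrite -md_gt0; apply: le_lt_trans Wv; exact: conv_ratio_ge0.
have P0 : \prod_i A i != 0 by apply/prodf_neq0.
have c0 : (-1) ^+ r.+1 / (v * \prod_i A i) != 0 :> C.
  by rewrite mulf_neq0 ?signr_eq0 // invr_eq0 mulf_neq0.
apply: (theta_det_proportional q0 c0 (ltn0Sn r) (F := thetaF q (v * \prod_i A i))) => //.
- by move=> j; apply: psi_theta_space => //; rewrite -ltnS ltn_ord.
- by move=> z i z0; apply: thetaF_section => //; rewrite mulf_neq0.
- by move=> z i j z0 ij zij; apply: (thetaF_alt q1 _ z0 ij zij).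
- by move=> z g z0; apply: thetaF_perm.
Qed.

(** Equal products of coordinates give both sides the same last theta factor. Its argument has a
    modulus that is no power of |q|, so the factor is nonzero and cancels. *)
Lemma psi_det_Theta v (x y : 'I_r.+1 -> C) : W < md v -> md v < 1 ->
  (forall i, x i != 0) -> (forall i, y i != 0) -> \prod_i x i = \prod_i y i ->
  Theta q y != 0 -> (forall k : int, md (v * \prod_i A i * \prod_i y i) != tq ^ k) ->
  \det (section_mx (fun j => psi v (val j)) x) * Theta q y =
  \det (section_mx (fun j => psi v (val j)) y) * Theta q x.
Proof.
move=> Wv v1 x0 y0 xy Ty vk; have v0 : v != 0.
  by rewrite -md_gt0; apply: le_lt_trans Wv; exact: conv_ratio_ge0.
have th0 : theta q (v * \prod_i A i * \prod_i y i) != 0.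
  apply: (theta_neq0 q0 q1) => [|k]; first by rewrite !mulf_neq0 //; apply/prodf_neq0.
  by apply: contra_neq (vk k) => ->; rewrite mdXz.
have cancel (K : fieldType) (a b c d t : K) : t != 0 -> a * (b * t) = c * (d * t) -> a * b = c * d.
  by move=> t0; rewrite !mulrA => /(mulIf t0).
apply: (cancel _ _ _ _ _ _ th0); have := psi_det Wv v1 x0 y0 (mulf_neq0 Ty th0).
by rewrite /thetaF xy.
Qed.

End PsiDeterminant.

(** * A Lipschitz bound for determinants *)

Section DetClose.
Variable R : realType.
Local Notation C := (Cx R).

Lemma prod_close (I : Type) (t : seq I) (a b : I -> C) (M d : R) : 1 <= M ->
  (forall i, md (a i) <= M) -> (forall i, md (b i) <= M) -> (forall i, md (a i - b i) <= d) ->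
  md (\prod_(i <- t) a i - \prod_(i <- t) b i) <= (size t)%:R * M ^+ size t * d.
Proof.
move=> M1 aM bM abd; have M0 : 0 <= M by lra.
have prodM (c : I -> C) u : (forall i, md (c i) <= M) -> md (\prod_(i <- u) c i) <= M ^+ size u.
  move=> cM; elim: u => [|i u IH]; first by rewrite big_nil md1.
  by rewrite big_cons mdM exprS ler_pM ?md_ge0.
elim: t => [|i t IH]; first by rewrite !big_nil subrr md0 !mul0r.
have d0 : 0 <= d by apply: le_trans (abd i); exact: md_ge0.
rewrite !big_cons /=; set x := \prod_(_ <- _) a _ in IH *; set y := \prod_(_ <- _) b _ in IH *.
have -> : a i * x - b i * y = a i * (x - y) + (a i - b i) * y by ring.
apply: le_trans (ler_mdD _ _) _; rewrite !mdM.
have h1 : md (a i) * md (x - y) <= M * ((size t)%:R * M ^+ size t * d).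
  by rewrite ler_pM ?md_ge0.
have h2 : md (a i - b i) * md y <= d * M ^+ size t by rewrite ler_pM ?md_ge0 // prodM.
have h3 : d * M ^+ size t <= M * (M ^+ size t * d).
  by rewrite mulrC -[leLHS]mul1r ler_wpM2r // mulr_ge0 ?exprn_ge0.
by apply: le_trans (lerD h1 (le_trans h2 h3)) _; rewrite -addn1 natrD exprD expr1; lra.
Qed.

(** The constant depends only on the size and the entry bound, hence may be used uniformly along a
    circle of values of v. *)
Lemma det_close n (M : R) : 1 <= M -> exists2 Q : R, 0 < Q & forall (X Y : 'M[C]_n) d,
  (forall i j, md (X i j) <= M) -> (forall i j, md (Y i j) <= M) ->
  (forall i j, md (X i j - Y i j) <= d) -> 0 <= d -> md (\det X - \det Y) <= Q * d.
Proof.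
move=> M1; pose Q0 : R := n%:R * M ^+ n.
(* Adding 1 keeps the constant positive even for n = 0. *)
exists (#|{: {perm 'I_n}}|%:R * Q0 + 1).
  by rewrite ltr_wpDl // mulr_ge0 ?ler0n // mulr_ge0 ?ler0n // exprn_ge0; lra.
move=> X Y d XM YM XY d0; rewrite /determinant -sumrB.
apply: le_trans (ler_md_sum _ _ _) _.
apply: (@le_trans _ _ (\sum_(s : {perm 'I_n}) Q0 * d)).
  apply: ler_sum => s _; rewrite -mulrBr mdM mdX mdN md1 expr1n mul1r.
  have := @prod_close _ (index_enum 'I_n) (fun i => X i (s i)) (fun i => Y i (s i)) M d M1
    (fun i => XM _ _) (fun i => YM _ _) (fun i => XY _ _).
  by have -> : size (index_enum 'I_n) = n by rewrite -[RHS](card_ord n) cardT enumT.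
by rewrite sumr_const mulrDl mul1r -mulrnAl mulr_natl ler_wpDr.
Qed.

End DetClose.

(** * Constant terms and limits *)

Section ConstantTerm.
Variable R : realType.
Local Notation C := (Cx R).
Variables (q p : C) (r s : nat) (A B : 'I_r.+1 -> C) (Cl : 'I_s -> C) (N : 'I_s -> nat).
Local Notation sterm := (bilateral_term q p A B Cl N).
Local Notation tau := (tau q p A B Cl N).

Definition kcons (T : Type) (k0 : T) (k : 'I_r -> T) (i : 'I_r.+1) : T :=
  if unlift ord0 i is Some j then k j else k0.

Lemma kcons0 (T : Type) (k0 : T) k : kcons k0 k ord0 = k0.
Proof. by rewrite /kcons unlift_none. Qed.

Lemma kconsS (T : Type) (k0 : T) k i : kcons k0 k (lift ord0 i) = k i.
Proof. by rewrite /kcons liftK. Qed.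

Definition boxk L (t : {ffun 'I_r -> 'I_(L + L).+1}) (i : 'I_r) : int := (t i)%:Z - L%:Z.

Lemma ksum_boxk_le L t : (`|ksum (@boxk L t)| <= r * L)%N.
Proof.
rewrite /ksum.
have -> : (r * L = \sum_(i < r) L)%N by rewrite sum_nat_const card_ord.
elim/big_rec2: _ => [|i n k _ IH]; first by rewrite absz0.
have := ltn_ord (t i); rewrite /boxk; lia.
Qed.

Definition term_mx (x : 'I_r.+1 -> C) (k : 'I_r.+1 -> int) : 'M[C]_r.+1 :=
  \matrix_(i, j) ((x i * q ^ k i) ^+ j * tau (k i) (x i)).

(* The zeroth coordinate needs a wider range, to accommodate minus the sum of the others. *)
Definition rowlen L (i : 'I_r.+1) : nat := if i == ord0 then (r.+1 * L)%N else L.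

Definition trunc_det L (x : 'I_r.+1 -> C) (v : C) : C :=
  \det (\matrix_(i < r.+1, j < r.+1) bsum (fun k => sterm v j k (x i)) (rowlen L i)).

Definition box_sum (x : 'I_r.+1 -> C) L : C :=
  \sum_(t : {ffun 'I_r -> 'I_(L + L).+1})
     \det (term_mx x (kcons (- ksum (boxk t)) (boxk t))).

(** Multilinearity in the rows: one index is chosen per row, and the powers of v combine to v^|k|.
    The result is a Laurent polynomial in v. *)
Lemma trunc_det_expand L x v : v != 0 ->
  trunc_det L x v = \sum_(t : {ffun 'I_r -> 'I_(L + L).+1})
    \sum_(u < (r.+1 * L + r.+1 * L).+1)
      \det (term_mx x (kcons (u%:Z - (r.+1 * L)%:Z) (boxk t))) *
      v ^ (u%:Z - (r.+1 * L)%:Z + ksum (boxk t)).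
Proof.
move=> v0; rewrite /trunc_det /determinant.
transitivity (\sum_(g : {perm 'I_r.+1}) (-1) ^+ g *
  \sum_(t : {ffun 'I_r -> 'I_(L + L).+1}) \sum_(u < (r.+1 * L + r.+1 * L).+1)
     \prod_i sterm v (g i) (kcons (u%:Z - (r.+1 * L)%:Z) (boxk t) i) (x i)).
  apply: eq_bigr => g _; congr (_ * _); rewrite big_ord_recl !mxE.
  have -> : \prod_(i < r) (\matrix_(i0, j) bsum (fun k : int => sterm v (val j) k (x i0))
       (rowlen L i0)) (lift ord0 i) (g (lift ord0 i)) =
    \prod_(i < r) \sum_(t < (L + L).+1) sterm v (g (lift ord0 i)) (t%:Z - L%:Z) (x (lift ord0 i)).
    by apply: eq_bigr => i _; rewrite mxE.
  rewrite bigA_distr_bigA /= mulr_sumr; apply: eq_bigr => t _.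
  rewrite /bsum /= mulr_suml; apply: eq_bigr => u _; rewrite big_ord_recl kcons0.
  by congr (_ * _); apply: eq_bigr => i _; rewrite kconsS.
under eq_bigr => g _ do rewrite mulr_sumr.
rewrite exchange_big; apply: eq_bigr => t _ /=.
under eq_bigr => g _ do rewrite mulr_sumr.
rewrite exchange_big; apply: eq_bigr => u _ /=.
rewrite mulr_suml; apply: eq_bigr => g _; rewrite -mulrA; congr (_ * _).
set k := kcons _ _.
have -> : u%:Z - (r.+1 * L)%:Z + ksum (boxk t) = \sum_i k i.
  by rewrite /k big_ord_recl kcons0; congr (_ + _); apply: eq_bigr => i _; rewrite kconsS.
have -> : v ^ (\sum_i k i) = \prod_i v ^ k i.
  elim/big_rec2: _ => [|i y z _ <-]; first by rewrite expr0z.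
  by rewrite expfzDr.
by rewrite -big_split; apply: eq_bigr => i _; rewrite mxE /bilateral_term [RHS]mulrC [RHS]mulrA.
Qed.

(** An exact identity at finite L: row 0 reaches up to (r + 1) L, so every box tuple has its
    completion to |k| = 0, and M exceeds every exponent of v in absolute value, so no other term
    survives. *)
Lemma avg_trunc_det L x v0 M : v0 != 0 -> (r.+1 * L + r.+1 * L < M)%N ->
  avg v0 M (trunc_det L x) 0 = box_sum x L.
Proof.
move=> v0n HM; have M0 : (0 < M)%N by apply: leq_ltn_trans HM.
rewrite (eq_avg _ v0n M0 (fun v (vv : md v = md v0) =>
  @trunc_det_expand L x v (_ : v != 0))); last first.
  by move=> v vv; rewrite -md_gt0 vv md_gt0.
rewrite avg_sum; apply: eq_bigr => t _; rewrite avg_sum.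
have Kt : (`|ksum (boxk t)| <= r.+1 * L)%N.
  by apply: leq_trans (ksum_boxk_le t) _; rewrite leq_mul2r leqnSn orbT.
(* The position of k_0 = -|k| in the range of row 0. *)
have ub : (absz ((r.+1 * L)%:Z - ksum (boxk t)) < (r.+1 * L + r.+1 * L).+1)%N.
  by move: Kt; lia.
rewrite (bigD1 (Ordinal ub)) //= big1 ?addr0 => [|u uu].
  rewrite avgZ avg_monomial //; last by move: Kt ub; lia.
  have -> : (`|(r.+1 * L)%:Z - ksum (boxk t)|%N)%:Z - (r.+1 * L)%:Z = - ksum (boxk t).
    by move: Kt; lia.
  by rewrite addNr eqxx mulr1.
rewrite avgZ avg_monomial //; last by move: (ltn_ord u) Kt; lia.
case: eqP => [h|_]; last by rewrite mulr0.
case/negP: uu; apply/eqP/val_inj => /=; lia.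
Qed.

End ConstantTerm.

Section Limits.
Variable R : realType.
Local Notation C := (Cx R).
Variables (q p : C) (r s : nat) (A B : 'I_r.+1 -> C) (Cl : 'I_s -> C) (N : 'I_s -> nat).
Hypotheses (q0 : q != 0) (q1 : md q < 1) (p2 : p ^+ 2 = q).
Hypotheses (A0 : forall i, A i != 0) (B0 : forall i, B i != 0).
Local Notation tq := (md q).
Local Notation W := (conv_ratio q A B N).
Local Notation psi := (psi q p A B Cl N).
Local Notation trunc_det := (trunc_det q p A B Cl N).
Local Notation box_sum := (box_sum q p A B Cl N).

Lemma common_ann n (x : 'I_n -> C) : (forall i, x i != 0) ->
  exists2 rho, 1 <= rho & forall i, annulus rho (x i).
Proof.
move=> x0; have H i : exists rho, 1 <= rho /\ annulus rho (x i).
  by have [rho r1 xr] := ann_exists (x0 i); exists rho.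
have [f Hf] := choice H; exists (1 + \sum_i f i).
  by rewrite lerDl sumr_ge0 // => i _; apply: le_trans (Hf i).1.
move=> i; apply: ann_le (Hf i).2; first by case: (Hf i).
rewrite (bigD1 i) //= addrCA lerDl addr_ge0 // sumr_ge0 // => j _.
by apply: le_trans (Hf j).1.
Qed.

(** Uniformity over |v| = rv allows the limit in L to be exchanged with the average over v. *)
Lemma trunc_det_unif (rv : R) x e : W < rv -> rv < 1 -> (forall i, x i != 0) -> 0 < e ->
  exists L0, forall L v, (L0 <= L)%N -> md v = rv ->
    md (trunc_det L x v - \det (section_mx (fun j => psi v (val j)) x)) <= e.
Proof.
move=> Wv v1 x0 e0; have [rho r1 xr] := common_ann x0.
have [K [t [K0 t0 t1 HK]]] := sterm_geo Cl q0 q1 p2 A0 B0 r1 Wv v1.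
pose E := 2 * K * t / (1 - t).
have E0 : 0 <= E by rewrite /E divr_ge0 ?mulr_ge0 // subr_ge0 ltW.
have M1 : 1 <= K + 2 * E + 1 by lra.
have [Q Q0 HQ] := det_close r.+1 M1.
have [L0 HL] := geo_small (Q * E) t0 t1 e0; exists L0 => L v LL vr.
have Hs i (j : 'I_r.+1) k : md (bilateral_term q p A B Cl N v j k (x i)) <= K * t ^+ `|k|.
  by apply: HK => //; rewrite -ltnS ltn_ord.
have Hb i j := bilim_approx t0 t1 (Hs i j).
have Hp i (j : 'I_r.+1) : md (psi v j (x i)) <= K + E.
  rewrite -[psi v j (x i)](subrK (bsum (fun k => bilateral_term q p A B Cl N v j k (x i)) 0)).
  apply: le_trans (ler_mdD _ _) _; rewrite addrC lerD //.
    by rewrite bsum0; apply: le_trans (Hs i j 0) _; rewrite absz0 expr0 mulr1.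
  by rewrite mdB; apply: le_trans (Hb i j 0%N) _; rewrite expr0 mulr1.
have tn n : t ^+ n <= 1 by rewrite exprn_ile1 // ltW.
apply: le_trans (HL L LL); rewrite -mulrA; apply: HQ.
- move=> i j; rewrite mxE; set f := fun k => _.
  rewrite -[bsum f _](subrK (psi v j (x i))); apply: le_trans (ler_mdD _ _) _.
  have h1 := Hp i j; have h2 := Hb i j (rowlen L i).
  have h3 : E * t ^+ rowlen L i <= E by rewrite -[leRHS]mulr1 ler_wpM2l.
  by move: h2; rewrite -/E -/f -/(psi v j (x i)); lra.
- by move=> i j; rewrite mxE; have := Hp i j; lra.
- move=> i j; rewrite !mxE; apply: le_trans (Hb i j (rowlen L i)) _; rewrite -/E.
  apply: ler_wpM2l => //; rewrite ler_wiXn2l // ?(ltW t1) // /rowlen.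
  by case: ifP => // _; rewrite mulSn leq_addr.
- by rewrite mulr_ge0 ?exprn_ge0.
Qed.

(** Two candidates a < b are taken between max(W, |q|) and 1. If both a c and b c were powers of
    |q|, so would be a/b, which lies strictly between |q| and 1. *)
Lemma radius_exists (c : R) : 0 < c -> W < 1 ->
  exists rv, [/\ W < rv, rv < 1 & forall k : int, rv * c != tq ^ k].
Proof.
move=> c0 W1; have tq0 : 0 < tq by rewrite md_gt0.
pose m := Num.max W tq; have m1 : m < 1 by rewrite gt_max W1.
have Wm : W <= m by rewrite le_max lexx.
have qm : tq <= m by rewrite le_max lexx orbT.
pose a := m + (1 - m) / 3; pose b := m + (1 - m) * 2 / 3.
have a0 : m < a by rewrite /a; lra.
have ab : a < b by rewrite /a /b; lra.
have b1 : b < 1 by rewrite /b; lra.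
have [Ha|Ha] := pselect (forall k : int, a * c != tq ^ k).
  by exists a; split => //; lra.
exists b; split => //; first by lra.
move=> k; apply/eqP => bk; apply: Ha => j; apply/eqP => aj.
have e : a = b * tq ^ (j - k).
  rewrite (expfzDr _ _ (lt0r_neq0 tq0)) -invr_expz -aj -bk.
  by field; apply/andP; split; lra.
case: (j - k) e => n e.
  case: n e => [|n] e; first by move: e; rewrite expr0z; lra.
  have h : tq ^+ n.+1 <= tq by rewrite exprS -[leRHS]mulr1 ler_wpM2l ?exprn_ile1 ?ltW.
  have : b * tq ^+ n.+1 <= 1 * tq by rewrite ler_pM ?exprn_ge0 //; lra.
  by rewrite [_ ^+ _]exprnP -e; lra.
have h : 1 <= tq ^ (Negz n).
  by rewrite NegzE -exprnN invf_ge1 ?exprn_gt0 // exprn_ile1 // ltW.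
have : b * 1 <= b * tq ^ (Negz n) by rewrite ler_wpM2l //; lra.
by rewrite -e; lra.
Qed.

(** Box sums are constant terms of truncated determinants, which are uniformly Cauchy on a circle;
    averaging on it does not enlarge their differences. *)
Lemma box_sum_cvg x : W < 1 -> (forall i, x i != 0) -> exists l, tends (box_sum x) l.
Proof.
move=> W1 x0; have [rv [Wv v1 _]] := radius_exists ltr01 W1.
have rv0 : 0 < rv by apply: le_lt_trans Wv; exact: conv_ratio_ge0.
have mv : md (rv%:C%C : C) = rv by rewrite md_realC ger0_norm // ltW.
have v0 : (rv%:C%C : C) != 0 by rewrite -md_gt0 mv.
apply: cauchy_tends => e e0; have e2 : 0 < e / 2 by rewrite divr_gt0.
have [L0 HL] := trunc_det_unif Wv v1 x0 e2; exists L0 => L L' hL hL'.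
(* A common number of nodes, large enough for the exact extraction at both truncation levels. *)
pose M := (r.+1 * L + r.+1 * L + (r.+1 * L' + r.+1 * L')).+1.
rewrite -(@avg_trunc_det _ q p r s A B Cl N L x _ M v0); last by rewrite /M; lia.
rewrite -(@avg_trunc_det _ q p r s A B Cl N L' x _ M v0); last by rewrite /M; lia.
rewrite -mulN1r -avgZ -avgD -[e]mulr1 -(expr0z (md (rv%:C%C : C))) -oppr0.
apply: avg_le => // v; rewrite mv => vr; rewrite mulN1r.
apply: le_trans (ler_dist_md _ (\det (section_mx (fun j => psi v (val j)) x)) _) _.
by rewrite [leRHS]splitr lerD ?HL // mdB HL.
Qed.

(** By [psi_det_Theta] the cross difference of the full determinants vanishes on the whole circle,
    so that of the truncated ones is uniformly small there, and so is its constant term. *)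
Lemma box_sum_Theta x y l l' : W < 1 -> (forall i, x i != 0) -> (forall i, y i != 0) ->
  \prod_i x i = \prod_i y i -> Theta q y != 0 ->
  tends (box_sum x) l -> tends (box_sum y) l' -> l * Theta q y = l' * Theta q x.
Proof.
move=> W1 x0 y0 xy Ty xl yl.
pose c := md (\prod_i A i * \prod_i y i).
have c0 : 0 < c by rewrite md_gt0 mulf_neq0 //; apply/prodf_neq0.
have [rv [Wv v1 Hrv]] := radius_exists c0 W1.
have rv0 : 0 < rv by apply: le_lt_trans Wv; exact: conv_ratio_ge0.
have mv : md (rv%:C%C : C) = rv by rewrite md_realC ger0_norm // ltW.
have v0 : (rv%:C%C : C) != 0 by rewrite -md_gt0 mv.
have H : tends (fun L => Theta q y * box_sum x L + - Theta q x * box_sum y L)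
   (Theta q y * l + - Theta q x * l').
  by apply: tendsD; apply: tendsZ.
suff H0 : tends (fun L => Theta q y * box_sum x L + - Theta q x * box_sum y L) 0.
  have := tends_unique H H0; rewrite mulNr => /eqP; rewrite subr_eq0 => /eqP e.
  by rewrite mulrC e mulrC.
move=> e e0; pose a := md (Theta q y) + md (Theta q x) + 1.
have a0 : 0 < a by rewrite /a ltr_wpDl // addr_ge0 ?md_ge0.
have ea : 0 < e / a by rewrite divr_gt0.
have [L0 HL] := trunc_det_unif Wv v1 x0 ea; have [L1 HL'] := trunc_det_unif Wv v1 y0 ea.
exists (maxn L0 L1) => L; rewrite geq_max subr0 => /andP[h0 h1].
pose M := (r.+1 * L + r.+1 * L).+1.
rewrite -!(@avg_trunc_det _ q p r s A B Cl N L _ _ M v0) //.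
rewrite -!avgZ -avgD -[e]mulr1 -(expr0z (md (rv%:C%C : C))) -oppr0.
apply: avg_le => // v; rewrite mv => vr.
have := @psi_det_Theta _ q p r s A B Cl N q0 q1 p2 A0 B0 v x y.
rewrite vr => /(_ Wv v1 x0 y0 xy Ty) D.
have {}D := D (fun k => _); rewrite -mulrA mdM vr in D.
have {}D := D Hrv.
have regroup (X Y X' Y' ty tx : C) : X' * ty = Y' * tx ->
    ty * X + - tx * Y = ty * (X - X') - tx * (Y - Y').
  move=> e'; have -> : ty * (X - X') - tx * (Y - Y') =
    ty * X + - tx * Y - (X' * ty - Y' * tx) by ring.
  by rewrite e' subrr subr0.
rewrite (regroup _ _ _ _ _ _ D); apply: le_trans (ler_mdB _ _) _.
have hx := HL L v h0 vr; have hy := HL' L v h1 vr.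
have mdM_le (t u : C) d : md u <= d -> md (t * u) <= md t * d.
  by move=> ud; rewrite mdM ler_wpM2l ?md_ge0.
apply: le_trans (lerD (mdM_le _ _ _ hx) (mdM_le _ _ _ hy)) _.
have aE : md (Theta q y) + md (Theta q x) <= a by rewrite /a lerDl.
rewrite -mulrDl; move: aE; set b := _ + _ => ba.
by rewrite mulrCA -[X in _ <= X]mulr1; apply: ler_wpM2l; [exact: ltW|rewrite ler_pdivrMr // mul1r].
Qed.

End Limits.

(** * The series as a lattice sum *)

Section QShiftedFactorials.
Variable R : realType.
Local Notation C := (Cx R).
Variable q : C.
Hypothesis q0 : q != 0.

(** The common form of the denominator conditions: it follows from [den_ok] for u and, at q/u, from
    [num_ok] for u, over all indices. *)
Definition nonvanishing (u : C) := forall j : nat, 1 - u * q ^+ j != 0.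

Lemma qpoch_nat x n : qpoch q x n%:Z = qpoch_n q x n.
Proof. by rewrite /qpoch /= divr1. Qed.

Lemma prod_neg_powers x m :
  \prod_(j < m) (1 - x * q ^- j.+1) = qpoch_n q (x * q ^ (- m%:Z)) m.
Proof.
rewrite (reindex_inj rev_ord_inj); apply: eq_bigr => j _ /=.
rewrite -mulrA; congr (1 - x * _); rewrite exprnN [q ^+ val j]exprnP -expfzDr //; congr (q ^ _).
by case: j => j jm /=; lia.
Qed.

Lemma qpoch_opp x m : qpoch q x (- m%:Z) = (qpoch_n q (x * q ^ (- m%:Z)) m)^-1.
Proof.
case: m => [|m]; first by rewrite oppr0 qpoch_nat !qpoch_n0 invr1.
by rewrite -prod_neg_powers /qpoch -NegzE /= div1r.
Qed.

Lemma qpoch_n_neq0 u n : nonvanishing u -> qpoch_n q u n != 0.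
Proof. by move=> un; apply/prodf_neq0 => j _. Qed.

Lemma nonvanishing_den u : (forall k, den_ok q u k) -> nonvanishing u.
Proof.
move=> H j; have := H j.+1%:Z; rewrite /den_ok /= qpoch_nS mulf_eq0 negb_or.
by case/andP.
Qed.

Lemma nonvanishing_num u : u != 0 -> (forall k, num_ok q u k) -> nonvanishing (q / u).
Proof.
move=> u0 H j; have := H (Negz j); rewrite /num_ok /= big_ord_recr /= mulf_eq0 negb_or.
case/andP => _; apply: contra; rewrite !subr_eq0 => /eqP e.
have qj : q ^+ j.+1 != 0 by rewrite expf_neq0.
apply/eqP; apply: (mulIf qj); rewrite mul1r divfK //.
by apply: (mulIf (invr_neq0 u0)); rewrite divff // exprS [RHS]e; ring.
Qed.

Lemma qpoch_n_back_neq0 u m : u != 0 -> nonvanishing (q / u) ->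
  qpoch_n q (u * q ^ (- m%:Z)) m != 0.
Proof.
move=> u0 un; rewrite -prod_neg_powers; apply/prodf_neq0 => j _.
have := un j; apply: contra; rewrite !subr_eq0 => /eqP e.
have qj : q ^+ j.+1 != 0 by rewrite expf_neq0.
have -> : u = q ^+ j.+1 by rewrite -[RHS]mul1r e divfK.
by rewrite exprS; apply/eqP; field; rewrite q0 expf_neq0.
Qed.

Lemma qpoch_n_reflect u n : u != 0 -> qpoch_n q (u * q ^ (- n%:Z)) n =
  (- u) ^+ n * (\prod_(j < n) q ^- j.+1) * qpoch_n q (q / u) n.
Proof.
move=> u0; rewrite -prod_neg_powers -[X in _ ^+ X](card_ord n) -prodr_const -!big_split.
apply: eq_bigr => j _ /=; rewrite exprS.
by field; rewrite u0 q0 expf_neq0.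
Qed.

(** Reflection of a single symbol produces a power of q quadratic in k and a sign. Both cancel in a
    quotient, and only (v/u)^k is left. *)
Lemma qpoch_ratio_opp u v (k : int) : u != 0 -> v != 0 ->
  qpoch q u (- k) / qpoch q v (- k) =
  (v / u) ^ k * (qpoch q (q / v) k / qpoch q (q / u) k).
Proof.
move=> u0 v0; have G0 n : \prod_(j < n) q ^- j.+1 != 0.
  by apply/prodf_neq0 => j _; rewrite invr_eq0 expf_neq0.
have key x y n : x != 0 -> y != 0 ->
    (qpoch_n q (x * q ^ (- n%:Z)) n)^-1 / (qpoch_n q (y * q ^ (- n%:Z)) n)^-1 =
    (y / x) ^+ n * (qpoch_n q (q / y) n / qpoch_n q (q / x) n).
  move=> x0 y0; rewrite !qpoch_n_reflect // invrK !invfM expr_div_n.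
  rewrite -(mulN1r y) -(mulN1r x) !exprMn invfM.
  have s0 : (-1) ^+ n != 0 :> C by rewrite signr_eq0.
  have xn : x ^+ n != 0 by rewrite expf_neq0.
  have := G0 n; set G := \prod_(j < n) _ => Gn.
  rewrite -[qpoch_n q (q / y) n]invrK; set a := (qpoch_n q (q / x) n)^-1.
  set b := qpoch_n q _ _; rewrite invrK; by field; rewrite s0 xn Gn.
case: k => n; first by rewrite !qpoch_opp !qpoch_nat key // -exprnP.
rewrite NegzE opprK !qpoch_nat !qpoch_opp.
have key2 x : x != 0 -> q / (q / x) = x by move=> x0; field; rewrite x0 q0.
rewrite key ?mulf_neq0 ?invr_eq0 // !key2 // mulrA.
have -> : q / u / (q / v) = v / u by field; rewrite u0 q0 v0.
by rewrite -exprnN mulVf ?mul1r // expf_neq0 // mulf_neq0 // invr_eq0.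
Qed.

(** For k >= 0 this splits the N + k factors from u on in two ways. For negative k the product
    starting at u q^k is split instead, and the last hypothesis permits the division. *)
Lemma qpoch_shift_ratio u N (k : int) : u != 0 -> nonvanishing u -> nonvanishing (q / (u * q ^+ N)) ->
  qpoch_n q (u * q ^ k) N = qpoch_n q u N * (qpoch q (u * q ^+ N) k / qpoch q u k).
Proof.
move=> u0 un uN; case: k => m.
  rewrite !qpoch_nat; have h := qpoch_n_neq0 m un.
  apply: (mulfI h); rewrite -exprnP -qpoch_nD addnC qpoch_nD.
  by field.
rewrite NegzE !qpoch_opp invrK; set w := q ^ _.
have uq0 : u * q ^+ N != 0 by rewrite mulf_neq0 ?expf_neq0.
have h := qpoch_n_back_neq0 m.+1 uq0 uN; rewrite -/w in h *.
have e : u * q ^+ N * w = u * w * q ^+ N by rewrite mulrAC.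
apply: (mulIf h); rewrite {1}e -qpoch_nD addnC qpoch_nD.
have -> : u * w * q ^+ m.+1 = u by rewrite -mulrA /w -exprnN mulVf ?mulr1 // expf_neq0.
by field.
Qed.

End QShiftedFactorials.

Section InfiniteFactors.
Variable R : realType.
Local Notation C := (Cx R).
Variables (q p : C).
Hypotheses (q0 : q != 0) (q1 : md q < 1) (p2 : p ^+ 2 = q).

Lemma qpinf_neq0 u : nonvanishing q u -> qpinf q u != 0.
Proof.
move=> un; apply/eqP => /(qpinf_eq0 q1)[j uj].
by have := un j; rewrite uj subrr eqxx.
Qed.

Lemma afac_qpoch a x (k : int) : a != 0 -> x != 0 -> nonvanishing q (q / (a * x)) ->
  afac q p a x k = qpinf q (q / (a * x)) * qpoch q (a * x) k.
Proof.
move=> a0 x0 H; case: k => m; first by rewrite qpoch_nat afac_nat.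
have ax0 : a * x != 0 by rewrite mulf_neq0.
rewrite NegzE (qpoch_opp q0) -(afac_negz q0 q1 p2 m.+1 a0 x0) (prod_neg_powers q0) mulfK //.
exact: (qpoch_n_back_neq0 q0).
Qed.

Lemma qpinf_qpoch u (k : int) : nonvanishing q u -> qpinf q (u * q ^ k) = qpinf q u / qpoch q u k.
Proof.
move=> H; case: k => m.
  by rewrite qpoch_nat (qpinf_split q1 u m) -exprnP [RHS]mulrC mulKf // qpoch_n_neq0.
rewrite NegzE (qpoch_opp q0) invrK -(prod_neg_powers q0).
by rewrite -[u]mul1r [LHS](bfac_negz q0 q1).
Qed.

End InfiniteFactors.

(** * Lattice terms and the summand of the series *)

Section LatticeTerm.
Variable R : realType.
Local Notation C := (Cx R).
Variables (q p : C) (r s : nat).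
Hypotheses (q0 : q != 0) (q1 : md q < 1) (p2 : p ^+ 2 = q).

Definition vdm n (x : 'I_n -> C) : C := \prod_(i < n) \prod_(j < n | (i < j)%N) (x j - x i).

Definition lattice_weight (A B : 'I_r.+1 -> C) (Cl : 'I_s -> C) (N : 'I_s -> nat) (k : int) (X : C) : C :=
  (\prod_(j < r.+1) (qpoch q (A j * X) k / qpoch q (B j * X) k)) *
  \prod_(l < s) (qpoch q (Cl l * X * q ^+ N l) k / qpoch q (Cl l * X) k).

Definition lattice_term A B Cl N (x : 'I_r.+1 -> C) (k : 'I_r.+1 -> int) : C :=
  vdm (fun i => x i * q ^ k i) / vdm x * \prod_i lattice_weight A B Cl N (k i) (x i).

(** The factor independent of k that separates [tau] from the Pochhammer quotient; its values at y
    and x supply the part of the prefactor not due to theta. *)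
Definition amplitude (A B : 'I_r.+1 -> C) (Cl : 'I_s -> C) (N : 'I_s -> nat) (X : C) : C :=
  km_poly q Cl N X * \prod_j (qpinf q (B j * X) * qpinf q (q / (A j * X))).

Definition regular (A B : 'I_r.+1 -> C) (Cl : 'I_s -> C) (N : 'I_s -> nat) (X : C) : Prop :=
  (forall j, nonvanishing q (B j * X) /\ nonvanishing q (q / (A j * X))) /\
  (forall l, nonvanishing q (Cl l * X) /\ nonvanishing q (q / (Cl l * X * q ^+ N l))).

Section Fixed.
Variables (A B : 'I_r.+1 -> C) (Cl : 'I_s -> C) (N : 'I_s -> nat).
Hypotheses (A0 : forall i, A i != 0) (Cl0 : forall l, Cl l != 0).

Lemma amplitude_neq0 X : regular A B Cl N X -> amplitude A B Cl N X != 0.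
Proof.
move=> [H1 H2]; rewrite mulf_neq0 //; apply/prodf_neq0 => i _.
  by apply: qpoch_n_neq0; case: (H2 i).
by case: (H1 i) => h1 h2; rewrite mulf_neq0 // qpinf_neq0.
Qed.

Lemma tau_amplitude k X : X != 0 -> regular A B Cl N X ->
  tau q p A B Cl N k X = amplitude A B Cl N X * lattice_weight A B Cl N k X.
Proof.
move=> X0 [H1 H2]; rewrite /tau /amplitude /lattice_weight.
have -> : km_poly q Cl N (X * q ^ k) = km_poly q Cl N X *
    \prod_(l < s) (qpoch q (Cl l * X * q ^+ N l) k / qpoch q (Cl l * X) k).
  rewrite -big_split; apply: eq_bigr => l _; rewrite mulrA.
  by case: (H2 l) => h1 h2; apply: qpoch_shift_ratio => //; rewrite mulf_neq0.
have -> : \prod_(i < r.+1) (qpinf q (B i * X * q ^ k) * afac q p (A i) X k) =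
    (\prod_j (qpinf q (B j * X) * qpinf q (q / (A j * X)))) *
    \prod_(j < r.+1) (qpoch q (A j * X) k / qpoch q (B j * X) k).
  rewrite -big_split; apply: eq_bigr => j _; case: (H1 j) => h1 h2.
  by rewrite qpinf_qpoch // afac_qpoch //=; ring.
by ring.
Qed.

Lemma det_term_mx x k : \det (term_mx q p A B Cl N x k) =
  (\prod_i tau q p A B Cl N (k i) (x i)) * vdm (fun i => x i * q ^ k i).
Proof.
have -> : term_mx q p A B Cl N x k =
    diag_mx (\row_i tau q p A B Cl N (k i) (x i)) *m
    (Vandermonde r.+1 (\row_i (x i * q ^ k i)))^T.
  by apply/matrixP => i j; rewrite mul_diag_mx !mxE mulrC.
rewrite det_mulmx det_diag det_tr det_Vandermonde; congr (_ * _).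
  by apply: eq_bigr => i _; rewrite mxE.
by apply: eq_bigr => i _; apply: eq_bigr => j _; rewrite !mxE.
Qed.

Lemma det_term_mx_lattice x k : (forall i, x i != 0) -> vdm x != 0 ->
  (forall i, regular A B Cl N (x i)) ->
  \det (term_mx q p A B Cl N x k) =
  vdm x * (\prod_i amplitude A B Cl N (x i)) * lattice_term A B Cl N x k.
Proof.
move=> x0 V0 H; rewrite det_term_mx.
rewrite (eq_bigr (fun i => amplitude A B Cl N (x i) * lattice_weight A B Cl N (k i) (x i))) => [|i _].
  by rewrite big_split /lattice_term /=; field.
exact: tau_amplitude.
Qed.

End Fixed.

Lemma prod_expz n (u : C) (k : 'I_n -> int) : u != 0 -> \prod_i u ^ k i = u ^ (\sum_i k i).
Proof.
move=> u0; apply/esym; elim/big_rec2: _ => [|i y z _ <-]; first by rewrite expr0z.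
by rewrite expfzDr.
Qed.

Lemma expz_prod I (t : seq I) (u : I -> C) (k : int) :
  (\prod_(i <- t) u i) ^ k = \prod_(i <- t) u i ^ k.
Proof.
elim: t => [|i t IH]; first by rewrite !big_nil exp1rz.
by rewrite !big_cons expfzMl IH.
Qed.

(** The pairs containing index 0, where x_0 = 1/a and k_0 = -|k|, produce the factors 1 - a z_i
    q^(k_i + |k|). Reflecting the weight at x_0 produces all symbols of index |k|. The monomials
    left over by these two steps make up w^|k|, which accounts for the argument of the series. *)
Lemma psi_term_lattice (a c d w : C) (b e z : 'I_r -> C) (h : 'I_s -> C) (N : 'I_s -> nat)
    (k : 'I_r -> int) :
  a != 0 -> c != 0 -> d != 0 -> (forall i, b i != 0) -> (forall i, e i != 0) ->
  (forall i, z i != 0) -> (forall l, h l != 0) -> (forall i, 1 - a * z i != 0) ->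
  w = a ^+ r.+1 * q ^ (1 - (\sum_(l < s) N l)%N%:Z) / (\prod_i b i * c * d * \prod_i e i) ->
  psi_term q a b c d e z (fun l => a * q ^+ (N l).+1 / h l) h w k =
  lattice_term (kcons c (fun j => b j / z j)) (kcons (a * q / d) (fun j => a * q / (e j * z j)))
    (fun l => a * q / h l) N (kcons a^-1 z) (kcons (- ksum k) k).
Proof.
move=> a0 c0 d0 b0 e0 z0 h0 az0 wE; rewrite /psi_term; set K := ksum k.
(* The product of the ratios v/u released by [qpoch_ratio_opp] at x_0. *)
pose Wf := (a * q / (c * d)) * (\prod_(j < r) (a * q / (e j * b j))) * \prod_(l < s) q ^ (- (N l)%:Z).
have E1 : vdm (fun i => kcons a^-1 z i * q ^ kcons (- K) k i) / vdm (kcons a^-1 z) =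
    q ^ (- K * r%:Z) * (\prod_(i < r) ((1 - a * z i * q ^ (k i + K)) / (1 - a * z i))) *
    \prod_(i < r) \prod_(j < r | (i < j)%N) ((z i * q ^ (k i) - z j * q ^ (k j)) / (z i - z j)).
  have divE n (u v : 'I_n -> C) : vdm u / vdm v =
      \prod_(i < n) \prod_(j < n | (i < j)%N) ((u j - u i) / (v j - v i)).
    rewrite /vdm -prodf_div; apply: eq_bigr => i _; by rewrite prodf_div.
  rewrite divE prod_pairs_recl; congr (_ * _); last first.
    apply: eq_bigr => i _; apply: eq_bigr => j _; rewrite !kconsS.
    by rewrite -[X in X / _]opprB -[X in _ / X]opprB invrN mulrNN.
  rewrite -exprz_exp -exprnP -[X in _ ^+ X](card_ord r) -prodr_const -big_split.
  apply: eq_bigr => j _; rewrite !kconsS !kcons0 /= expfzDr // -invr_expz.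
  have qK : q ^ K != 0 by exact: expfz_neq0.
  have az : z j - a^-1 != 0.
    apply: contra (az0 j); rewrite !subr_eq0 => /eqP ->; by rewrite divff.
  field; by rewrite ?a0 ?qK ?az ?az0 //= mulrC -[X in _ - X](mulfV a0) -mulrBr mulf_neq0.
have ratioE u v u' v' t : u != 0 -> v != 0 -> q / v = u' -> q / u = v' -> v / u = t ->
    qpoch q u (- K) / qpoch q v (- K) = t ^ K * (qpoch q u' K / qpoch q v' K).
  by move=> u0 v0 <- <- <-; exact: qpoch_ratio_opp.
have E2 : lattice_weight (kcons c (fun j => b j / z j)) (kcons (a * q / d) (fun j => a * q / (e j * z j)))
    (fun l => a * q / h l) N (- K) a^-1 =
    Wf ^ K * (qpoch q d K / qpoch q (a * q / c) K) *
    (\prod_(j < r) (qpoch q (e j * z j) K / qpoch q (a * z j * q / b j) K)) *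
    \prod_(l < s) (qpoch q (h l) K / qpoch q (a * q / (a * q ^+ (N l).+1 / h l)) K).
  rewrite /lattice_weight big_ord_recl !kcons0 /Wf (expfzMl (_ * \prod_(j < r) _)).
  rewrite (expfzMl _ (\prod_(j < r) _)) !expz_prod.
  rewrite (ratioE _ _ d (a * q / c) (a * q / (c * d))).
  - rewrite (eq_bigr (fun j => (a * q / (e j * b j)) ^ K *
      (qpoch q (e j * z j) K / qpoch q (a * z j * q / b j) K))) => [|j _].
      rewrite (eq_bigr (fun l => (q ^ (- (N l)%:Z)) ^ K *
        (qpoch q (h l) K / qpoch q (a * q / (a * q ^+ (N l).+1 / h l)) K))) => [|l _].
        have split1 n (u v : 'I_n -> C) : \prod_j (u j * v j) = (\prod_j u j) * \prod_j v j.
          by rewrite big_split.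
        have reorder (x y b1 b2 l1 l2 : C) :
            x * y * (b1 * b2) * (l1 * l2) = x * b1 * l1 * y * b2 * l2 by ring.
        rewrite (split1 _ (fun j => (a * q / (e j * b j)) ^ K)).
        rewrite (split1 _ (fun l => (q ^ (- (N l)%:Z)) ^ K)).
        exact: reorder.
      apply: ratioE.
      + by rewrite !mulf_neq0 ?invr_eq0 // expf_neq0.
      + by rewrite !mulf_neq0 ?invr_eq0.
      + by field; rewrite a0 q0 h0.
      + by rewrite exprS; field; rewrite a0 q0 h0 expf_neq0.
      + by rewrite -exprnN; field; rewrite a0 q0 h0 expf_neq0.
    rewrite !kconsS; apply: ratioE.
    + by rewrite !mulf_neq0 ?invr_eq0.
    + by rewrite !mulf_neq0 ?invr_eq0 ?mulf_neq0.
    + by field; rewrite a0 q0 e0 z0.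
    + by field; rewrite a0 b0 z0.
    + by field; rewrite a0 b0 e0 z0.
  - by rewrite mulf_neq0 ?invr_eq0.
  - by rewrite !mulf_neq0 ?invr_eq0.
  - by field; rewrite a0 q0 d0.
  - by field; rewrite a0 c0.
  - by field; rewrite a0 c0 d0.
have E3 i : lattice_weight (kcons c (fun j => b j / z j)) (kcons (a * q / d) (fun j => a * q / (e j * z j)))
    (fun l => a * q / h l) N (k i) (z i) =
    qpoch q (c * z i) (k i) / qpoch q (a * z i * q / d) (k i) *
    (\prod_(j < r) (qpoch q (b j * z i / z j) (k i) / qpoch q (a * z i * q / (e j * z j)) (k i))) *
    \prod_(l < s) (qpoch q (a * q ^+ (N l).+1 / h l * z i) (k i) / qpoch q (a * z i * q / h l) (k i)).
  rewrite /lattice_weight big_ord_recl !kcons0; congr (_ / qpoch q _ _ * _ * _); first by ring.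
    apply: eq_bigr => j _; rewrite !kconsS; congr (qpoch q _ _ / qpoch q _ _); ring.
  by apply: eq_bigr => l _; congr (qpoch q _ _ / qpoch q _ _); rewrite ?exprS; ring.
have E4 : w ^ K = q ^ (- K * r%:Z) * Wf ^ K.
  have -> : q ^ (- K * r%:Z) = (q ^- r) ^ K by rewrite mulNr -mulrN mulrC -exprz_exp -exprnN.
  rewrite -expfzMl; congr (_ ^ K); rewrite wE /Wf.
  have -> : \prod_(l < s) q ^ (- (N l)%:Z) = q ^ (- (\sum_(l < s) N l)%N%:Z).
    by rewrite prod_expz // sumrN (big_morph Posz PoszD (erefl (0%N : int))).
  rewrite expfzDr // expr1z !prodf_div !big_split /= !prodr_const card_ord exprS.
  have e1 : \prod_i e i != 0 by apply/prodf_neq0.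
  have b1 : \prod_i b i != 0 by apply/prodf_neq0.
  by field; rewrite c0 d0 e1 b1 expf_neq0.
have E7 : \prod_(i < r) lattice_weight (kcons c (fun j => b j / z j))
      (kcons (a * q / d) (fun j => a * q / (e j * z j))) (fun l => a * q / h l) N
      (kcons (- K) k (lift ord0 i)) (kcons a^-1 z (lift ord0 i)) =
    (\prod_(i < r) (qpoch q (c * z i) (k i) / qpoch q (a * z i * q / d) (k i))) *
    (\prod_(i < r) \prod_(j < r)
      (qpoch q (b j * z i / z j) (k i) / qpoch q (a * z i * q / (e j * z j)) (k i))) *
    \prod_(i < r) \prod_(l < s)
     (qpoch q (a * q ^+ (N l).+1 / h l * z i) (k i) / qpoch q (a * z i * q / h l) (k i)).
  by rewrite -!big_split; apply: eq_bigr => i _; rewrite !kconsS E3.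
have fracE (u v : C) (f g : 'I_s -> C) :
    u * \prod_l f l / (v * \prod_l g l) = u / v * \prod_l (f l / g l).
  by rewrite prodf_div invfM; ring.
have E5 : \prod_(i < r) ((qpoch q (c * z i) (k i) *
      \prod_(l < s) qpoch q (a * q ^+ (N l).+1 / h l * z i) (k i)) /
     (qpoch q (a * z i * q / d) (k i) * \prod_(l < s) qpoch q (a * z i * q / h l) (k i))) =
   (\prod_(i < r) (qpoch q (c * z i) (k i) / qpoch q (a * z i * q / d) (k i))) *
   \prod_(i < r) \prod_(l < s)
     (qpoch q (a * q ^+ (N l).+1 / h l * z i) (k i) / qpoch q (a * z i * q / h l) (k i)).
  rewrite -big_split; apply: eq_bigr => i _; exact: fracE.
have E6 : qpoch q d K * \prod_(l < s) qpoch q (h l) K /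
     (qpoch q (a * q / c) K * \prod_(l < s) qpoch q (a * q / (a * q ^+ (N l).+1 / h l)) K) =
   qpoch q d K / qpoch q (a * q / c) K *
   \prod_(l < s) (qpoch q (h l) K / qpoch q (a * q / (a * q ^+ (N l).+1 / h l)) K).
  exact: fracE.
rewrite /lattice_term E1 big_ord_recl !kcons0 E2 E4 E7 E5 E6; ring.
Qed.

End LatticeTerm.

Section BoxSums.
Variables (R : realType) (r : nat).
Local Notation C := (Cx R).

Lemma box_rev (L : nat) (G : ('I_r -> int) -> C) :
  \sum_(t : {ffun 'I_r -> 'I_(L + L).+1}) G (fun i => - boxk t i) =
  \sum_(t : {ffun 'I_r -> 'I_(L + L).+1}) G (boxk t).
Proof.
pose rv (t : {ffun 'I_r -> 'I_(L + L).+1}) := [ffun i => rev_ord (t i)].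
have rvK : involutive rv by move=> t; apply/ffunP => i; rewrite !ffunE rev_ordK.
rewrite [RHS](reindex_inj (inv_inj rvK)); apply: eq_bigr => t _; congr G.
apply: funext => i; rewrite /boxk ffunE /=; by case: (t i) => u hu /=; lia.
Qed.

Lemma sum_kcons (k : 'I_r -> int) : \sum_i kcons (- ksum k) k i = 0.
Proof.
rewrite big_ord_recl kcons0 (eq_bigr k) => [|i _]; last by rewrite kconsS.
by rewrite addNr.
Qed.

Lemma kcons_opp (k : 'I_r -> int) :
  (fun i => - kcons (- ksum k) k i) = kcons (- ksum (fun i => - k i)) (fun i => - k i).
Proof.
apply: funext => i; rewrite /kcons; case: unliftP => // _.
by rewrite /ksum sumrN.
Qed.

End BoxSums.

(** * Reversing the index and inverting the variables *)

Section Inversion.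
Variable R : realType.
Local Notation C := (Cx R).
Variables (q : C) (r s : nat).
Hypotheses (q0 : q != 0).

(** Each of the n + 1 indices belongs to n pairs. *)
Lemma prod_pairs_mul n (u : 'I_n.+1 -> C) :
  \prod_(i < n.+1) \prod_(j < n.+1 | (i < j)%N) (u i * u j) = (\prod_i u i) ^+ n.
Proof.
elim: n u => [|n IH] u.
  by rewrite prod_pairs_recl !big_ord0 expr0 mulr1.
rewrite prod_pairs_recl (IH (fun i => u (lift ord0 i))) big_split /= prodr_const card_ord.
rewrite [in RHS]big_ord_recl exprMn; set P := \prod_(i < n.+1) u (lift ord0 i).
by rewrite [P ^+ n.+1]exprS mulrA.
Qed.

Lemma vdm_inv n (x : 'I_n.+1 -> C) : (forall i, x i != 0) ->
  vdm (fun i => (x i)^-1) =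
  (\prod_(i < n.+1) \prod_(j < n.+1 | (i < j)%N) (-1 : C)) / (\prod_i x i) ^+ n * vdm x.
Proof.
move=> x0; rewrite -prod_pairs_mul.
rewrite /vdm -prodf_div -big_split; apply: eq_bigr => i _.
rewrite -prodf_div -big_split; apply: eq_bigr => j _ /=.
by field; rewrite !x0.
Qed.

Lemma vdm_neq0 n (x : 'I_n -> C) : (forall i j, i != j -> x i != x j) -> vdm x != 0.
Proof.
move=> H; apply/prodf_neq0 => i _; apply/prodf_neq0 => j ij.
by rewrite subr_eq0 eq_sym H // -(inj_eq val_inj) neq_ltn ij.
Qed.

(** The condition |k| = 0 acts twice: it leaves the product of the coordinates fixed, so the
    monomials from the inverted Vandermonde quotient cancel, and it turns the product of the
    reflection factors Z^(k_i) into 1. *)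
Lemma lattice_term_inv (A B : 'I_r.+1 -> C) (Cl : 'I_s -> C) (N : 'I_s -> nat)
    (y : 'I_r.+1 -> C) (k : 'I_r.+1 -> int) :
  (forall i, A i != 0) -> (forall i, B i != 0) -> (forall l, Cl l != 0) ->
  (forall i, y i != 0) -> \sum_i k i = 0 ->
  lattice_term q (fun i => q / B i) (fun i => q / A i) (fun l => q / (Cl l * q ^+ N l)) N
    (fun i => (y i)^-1) k =
  lattice_term q A B Cl N y (fun i => - k i).
Proof.
move=> A0 B0 Cl0 y0 k0; rewrite /lattice_term; congr (_ * _).
  pose Y i := y i * q ^ (- k i).
  have Y0 i : Y i != 0 by rewrite mulf_neq0 // expfz_neq0.
  have -> : (fun i => (y i)^-1 * q ^ k i) = (fun i => (Y i)^-1).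
    by apply: funext => i; rewrite /Y -invr_expz invfM invrK.
  rewrite !vdm_inv //.
  have -> : \prod_i Y i = \prod_i y i.
    by rewrite /Y big_split /= prod_expz // sumrN k0 oppr0 expr0z mulr1.
  have : (\prod_(i < r.+1) \prod_(j < r.+1 | (i < j)%N) (-1 : C)) / (\prod_i y i) ^+ r != 0.
    rewrite mulf_neq0 ?invr_eq0 ?expf_neq0 //; last by apply/prodf_neq0.
    by apply/prodf_neq0 => i _; apply/prodf_neq0 => j _; rewrite oppr_eq0 oner_eq0.
  set c := _ / _ => c0; by rewrite -mulf_div divff // mul1r.
pose Z := (\prod_(j < r.+1) (B j / A j)) * \prod_(l < s) q ^ (- (N l)%:Z).
have Z0 : Z != 0.
  rewrite mulf_neq0 //; apply/prodf_neq0 => i _; last exact: expfz_neq0.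
  by rewrite mulf_neq0 ?invr_eq0.
have congr_ratio (k' : int) (t t' u u' v v' : C) : t = t' -> u = u' -> v = v' ->
    t ^ k' * (qpoch q u k' / qpoch q v k') = t' ^ k' * (qpoch q u' k' / qpoch q v' k').
  by move=> -> -> ->.
have omE i : lattice_weight q A B Cl N (- k i) (y i) = Z ^ k i *
    lattice_weight q (fun i => q / B i) (fun i => q / A i) (fun l => q / (Cl l * q ^+ N l)) N (k i) (y i)^-1.
  rewrite /lattice_weight /Z expfzMl !expz_prod mulrACA -!big_split; congr (_ * _); apply: eq_bigr => j _ /=.
    have Ay := mulf_neq0 (A0 j) (y0 i); have By := mulf_neq0 (B0 j) (y0 i).
    apply: etrans (qpoch_ratio_opp q0 (k i) Ay By) _; apply: congr_ratio.
    - by field; rewrite A0 y0.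
    - by rewrite invfM; ring.
    - by rewrite invfM; ring.
  have qN : q ^+ N j != 0 by rewrite expf_neq0.
  have Cy := mulf_neq0 (Cl0 j) (y0 i); have CNy := mulf_neq0 Cy qN.
  apply: etrans (qpoch_ratio_opp q0 (k i) CNy Cy) _; apply: congr_ratio.
  - by rewrite -exprnN; field; rewrite Cl0 y0 qN.
  - by field; rewrite Cl0 y0 qN.
  - by rewrite !invfM; ring.
rewrite [RHS](eq_bigr _ (fun i _ => omE i)) [RHS]big_split /= prod_expz // k0 expr0z mul1r.
by [].
Qed.

(** Conditions of index k_i give regularity at the z_i, those of index |k| give it at 1/a; and 1 - a
    z_i != 0 separates 1/a from the z_i. *)
Lemma regular_of_denoms (a c d : C) (b e z : 'I_r -> C) (h : 'I_s -> C) (N : 'I_s -> nat) :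
  (0 < r)%N -> a != 0 -> c != 0 -> d != 0 -> (forall i, b i != 0) -> (forall i, e i != 0) ->
  (forall i, z i != 0) -> (forall l, h l != 0) ->
  psi_denoms_ok q a b c d e z (fun l => a * q ^+ (N l).+1 / h l) h ->
  (forall i, regular q (kcons c (fun j => b j / z j))
    (kcons (a * q / d) (fun j => a * q / (e j * z j))) (fun l => a * q / h l) N
    (kcons a^-1 z i)) /\
  (forall i j, i != j -> kcons a^-1 z i != kcons a^-1 z j).
Proof.
move=> r0 a0 c0 d0 b0 e0 z0 h0 [H1 [H2 H3]]; split; last first.
  have az i : z i != a^-1.
    by apply: contra_neq (H1 i) => ->; rewrite divff // subrr.
  move=> i j; rewrite /kcons; case: unliftP => [i' ->|->]; case: unliftP => [j' ->|->] //.
  - by rewrite (inj_eq lift_inj) => /H2; rewrite subr_eq0.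
  - by move=> _; rewrite eq_sym.
(* Conditions on |k| are quantified over tuples. Placing K on one coordinate, which exists since r >
   0, makes them available for every integer. *)
have kex (K : int) : exists k : 'I_r -> int, ksum k = K.
  exists (fun i => if i == Ordinal r0 then K else 0).
  by rewrite /ksum -big_mkcond big_pred1_eq.
have den u v : u = v -> (forall k, den_ok q u k) -> nonvanishing q v.
  by move=> <-; exact: nonvanishing_den.
have num u v : u != 0 -> q / u = v -> (forall k, num_ok q u k) -> nonvanishing q v.
  by move=> u0 <-; exact: nonvanishing_num.
have az0 i : a * z i != 0 by rewrite mulf_neq0.
move=> i; rewrite /kcons; case: unliftP => [i' _|_]; split => [j|l].
- case: unliftP => [j' _|_]; split.
  + apply: (den (a * z i' * q / (e j' * z j'))); first by ring.
    by move=> k; case: (H3 (fun _ => k)) => /(_ i' j')[].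
  + apply: (num (b j' * z i' / z j')); [by rewrite !mulf_neq0 ?invr_eq0 | by rewrite !invfM; ring|].
    by move=> k; case: (H3 (fun _ => k)) => /(_ i' j')[].
  + apply: (den (a * z i' * q / d)); first by ring.
    by move=> k; case: (H3 (fun _ => k)) => _ [] /(_ i')[_ [_ [_ []]]].
  + apply: (num (c * z i')); [by rewrite mulf_neq0 | by [] |].
    by move=> k; case: (H3 (fun _ => k)) => _ [] /(_ i')[_ [_ []]].
- split.
  + apply: (den (a * z i' * q / h l)); first by ring.
    by move=> k; case: (H3 (fun _ => k)) => _ [] /(_ i')[_ [_ [_ [_ /(_ l)[]]]]].
  + apply: (num (a * q ^+ (N l).+1 / h l * z i')).
    * by rewrite !mulf_neq0 ?invr_eq0 ?expf_neq0.
    * by rewrite exprS !invfM; ring.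
    * by move=> k; case: (H3 (fun _ => k)) => _ [] /(_ i')[_ [_ [_ [_ /(_ l)[]]]]].
- case: unliftP => [j' _|_]; split.
  + apply: (num (e j' * z j')); [by rewrite mulf_neq0 | by field; rewrite a0 e0 z0|].
    by move=> K; have [k <-] := kex K; case: (H3 k) => _ [] /(_ j')[].
  + apply: (den (a * z j' * q / b j')); first by rewrite !invfM !invrK; ring.
    by move=> K; have [k <-] := kex K; case: (H3 k) => _ [] /(_ j')[_ []].
  + apply: (num d); [by [] | by field; rewrite a0 d0 |].
    by move=> K; have [k <-] := kex K; case: (H3 k) => _ [_ []].
  + apply: (den (a * q / c)); first by rewrite !invfM !invrK; ring.
    by move=> K; have [k <-] := kex K; case: (H3 k) => _ [_ [_ []]].
- split.
  + apply: (num (h l)); [by [] | by field; rewrite a0 h0 |].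
    by move=> K; have [k <-] := kex K; case: (H3 k) => _ [_ [_ [_ /(_ l)[]]]].
  + apply: (den (a * q / (a * q ^+ (N l).+1 / h l))).
      by rewrite exprS; field; rewrite a0 h0 q0 expf_neq0.
    by move=> K; have [k <-] := kex K; case: (H3 k) => _ [_ [_ [_ /(_ l)[]]]].
Qed.

End Inversion.

(** * The prefactor as a ratio of amplitudes and theta products *)

Section Prefactor.
Variable K : fieldType.

Lemma prod_square_pairs n (S : 'I_n -> 'I_n -> K) :
  \prod_(i < n) \prod_(j < n) S i j =
  (\prod_(i < n) S i i) * \prod_(i < n) \prod_(j < n | (i < j)%N) (S i j * S j i).
Proof.
elim: n S => [|n IH] S; first by rewrite !big_ord0 mulr1.
rewrite prod_pairs_recl big_ord_recl [in RHS]big_ord_recl.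
rewrite big_ord_recl.
have -> : \prod_(i < n) \prod_(j < n.+1) S (lift ord0 i) j =
   (\prod_(i < n) S (lift ord0 i) ord0) * \prod_(i < n) \prod_(j < n) S (lift ord0 i) (lift ord0 j).
  by rewrite -big_split; apply: eq_bigr => i _; rewrite big_ord_recl.
rewrite (IH (fun i j => S (lift ord0 i) (lift ord0 j))) [\prod_(j < n) (_ * _)]big_split /=.
by ring.
Qed.

Variables (q a c d F : K) (r s : nat) (b e f z : 'I_r -> K) (h : 'I_s -> K).
Variables (P : K -> K) (Q : 'I_s -> K -> K).
Hypotheses (a0 : a != 0) (c0 : c != 0) (d0 : d != 0) (F0 : F != 0).
Hypotheses (b0 : forall i, b i != 0) (e0 : forall i, e i != 0) (f0 : forall i, f i != 0).
Hypotheses (z0 : forall i, z i != 0) (h0 : forall l, h l != 0).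
Local Ltac fieldnz := field; rewrite ?a0 ?c0 ?d0 ?F0 ?b0 ?e0 ?f0 ?z0 ?h0 ?oner_eq0 //.
Let A := kcons c (fun j => b j / z j).
Let B := kcons (a * q / d) (fun j => a * q / (e j * z j)).
Let Cl l := a * q / h l.
Let x := kcons a^-1 z.
Let y := kcons (F / a) (fun i => z i / f i).
Let amp X := (\prod_l Q l (Cl l * X)) * \prod_j (P (B j * X) * P (q / (A j * X))).
Let Phi (u : 'I_r.+1 -> K) : K :=
  \prod_(i < r.+1) \prod_(j < r.+1 | (i < j)%N) (P (q * u i / u j) * P (q * u j / u i)).

(** A matching of arguments only: P stands for the infinite product and [Q l] for the finite one of
    length N_l, and no property of either is involved beyond P q != 0, by which the diagonal factors
    P q / P q equal 1. *)
Lemma prefactorE : P q != 0 ->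
  (\prod_(j < s) (Q j (F * q / h j) / Q j (q / h j) *
      \prod_(i < r) (Q j (a * z i * q / (f i * h j)) / Q j (a * z i * q / h j)))) *
  (P (F * q / d) * P (a * q / (c * F)) / (P (a * q / c) * P (q / d))) *
  (\prod_(i < r) \prod_(j < r)
     (P (q * z i / z j) * P (a * z i * q / (e j * f i * z j)) * P (f j * z i * q / (b i * z j)) /
      (P (q * f j * z i / (f i * z j)) * P (q * z i / (b i * z j)) * P (a * z i * q / (e j * z j))))) *
  (\prod_(i < r)
     (P (a * z i * q) * P (q / (a * z i)) * P (F * q / (e i * z i)) * P (a * z i * q / (b i * F)) *
      P (a * z i * q / (d * f i)) * P (f i * q / (c * z i)) /
      (P (F * f i * q / (a * z i)) * P (a * z i * q / (F * f i)) * P (a * z i * q / b i) *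
       P (q / (e i * z i)) * P (q / (c * z i)) * P (a * z i * q / d)))) =
  (\prod_i (amp (y i) / amp (x i))) * (Phi x / Phi y).
Proof.
move=> Pq.
pose G i j := P (B j * y i) * P (q / (A j * y i)) / (P (B j * x i) * P (q / (A j * x i))).
pose S i j := P (q * z i / z j) / P (q * f j * z i / (f i * z j)).
have mulfrac (u v u' v' : K) : u * v / (u' * v') = u / u' * (v / v') by rewrite invfM; ring.
have congP (u v : K) : u = v -> P u = P v by move->.
have congQ l (u v : K) : u = v -> Q l u = Q l v by move->.
have E1 : \prod_i (amp (y i) / amp (x i)) =
    (\prod_(j < s) (Q j (F * q / h j) / Q j (q / h j) *
      \prod_(i < r) (Q j (a * z i * q / (f i * h j)) / Q j (a * z i * q / h j)))) *
    \prod_(i < r.+1) \prod_(j < r.+1) G i j.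
  transitivity ((\prod_i \prod_l (Q l (Cl l * y i) / Q l (Cl l * x i))) *
      \prod_(i < r.+1) \prod_(j < r.+1) G i j).
    rewrite -big_split; apply: eq_bigr => i _ /=.
    by rewrite mulfrac -!prodf_div.
  rewrite exchange_big; congr (_ * _); apply: eq_bigr => l _.
  rewrite big_ord_recl; congr (_ / _ * _).
  - by apply: congQ; rewrite /y kcons0 /Cl; fieldnz.
  - by apply: congQ; rewrite /x kcons0 /Cl; fieldnz.
  apply: eq_bigr => i _; congr (_ / _); apply: congQ; rewrite /y /x kconsS /Cl; fieldnz.
have E2 : Phi x / Phi y =
   (\prod_(i < r) (P (a * z i * q) * P (q / (a * z i)) /
      (P (F * f i * q / (a * z i)) * P (a * z i * q / (F * f i))))) *
   \prod_(i < r) \prod_(j < r) S i j.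
  rewrite (prod_square_pairs S) [\prod_i S i i]big1 => [|i _]; last first.
    rewrite /S; have -> : q * z i / z i = q by fieldnz.
    have -> : q * f i * z i / (f i * z i) = q by fieldnz.
    by rewrite divff.
  rewrite mul1r /Phi -prodf_div.
  transitivity (\prod_(i < r.+1) \prod_(j < r.+1 | (i < j)%N)
    (P (q * x i / x j) * P (q * x j / x i) / (P (q * y i / y j) * P (q * y j / y i)))).
    by apply: eq_bigr => i _; rewrite prodf_div.
  rewrite prod_pairs_recl; congr (_ * _).
    apply: eq_bigr => j _; rewrite /x /y !kcons0 !kconsS.
    rewrite [P (q * a^-1 / _) * _]mulrC; congr (_ * _ / (_ * _)); apply: congP; fieldnz.
  apply: eq_bigr => i _; apply: eq_bigr => j _; rewrite /S /x /y !kconsS mulfrac.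
  congr (_ / _ * (_ / _)); apply: congP; fieldnz.
have E3 : \prod_(i < r.+1) \prod_(j < r.+1) G i j =
   (P (F * q / d) * P (a * q / (c * F)) / (P (a * q / c) * P (q / d))) *
   (\prod_(i < r) (P (F * q / (e i * z i)) / P (q / (e i * z i)) *
                   (P (a * z i * q / (b i * F)) / P (a * z i * q / b i)))) *
   (\prod_(i < r) (P (a * z i * q / (d * f i)) / P (a * z i * q / d) *
                   (P (f i * q / (c * z i)) / P (q / (c * z i))))) *
   \prod_(i < r) \prod_(j < r)
     (P (a * z i * q / (e j * f i * z j)) / P (a * z i * q / (e j * z j)) *
      (P (f i * z j * q / (b j * z i)) / P (q * z j / (b j * z i)))).
  rewrite big_ord_recl big_ord_recl.
  have -> : \prod_(i < r) \prod_(j < r.+1) G (lift ord0 i) j =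
     (\prod_(i < r) G (lift ord0 i) ord0) * \prod_(i < r) \prod_(j < r) G (lift ord0 i) (lift ord0 j).
    by rewrite -big_split; apply: eq_bigr => i _; rewrite big_ord_recl.
  rewrite !mulrA; congr (_ * _ * _ * _).
  - rewrite /G /A /B /x /y !kcons0 [P (a * q / c) * _]mulrC.
    congr (_ * _ / (_ * _)); apply: congP; fieldnz.
  - apply: eq_bigr => j _; rewrite /G /A /B /x /y !kcons0 !kconsS mulfrac.
    congr (_ / _ * (_ / _)); apply: congP; fieldnz.
  - apply: eq_bigr => i _; rewrite /G /A /B /x /y !kcons0 !kconsS mulfrac.
    congr (_ / _ * (_ / _)); apply: congP; fieldnz.
  - apply: eq_bigr => i _; apply: eq_bigr => j _; rewrite /G /A /B /x /y !kconsS mulfrac.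
    congr (_ / _ * (_ / _)); apply: congP; fieldnz.
have E4 : \prod_(i < r) \prod_(j < r)
     (P (q * z i / z j) * P (a * z i * q / (e j * f i * z j)) * P (f j * z i * q / (b i * z j)) /
      (P (q * f j * z i / (f i * z j)) * P (q * z i / (b i * z j)) * P (a * z i * q / (e j * z j)))) =
   (\prod_(i < r) \prod_(j < r) S i j) * \prod_(i < r) \prod_(j < r)
     (P (a * z i * q / (e j * f i * z j)) / P (a * z i * q / (e j * z j)) *
      (P (f i * z j * q / (b j * z i)) / P (q * z j / (b j * z i)))).
  have split2 (u v : 'I_r -> 'I_r -> K) : \prod_i \prod_j (u i j * v i j) =
      (\prod_i \prod_j u i j) * \prod_i \prod_j v i j.
    by rewrite -big_split; apply: eq_bigr => i _; rewrite big_split.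
  rewrite (split2 (fun i j => P (a * z i * q / (e j * f i * z j)) / P (a * z i * q / (e j * z j)))).
  (* The factors with b_i carry i and j in the opposite roles from those that arise from [G]. *)
  rewrite [X in _ = _ * (_ * X)]exchange_big -!split2.
  apply: eq_bigr => i _; apply: eq_bigr => j _; rewrite /S !invfM; ring.
rewrite E1 E2 E3 E4.
rewrite [\prod_(i < r) (P (a * z i * q) * _ * _ * _ * _ * _ / _)](eq_bigr (fun i =>
  (P (a * z i * q) * P (q / (a * z i)) /
      (P (F * f i * q / (a * z i)) * P (a * z i * q / (F * f i)))) *
  ((P (F * q / (e i * z i)) / P (q / (e i * z i)) *
                   (P (a * z i * q / (b i * F)) / P (a * z i * q / b i))) *
   (P (a * z i * q / (d * f i)) / P (a * z i * q / d) *
                   (P (f i * q / (c * z i)) / P (q / (c * z i))))))) => [|i _].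
  have split1 (u v w : 'I_r -> K) : \prod_i (u i * (v i * w i)) =
      (\prod_i u i) * ((\prod_i v i) * \prod_i w i).
    by rewrite -!big_split.
  by rewrite split1; ring.
by rewrite !invfM; ring.
Qed.

End Prefactor.

(** * The transformation *)

Section Assembly.
Variable R : realType.
Local Notation C := (Cx R).
Variables (q p : C) (r s : nat).
Hypotheses (q0 : q != 0) (q1 : md q < 1) (p2 : p ^+ 2 = q).

Lemma box_sum_lattice (A B : 'I_r.+1 -> C) (Cl : 'I_s -> C) (N : 'I_s -> nat) (x : 'I_r.+1 -> C) L :
  (forall i, A i != 0) -> (forall l, Cl l != 0) -> (forall i, x i != 0) -> vdm x != 0 ->
  (forall i, regular q A B Cl N (x i)) ->
  box_sum q p A B Cl N x L = vdm x * (\prod_i amplitude q A B Cl N (x i)) *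
    \sum_(t : {ffun 'I_r -> 'I_(L + L).+1})
       lattice_term q A B Cl N x (kcons (- ksum (boxk t)) (boxk t)).
Proof.
move=> A0 Cl0 x0 V0 H; rewrite mulr_sumr; apply: eq_bigr => t _.
exact: (det_term_mx_lattice q0 q1 p2).
Qed.

(** The denominators of the second series speak about the inverted point and inverted parameters;
    reversal carries them back to y with the parameters of the first series. *)
Lemma regular_inv (A B : 'I_r.+1 -> C) (Cl : 'I_s -> C) (N : 'I_s -> nat) (X : C) :
  (forall i, A i != 0) -> (forall i, B i != 0) -> (forall l, Cl l != 0) -> X != 0 ->
  regular q (fun i => q / B i) (fun i => q / A i) (fun l => q / (Cl l * q ^+ N l)) N X^-1 ->
  regular q A B Cl N X.
Proof.
move=> A0 B0 Cl0 X0 [H1 H2]; split=> [j|l].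
  case: (H1 j) => h1 h2; split.
    by move: h2; congr nonvanishing; field; rewrite q0 X0 B0.
  by move: h1; congr nonvanishing; field; rewrite X0 A0.
have qN : q ^+ N l != 0 by rewrite expf_neq0.
case: (H2 l) => h1 h2; split.
  by move: h2; congr nonvanishing; field; rewrite q0 X0 Cl0 qN.
by move: h1; congr nonvanishing; field; rewrite X0 Cl0 qN.
Qed.

Lemma Theta_vdm n (x : 'I_n -> C) : (forall i, x i != 0) ->
  Theta q x = vdm x *
    \prod_(i < n) \prod_(j < n | (i < j)%N) (qpinf q (q * x i / x j) * qpinf q (q * x j / x i)).
Proof.
move=> x0; rewrite -big_split; apply: eq_bigr => i _; rewrite -big_split.
by apply: eq_bigr => j _; exact: theta2E.
Qed.

End Assembly.

Theorem theorem4p2 (R : realType) (q : Cx R) (r s : nat)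
    (a c d : Cx R) (b e f z : 'I_r -> Cx R) (h : 'I_s -> Cx R) (N : 'I_s -> nat) :
  0 < `|q| < 1 ->
  (1 <= r)%N ->
  a != 0 -> c != 0 -> d != 0 ->
  (forall i, b i != 0) -> (forall i, e i != 0) -> (forall i, f i != 0) ->
  (forall i, z i != 0) -> (forall j, h j != 0) ->
  let B := \prod_(i < r) b i in
  let E := \prod_(i < r) e i in
  let F := \prod_(i < r) f i in
  let Nsum := (\sum_(j < s) N j)%N in
  let w := a ^+ r.+1 * q ^ (1 - Nsum%:Z) / (B * c * d * E) in
  (* denominators of the two Psi series *)
  psi_denoms_ok q a b c d e z (fun j => a * q ^+ (N j).+1 / h j) h ->
  psi_denoms_ok q (F / a) (fun i => e i * f i / a) (d / a) (c * F / a)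
    (fun i => b i * F / (a * f i)) (fun i => f i / z i)
    (fun j => h j / a) (fun j => F * q ^+ (N j).+1 / h j) ->
  (* denominators of the prefactor *)
  (forall j, qpoch_n q (q / h j) (N j) != 0) ->
  (forall i j, qpoch_n q (a * z i * q / h j) (N j) != 0) ->
  qpinf q (a * q / c) != 0 -> qpinf q (q / d) != 0 ->
  (forall i j, qpinf q (q * f j * z i / (f i * z j)) != 0
            /\ qpinf q (q * z i / (b i * z j)) != 0
            /\ qpinf q (a * z i * q / (e j * z j)) != 0) ->
  (forall i, qpinf q (F * f i * q / (a * z i)) != 0
          /\ qpinf q (a * z i * q / (F * f i)) != 0
          /\ qpinf q (a * z i * q / b i) != 0
          /\ qpinf q (q / (e i * z i)) != 0
          /\ qpinf q (q / (c * z i)) != 0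
          /\ qpinf q (a * z i * q / d) != 0) ->
  `|w| < 1 ->
  exists L1 L2 : Cx R,
    psi_partial q a b c d e z (fun j => a * q ^+ (N j).+1 / h j) h w n @[n --> \oo] --> L1
    /\ psi_partial q (F / a) (fun i => e i * f i / a) (d / a) (c * F / a)
         (fun i => b i * F / (a * f i)) (fun i => f i / z i)
         (fun j => h j / a) (fun j => F * q ^+ (N j).+1 / h j) w n @[n --> \oo] --> L2
    /\ L1 =
       (\prod_(j < s)
          (qpoch_n q (F * q / h j) (N j) / qpoch_n q (q / h j) (N j)
           * \prod_(i < r) (qpoch_n q (a * z i * q / (f i * h j)) (N j)
                            / qpoch_n q (a * z i * q / h j) (N j))))
       * ((qpinf q (F * q / d) * qpinf q (a * q / (c * F)))
          / (qpinf q (a * q / c) * qpinf q (q / d)))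
       * (\prod_(i < r) \prod_(j < r)
            ((qpinf q (q * z i / z j) * qpinf q (a * z i * q / (e j * f i * z j))
              * qpinf q (f j * z i * q / (b i * z j)))
             / (qpinf q (q * f j * z i / (f i * z j)) * qpinf q (q * z i / (b i * z j))
                * qpinf q (a * z i * q / (e j * z j)))))
       * (\prod_(i < r)
            ((qpinf q (a * z i * q) * qpinf q (q / (a * z i))
              * qpinf q (F * q / (e i * z i)) * qpinf q (a * z i * q / (b i * F))
              * qpinf q (a * z i * q / (d * f i)) * qpinf q (f i * q / (c * z i)))
             / (qpinf q (F * f i * q / (a * z i)) * qpinf q (a * z i * q / (F * f i))
                * qpinf q (a * z i * q / b i) * qpinf q (q / (e i * z i))
                * qpinf q (q / (c * z i)) * qpinf q (a * z i * q / d))))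
       * L2.
Proof.
move=> /andP[q0' q1'] r1 a0 c0 d0 b0 e0 f0 z0 h0 B E F Nsum w okx oky _ _ _ _ Hij Hth w1.
have q0 : q != 0 by rewrite -normr_gt0.
have q1 : md q < 1 by rewrite -md_lt1.
have p2 : sqrtC q ^+ 2 = q by exact: sqrtCK.
have B0 : B != 0 by apply/prodf_neq0.
have E0 : E != 0 by apply/prodf_neq0.
have F0 : F != 0 by apply/prodf_neq0.
have qN n : q ^+ n != 0 by rewrite expf_neq0.
pose A1 := kcons c (fun j => b j / z j).
pose B1 := kcons (a * q / d) (fun j => a * q / (e j * z j)).
pose Cl l := a * q / h l.
pose x := kcons a^-1 z.
pose y := kcons (F / a) (fun i => z i / f i).
have kcons_neq0 (u : Cx R) (v : 'I_r -> Cx R) : u != 0 -> (forall j, v j != 0) ->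
    forall i, kcons u v i != 0.
  by move=> u0 v0 i; rewrite /kcons; case: unliftP.
have A10 : forall i, A1 i != 0.
  by apply: kcons_neq0 => // j; rewrite mulf_neq0 ?invr_eq0.
have B10 : forall i, B1 i != 0.
  by apply: kcons_neq0 => [|j]; rewrite !mulf_neq0 ?invr_eq0 ?mulf_neq0.
have Cl0 l : Cl l != 0 by rewrite !mulf_neq0 ?invr_eq0.
have x0 : forall i, x i != 0 by apply: kcons_neq0 => //; rewrite invr_eq0.
have y0 : forall i, y i != 0.
  by apply: kcons_neq0 => [|j]; rewrite mulf_neq0 ?invr_eq0.
(* The factor F in y_0 compensates the divisors f_i, which fixes the first parameter F/a of the
   second series. *)
have prodxy : \prod_i x i = \prod_i y i.
  rewrite !big_ord_recl /x /y !kcons0.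
  under eq_bigr do rewrite kconsS. under [in RHS]eq_bigr do rewrite kconsS.
  by rewrite prodf_div -/F; field; rewrite a0 F0.
have [regx distx] := regular_of_denoms q0 r1 a0 c0 d0 b0 e0 z0 h0 okx.
have Fa0 : F / a != 0 by rewrite mulf_neq0 ?invr_eq0.
(* With a' = F/a and h'_l = F q^(N_l + 1)/h_l, the entry h_l/a has the shape a' q^(N_l + 1)/h'_l, so
   the second series has the same form as the first. *)
have gE : (fun j => h j / a) = (fun l => F / a * q ^+ (N l).+1 / (F * q ^+ (N l).+1 / h l)).
  apply: funext => l; have := qN (N l).+1; move: (q ^+ _) => u u0.
  by field; rewrite F0 h0 u0 a0.
(* The lattice parameters of the second series. They turn out to be q/B1 and q/A1, those of the
   first series after reversal of k, so the two series share one set of weights. *)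
pose A2 := kcons (d / a) (fun j => e j * f j / a / (f j / z j)).
pose B2 := kcons (F / a * q / (c * F / a)) (fun j => F / a * q / (b j * F / (a * f j) * (f j / z j))).
have A2E : A2 = (fun i => q / B1 i).
  apply: funext => i; rewrite /A2 /B1 /kcons; case: unliftP => [j _|_].
    by field; rewrite q0 a0 e0 z0 f0.
  by field; rewrite q0 a0 d0.
have B2E : B2 = (fun i => q / A1 i).
  apply: funext => i; rewrite /B2 /A1 /kcons; case: unliftP => [j _|_].
    by field; rewrite F0 a0 b0 z0 f0.
  by field; rewrite F0 a0 c0.
have Cl2E : (fun l => F / a * q / (F * q ^+ (N l).+1 / h l)) = (fun l => q / (Cl l * q ^+ N l)).
  apply: funext => l; rewrite /Cl exprS; have := qN (N l); move: (q ^+ _) => u u0.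
  by field; rewrite F0 h0 u0 a0 q0.
have x2E : kcons (F / a)^-1 (fun i => f i / z i) = (fun i => (y i)^-1).
  apply: funext => i; rewrite /y /kcons; case: unliftP => [j _|_] //.
  by rewrite invf_div.
have efa0 i : e i * f i / a != 0 by rewrite !mulf_neq0 ?invr_eq0.
have bF0 i : b i * F / (a * f i) != 0 by rewrite !mulf_neq0 ?invr_eq0 ?mulf_neq0.
have fz0 i : f i / z i != 0 by rewrite mulf_neq0 ?invr_eq0.
have Fqh0 l : F * q ^+ (N l).+1 / h l != 0 by rewrite !mulf_neq0 ?invr_eq0.
have da0 : d / a != 0 by rewrite mulf_neq0 ?invr_eq0.
have cFa0 : c * F / a != 0 by rewrite !mulf_neq0 ?invr_eq0.
have az0 : forall i, 1 - a * z i != 0 by case: okx.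
have az20 : forall i, 1 - F / a * (f i / z i) != 0 by case: oky.
rewrite gE in oky *.
have [regx2 distx2] := regular_of_denoms q0 r1 Fa0 da0 cFa0 efa0 bF0 fz0 Fqh0 oky.
rewrite -/A2 -/B2 A2E B2E Cl2E x2E in regx2 distx2.
have regy i : regular q A1 B1 Cl N (y i) by exact: (regular_inv q0 A10 B10 Cl0 (y0 i) (regx2 i)).
have disty i j : i != j -> y i != y j.
  by move=> /distx2; apply: contra_neq => ->.
have Vx : vdm x != 0 by exact: vdm_neq0.
have Vy : vdm y != 0 by exact: vdm_neq0.
have ampx0 : \prod_i amplitude q A1 B1 Cl N (x i) != 0.
  by apply/prodf_neq0 => i _; exact: amplitude_neq0.
have ampy0 : \prod_i amplitude q A1 B1 Cl N (y i) != 0.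
  by apply/prodf_neq0 => i _; exact: amplitude_neq0.
have wE2 : w = (F / a) ^+ r.+1 * q ^ (1 - (\sum_(l < s) N l)%N%:Z) /
    ((\prod_i (e i * f i / a)) * (d / a) * (c * F / a) * \prod_i (b i * F / (a * f i))).
  rewrite /w -/Nsum !prodf_div !big_split /= -/B -/E -/F !prodr_const card_ord !exprS expr_div_n.
  have ar : a ^+ r != 0 by rewrite expf_neq0.
  have Fr : F ^+ r != 0 by rewrite expf_neq0.
  by field; rewrite a0 F0 ar Fr B0 c0 d0 E0.
have partx L : psi_partial q a b c d e z (fun j => a * q ^+ (N j).+1 / h j) h w L =
    \sum_(t : {ffun 'I_r -> 'I_(L + L).+1})
       lattice_term q A1 B1 Cl N x (kcons (- ksum (boxk t)) (boxk t)).
  by apply: eq_bigr => t _; exact: psi_term_lattice.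
have party L : psi_partial q (F / a) (fun i => e i * f i / a) (d / a) (c * F / a)
    (fun i => b i * F / (a * f i)) (fun i => f i / z i)
    (fun l => F / a * q ^+ (N l).+1 / (F * q ^+ (N l).+1 / h l))
    (fun j => F * q ^+ (N j).+1 / h j) w L =
    \sum_(t : {ffun 'I_r -> 'I_(L + L).+1})
       lattice_term q A1 B1 Cl N y (kcons (- ksum (boxk t)) (boxk t)).
  rewrite -(@box_rev R r L (fun k => lattice_term q A1 B1 Cl N y (kcons (- ksum k) k))).
  apply: eq_bigr => t _.
  rewrite -kcons_opp -(lattice_term_inv q0 N A10 B10 Cl0 y0 (sum_kcons (boxk t))).
  rewrite -A2E -B2E -Cl2E -x2E.
  exact: psi_term_lattice.
(* The convergence ratio is |w|, so the hypothesis on w opens the annulus for v. *)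
have W1 : conv_ratio q A1 B1 N < 1.
  have -> : conv_ratio q A1 B1 N = md w; last by rewrite -md_lt1.
  have -> : w = \prod_(i < r.+1) (B1 i / A1 i) / q ^+ (r + \sum_(l < s) N l)%N.
    rewrite big_ord_recl /A1 /B1 !kcons0.
    rewrite (eq_bigr (fun j => a * q / (e j * b j))) => [|j _]; last first.
      by rewrite !kconsS; field; rewrite e0 z0 b0.
    rewrite /w -/Nsum prodf_div !big_split /= -/B -/E !prodr_const card_ord exprS exprD.
    rewrite expfzDr // expr1z -exprnN.
    by field; rewrite !qN c0 d0 E0 B0.
  by rewrite mdM mdV mdX.
have [lx xl] := box_sum_cvg Cl q0 q1 p2 A10 B10 W1 x0.
have [ly yl] := box_sum_cvg Cl q0 q1 p2 A10 B10 W1 y0.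
pose kx := vdm x * \prod_i amplitude q A1 B1 Cl N (x i).
pose ky := vdm y * \prod_i amplitude q A1 B1 Cl N (y i).
have kx0 : kx != 0 by rewrite mulf_neq0.
have ky0 : ky != 0 by rewrite mulf_neq0.
exists (kx^-1 * lx), (ky^-1 * ly); split; [|split].
- apply/tendsP; apply: eq_tends (tendsZ kx^-1 xl) => L.
  by rewrite partx box_sum_lattice // -/kx mulKf.
- apply/tendsP; apply: eq_tends (tendsZ ky^-1 yl) => L.
  by rewrite party box_sum_lattice // -/ky mulKf.
(* The diagonal case i = j of the first family of denominators has argument q. *)
have qq : qpinf q q != 0.
  have [h1 _] := Hij (Ordinal r1) (Ordinal r1); move: h1.
  congr (qpinf q _ != 0); move: (f0 (Ordinal r1)) (z0 (Ordinal r1)) => f1 z1.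
  by field; rewrite f1 z1.
(* The arguments q y_i/y_j are exactly those of three denominator families of the prefactor: one for
   two positive indices, two for pairs with index 0. *)
have Ty : Theta q y != 0.
  apply: (Theta_neq0 q1) => // i j ij; split; first exact: disty.
  move: ij; rewrite /y /kcons.
  case: unliftP => [i' ->|->]; case: unliftP => [j' ->|->] ij; last by rewrite eqxx in ij.
  - have [h1 _] := Hij i' j'; apply: contra_neq h1 => <-; congr (qpinf q _).
    by field; rewrite ?f0 ?z0.
  - have [_ [h1 _]] := Hth i'; apply: contra_neq h1 => <-; congr (qpinf q _).
    by field; rewrite ?f0 ?z0 ?a0 ?F0.
  - have [h1 _] := Hth j'; apply: contra_neq h1 => <-; congr (qpinf q _).
    by field; rewrite ?f0 ?z0 ?a0 ?F0.
have TE := box_sum_Theta q0 q1 p2 A10 B10 W1 x0 y0 prodxy Ty xl yl.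
have PE := @prefactorE _ q a c d F r s b e f z h (qpinf q) (fun l u => qpoch_n q u (N l))
  a0 c0 d0 F0 b0 e0 f0 z0 h0 qq.
apply: etrans (congr1 (fun u => u * (ky^-1 * ly)) (esym PE)).
rewrite (Theta_vdm q1 x0) (Theta_vdm q1 y0) in TE; rewrite (Theta_vdm q1 y0) mulf_eq0 negb_or in Ty.
case/andP: Ty => _ Py0.
have solve (K : fieldType) (l1 l2 v1 v2 a1 a2 f1 f2 : K) :
    v1 != 0 -> v2 != 0 -> a1 != 0 -> a2 != 0 -> f2 != 0 ->
    l1 * (v2 * f2) = l2 * (v1 * f1) ->
    (v1 * a1)^-1 * l1 = a2 / a1 * (f1 / f2) * ((v2 * a2)^-1 * l2).
  move=> h1 h2 h3 h4 h5 e'; have -> : l1 = l2 * (v1 * f1) / (v2 * f2).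
    by rewrite -e' mulfK // mulf_neq0.
  by field; rewrite h1 h2 h3 h4 h5.
rewrite prodf_div; exact: solve TE.
Qed.
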